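(* Let $f_0\in L^\infty(\mathbb{R}^+)\cap W^1$ be a probability density, i.e. $f_0\ge 0$ and $\int_0^\infty f_0(z)\,dz=1$. Let $r>0$, and let $\alpha:[0,1]\to[0,\infty)$ be continuous on $[0,1]$ and $C^\infty$ on $(0,1]$, monotone, with $\alpha(0)=0$, $\lim_{s\to 0^+}\alpha'(s)=\infty$ and $\alpha''<0$. If the limit $\lim_{s\to 0^+}\frac{(\alpha'(s))^3}{\alpha''(s)}$ exists and is finite, then the fully coupled Boltzmann mean field game system on $\mathbb{R}^+\times[0,T]$ given by $$\partial_t f(z,t)=-\alpha(S(z,t))f(z,t)\int_z^\infty f(y,t)\,dy+f(z,t)\int_0^z\alpha(S(y,t))f(y,t)\,dy,$$ $$\partial_t V(z,t)-rV(z,t)=-\Big[(1-S(z,t))z-\alpha(S(z,t))V(z,t)\int_z^\infty f(y,t)\,dy+\alpha(S(z,t))\int_z^\infty V(y,t)f(y,t)\,dy\Big],$$ $$S(z,t)=\arg\max_{s\in[0,1]}\Big[(1-s)z-\alpha(s)V(z,t)\int_z^\infty f(y,t)\,dy+\alpha(s)\int_z^\infty V(y,t)f(y,t)\,dy\Big],$$ $$f(z,0)=f_0(z),\qquad V(z,T)=0,$$ has a unique local in time solution; that is, for all sufficiently small $T>0$ there is a unique solution $(f,V,S)$ with $f\in C([0,T];W^1)$ and $V\in C([0,T];W^\infty)$.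
   Context: $\mathbb{R}^+=[0,\infty)$. The weighted spaces are $W^\infty:=L^\infty_{1+z}(\mathbb{R}^+)=\{u=(1+z)w : w\in L^\infty(\mathbb{R}^+)\}$ with norm $\|u\|_{W^\infty}=\operatorname{ess\,sup}_z \frac{|u(z)|}{1+z}$, and $W^1:=\{u=\frac{w}{1+z}: w\in L^1(\mathbb{R}^+)\}$ with norm $\|u\|_{W^1}=\int_0^\infty |u(z)|(1+z)\,dz$. Here $f$ is the (nonnegative) density of agents with respect to their knowledge level $z$, $V$ is the value function, $S$ is the optimal fraction of time devoted to learning, $r$ is the discount factor and $\alpha$ is the learning function. The system is posed forward in time for $f$ and backward in time for $V$. *)

(* Defs.v *)
From HB Require Import structures.
From mathcomp Require Import all_boot all_order all_algebra.
From mathcomp Require Import all_classical all_reals all_analysis ess_sup_inf.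

Set Implicit Arguments.
Unset Strict Implicit.
Unset Printing Implicit Defensive.

Import Order.TTheory GRing.Theory Num.Theory.
Import numFieldNormedType.Exports.

Local Open Scope classical_set_scope.
Local Open Scope ring_scope.

(* Iterable derivative relative to a set [A]: at an endpoint belonging to [A]
   it is the one-sided derivative, and values of [f] off [A] are never used
   at points of [A]. *)
Section derivatives_within.
Context {R : realType}.
Implicit Types (A : set R) (f : R -> R).

Definition diff_quot f (s y : R) : R := (f y - f s) / (y - s).

Definition derivable_within A f (s : R) : Prop :=
  cvg (diff_quot f s y @[y --> within A s^']).

Definition derive_within A f (s : R) : R :=
  lim (diff_quot f s y @[y --> within A s^']).

Definition derive_within_n A (n : nat) f : R -> R := iter n (derive_within A) f.

Definition smooth_within A f : Prop :=
  forall (n : nat) (s : R), A s -> derivable_within A (derive_within_n A n f) s.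

End derivatives_within.

(* Elements of the function spaces are represented by functions on [R];
   only their values on [0, +oo[ matter, and only almost everywhere. *)
Section weighted_spaces.
Context {R : realType}.
Implicit Types (u : R -> R).

Definition halfline : set R := `[0, +oo[.

Definition ae_halfline (P : R -> Prop) : Prop :=
  {ae (@lebesgue_measure R), forall z, halfline z -> P z}.

Definition Linfty_norm u : \bar R :=
  ess_sup (@lebesgue_measure R) ((fun z => `|u z|%:E) \_ halfline).

Definition in_Linfty u : Prop :=
  measurable_fun halfline u /\ (Linfty_norm u < +oo)%E.

Definition Winfty_norm u : \bar R := Linfty_norm (fun z => u z / (1 + z)).

Definition in_Winfty u : Prop := in_Linfty (fun z => u z / (1 + z)).

Definition W1_norm u : \bar R :=
  (\int[@lebesgue_measure R]_(z in halfline) (`|u z| * (1 + z))%:E)%E.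

Definition in_W1 u : Prop :=
  (@lebesgue_measure R).-integrable halfline (fun z => (u z * (1 + z))%:E).

End weighted_spaces.

(* A curve in a space of functions of [z], parametrized by time, is written
   [u : R -> R -> R] with arguments [z], [t], in this order. *)
Section curves.
Context {R : realType}.
Implicit Types (N : (R -> R) -> \bar R) (X : (R -> R) -> Prop) (T : R).
Implicit Types (u du : R -> R -> R).

(* [u] belongs to C([0,T]; X), where [N] is the norm of [X]. *)
Definition continuous_curve X N T u : Prop :=
  (forall t, 0 <= t <= T -> X (u ^~ t)) /\
  (forall t, 0 <= t <= T ->
     N (fun z => u z t' - u z t) @[t' --> within `[0, T] (nbhs t)] --> 0%E).

(* [du] is the time derivative of [u] on [0,T] in the norm [N], one-sided at
   both ends. *)
Definition curve_derivative N T u du : Prop :=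
  forall t, 0 <= t <= T ->
    N (fun z => (u z t' - u z t) / (t' - t) - du z t)
      @[t' --> within `[0, T] t^'] --> 0%E.

End curves.

Section boltzmann_mfg.
Context {R : realType}.
Implicit Types (r T : R) (alpha : R -> R) (f V S : R -> R -> R).

Local Notation mu := (@lebesgue_measure R).

(* The expression maximized over the learning time [s]. *)
Definition hamiltonian alpha f V (z t s : R) : R :=
  (1 - s) * z
  - alpha s * V z t * (\int[mu]_(y in `[z, +oo[) f y t)
  + alpha s * (\int[mu]_(y in `[z, +oo[) (V y t * f y t)).

Definition boltzmann_rhs alpha f S (z t : R) : R :=
  - alpha (S z t) * f z t * (\int[mu]_(y in `[z, +oo[) f y t)
  + f z t * (\int[mu]_(y in `[0, z]) (alpha (S y t) * f y t)).

Definition is_argmax (h : R -> R) (s : R) : Prop :=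
  0 <= s <= 1 /\ (forall s', 0 <= s' <= 1 -> h s' <= h s).

Record mfg_solution r alpha (f0 : R -> R) T f V S : Prop := MfgSolution {
  mfg_f_space : continuous_curve in_W1 W1_norm T f ;
  mfg_V_space : continuous_curve in_Winfty Winfty_norm T V ;
  mfg_S_measurable : forall t, 0 <= t <= T -> measurable_fun halfline (S ^~ t) ;
  mfg_S_range : forall z t, 0 <= z -> 0 <= t <= T -> 0 <= S z t <= 1 ;
  mfg_f_eq : curve_derivative W1_norm T f (boltzmann_rhs alpha f S) ;
  mfg_V_eq : curve_derivative Winfty_norm T V
    (fun z t => r * V z t - hamiltonian alpha f V z t (S z t)) ;
  mfg_S_eq : forall t, 0 <= t <= T ->
    ae_halfline (fun z => is_argmax (hamiltonian alpha f V z t) (S z t)) ;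
  mfg_init : ae_halfline (fun z => f z 0 = f0 z) ;
  mfg_final : ae_halfline (fun z => V z T = 0)
}.

End boltzmann_mfg.

(* Main.v *)
Require Import Defs.
From HB Require Import structures.
From mathcomp Require Import all_boot all_order all_algebra.
From mathcomp Require Import all_classical all_reals all_analysis.
From mathcomp Require Import measurable_realfun ess_sup_inf ring lra.

Set Implicit Arguments.
Unset Strict Implicit.
Unset Printing Implicit Defensive.

Import Order.TTheory GRing.Theory Num.Theory.
Import numFieldNormedType.Exports.

Local Open Scope classical_set_scope.
Local Open Scope ring_scope.

(** The control enters both equations only through the number
    B(z) = int_z^oo (V(y) - V(z)) f(y) dy, called [gain] below: for z > 0 the
    maximized expression is z times [payoff] at b = B(z) / z, that is
    z * ((1 - s) + alpha(s) * b).  Strict concavity gives a unique maximizer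
    sigma(b), hence S = sigma(B / z), and the first-order condition
    alpha'(sigma(b)) = 1 / b yields

      d/db alpha(sigma(b)) = - alpha'^3 / alpha''   at s = sigma(b).

    The hypothesis on the limit at 0 keeps this derivative bounded
    ([alpha_ratio_bound]), so alpha o sigma is Lipschitz ([optimal_policy]).

    This makes the learning rate alpha(S) Lipschitz in B with constant L / z
    only, which degenerates as z tends to 0.  The terminal condition repairs
    this: close to the final time V(z,t) is (T - t) z up to a small relative
    error, so that for small z the gain is at least (T - t) m / 4, where m > 0
    is the mean of f_0 ([near_gain_ge]).  Since alpha' tends to infinity,
    alpha'^2 / alpha'' is bounded as well, which bounds the derivative of
    alpha o sigma with respect to log b.  Two states whose gains differ by
    O(T - t) delta therefore have learning rates that differ by O(delta),
    uniformly in z and t ([close_policy_diff]).  The maximal Hamiltonian raises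
    no such difficulty: by the envelope principle it is alpha(1)-Lipschitz in B
    ([max_hamiltonian_lip]).

    Existence.  Write f = f_0 rho.  The integrated system is a fixed-point
    problem for the pair (rho, V), and for small T it is a contraction by 1/2
    in the supremum norm with weights 1 and (T - t)(1 + z) ([step_contract]);
    all functions are kept jointly measurable in (z,t).  The fixed point
    satisfies the equations pointwise.  That they hold in the norms of W^1 and
    W^oo, up to both end points of [0,T], is a separate matter: the learning
    rate is not Lipschitz in time uniformly in z, but the mass of f near z = 0
    is small because f_0 is bounded ([W1_derivative_small]).

    Uniqueness.  A solution is a curve in a function space; its representatives
    carry no regularity in time at a given z.  The estimates are thus run on
    norms, through a mean-value inequality for curves ([curve_growth]).  It
    shows that every solution satisfies the closeness to (f_0, (T - t) z) on
    which the Lipschitz estimates rest ([sol_near]), and that the distance of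
    two solutions, measured in W^1 and in W^oo relative to T - t, can be halved
    again and again ([solutions_close_half]). *)

(** * One-sided derivatives *)

Lemma within_dnbhs_eps (R : realType) (A : set R) (s : R) (P : R -> Prop) :
  (\forall y \near within A s^', P y) <->
  exists2 d, 0 < d & forall y, A y -> y != s -> `|y - s| < d -> P y.
Proof.
split.
  move=> /nbhs_ballP[d /= d0 H]; exists d => // y Ay ys yd.
  by apply: (H y) => //=; rewrite /ball/= distrC.
move=> [d d0 H]; apply/nbhs_ballP; exists d => //= y /=.
by rewrite /ball/= distrC => yd ys Ay; apply: H.
Qed.

Lemma within_nbhs_eps (R : realType) (A : set R) (s : R) (P : R -> Prop) :
  (\forall y \near within A (nbhs s), P y) <->
  exists2 d, 0 < d & forall y, A y -> `|y - s| < d -> P y.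
Proof.
split.
  move=> /nbhs_ballP[d /= d0 H]; exists d => // y Ay yd.
  by apply: (H y) => //=; rewrite /ball/= distrC.
move=> [d d0 H]; apply/nbhs_ballP; exists d => //= y /=.
by rewrite /ball/= distrC => yd Ay; apply: H.
Qed.

Section derivatives_within_itv.
Context {R : realType}.
Implicit Types (A : set R) (g : R -> R) (s a b : R).

Lemma derive_withinP A g s : derivable_within A g s ->
  forall e, 0 < e -> exists2 d, 0 < d & forall y, A y -> y != s ->
    `|y - s| < d -> `|diff_quot g s y - derive_within A g s| < e.
Proof.
move=> dg e e0.
have /cvgrPdist_lt/(_ e e0) : diff_quot g s y @[y --> within A s^'] -->
  derive_within A g s by exact: dg.
move=> /within_dnbhs_eps[d d0 H]; exists d => // y Ay ys yd.
by rewrite distrC; exact: H.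
Qed.

Lemma derivable_within_continuous A g s : derivable_within A g s ->
  g y @[y --> within A (nbhs s)] --> g s.
Proof.
move=> dg; apply/cvgrPdist_lt => e e0; apply/within_nbhs_eps.
have [d d0 H] := derive_withinP dg ltr01.
set K := `|derive_within A g s| + 1.
have K0 : 0 < K by rewrite /K ltr_wpDl.
exists (Order.min d (e / K)); first by rewrite lt_min d0 divr_gt0.
move=> y Ay; rewrite lt_min => /andP[yd ye].
have [->|ys] := eqVneq y s; first by rewrite subrr normr0.
have := H y Ay ys yd => Hy.
have ys0 : y - s != 0 by rewrite subr_eq0.
have -> : g s - g y = - (diff_quot g s y * (y - s)).
  by rewrite /diff_quot divfK// opprB.
rewrite normrN normrM.
apply: (@le_lt_trans _ _ (K * `|y - s|)).
  apply: ler_wpM2r => //; rewrite /K.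
  by have := ler_normD (derive_within A g s) (diff_quot g s y - derive_within A g s);
    rewrite addrC subrK; move: Hy; lra.
by rewrite mulrC -ltr_pdivlMr.
Qed.

(** The smoothness hypotheses speak of difference quotients within a set; in the
    interior they give back the usual derivative, to which the mean value theorem
    applies. *)
Lemma derivable_within_is_derive a b g s : a < s -> s < b ->
  derivable_within `]a, b] g s -> is_derive s 1 g (derive_within `]a, b] g s).
Proof.
move=> as_ sb dg.
have H : h^-1 *: (g (h + s) - g s) @[h --> 0^'] --> derive_within `]a, b] g s.
  apply/cvgrPdist_lt => e e0.
  have [d d0 Hd] := derive_withinP dg e0.
  apply/nbhs_ballP; exists (Order.min d (Order.min (s - a) (b - s))).
    by rewrite /= !lt_min d0/= !subr_gt0 as_.
  move=> h; rewrite /ball/= sub0r normrN !lt_min => /andP[hd /andP[h1 h2]] h0.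
  have := Hd (h + s); rewrite /diff_quot/= in_itv/= addrK distrC mulrC.
  apply => //; first by move: h1 h2; rewrite !ltr_norml; lra.
  by apply: contra h0 => /eqP hs; apply/eqP; lra.
have E : (fun h : R => h^-1 *: ((g \o shift s) (h *: (1 : R)) - g s))
   = fun h : R => h^-1 *: (g (h + s) - g s).
  by apply/funext => h; rewrite /= /GRing.scale/= mulr1.
apply: DeriveDef; first by rewrite /derivable E; apply/cvg_ex; eexists; exact: H.
by rewrite /derive E; apply: cvg_lim.
Qed.

Lemma within_continuous_sub a b g c d : a < c -> d <= b ->
  (forall s, a < s <= b -> derivable_within `]a, b] g s) ->
  {within `[c, d], continuous g}.
Proof.
move=> ac db dg; apply/subspace_continuousP => x /=; rewrite in_itv/= => xcd.
have := @derivable_within_continuous `]a, b] g x.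
move/(_ (dg x ltac:(lra))) => /cvgrPdist_lt H; apply/cvgrPdist_lt => e /H.
move=> /within_nbhs_eps[d' d0 Hd]; apply/within_nbhs_eps; exists d' => // y /=.
by rewrite in_itv/= => ycd; apply: Hd; rewrite /= in_itv/=; lra.
Qed.

End derivatives_within_itv.

(** * The learning function and the optimal policy *)

Section learning_function.
Context {R : realType}.
Variable alpha : R -> R.
Hypothesis alpha_ge0 : forall s : R, 0 <= s <= 1 -> 0 <= alpha s.
Hypothesis alpha_cont : {within `[0, 1], continuous alpha}.
Hypothesis alpha_smooth : smooth_within `]0, 1] alpha.
Hypothesis alpha_mono :
  forall s s' : R, 0 <= s -> s <= s' -> s' <= 1 -> alpha s <= alpha s'.
Hypothesis alpha_0 : alpha 0 = 0.
Hypothesis alpha_deriv_0 :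
  derive_within_n `]0, 1] 1 alpha s @[s --> 0^'+] --> +oo.
Hypothesis alpha_concave :
  forall s : R, 0 < s <= 1 -> derive_within_n `]0, 1] 2 alpha s < 0.
Hypothesis alpha_limit : exists l : R,
  derive_within_n `]0, 1] 1 alpha s ^+ 3 / derive_within_n `]0, 1] 2 alpha s
    @[s --> 0^'+] --> l.

Let a1 := derive_within_n `]0, 1] 1 alpha.
Let a2 := derive_within_n `]0, 1] 2 alpha.

Lemma alpha_derivable (n : nat) (s : R) : 0 < s <= 1 ->
  derivable_within `]0, 1] (derive_within_n `]0, 1] n alpha) s.
Proof. by move=> s01; apply: alpha_smooth; rewrite /= in_itv. Qed.

Lemma alpha_is_derive (s : R) : 0 < s < 1 -> is_derive s 1 alpha (a1 s).
Proof.
move=> /andP[s0 s1]; apply: (derivable_within_is_derive s0 s1).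
by apply: (@alpha_derivable 0%N); rewrite s0 ltW.
Qed.

Lemma alpha1_is_derive (s : R) : 0 < s < 1 -> is_derive s 1 a1 (a2 s).
Proof.
move=> /andP[s0 s1]; apply: (derivable_within_is_derive s0 s1).
by apply: (@alpha_derivable 1%N); rewrite s0 ltW.
Qed.

Lemma alpha_derive_within_cont (n : nat) (c d : R) : 0 < c -> d <= 1 ->
  {within `[c, d], continuous (derive_within_n `]0, 1] n alpha)}.
Proof.
by move=> c0 d1; apply: within_continuous_sub c0 d1 _ => s s01;
  exact: alpha_derivable.
Qed.

Lemma alpha1_decr (s s' : R) : 0 < s -> s < s' -> s' <= 1 -> a1 s' < a1 s.
Proof.
move=> s0 ss' s'1.
have := @ltr0_derive1_decr R a1 s s'; apply => //.
- by move=> x; rewrite in_itv/= => xs; have [] := @alpha1_is_derive x ltac:(lra).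
- move=> x; rewrite in_itv/= => xs.
  have dx := @alpha1_is_derive x ltac:(lra).
  by rewrite derive1E derive_val; apply: alpha_concave; lra.
- exact: (@alpha_derive_within_cont 1%N).
Qed.

Lemma alpha1_ge0 (s : R) : 0 < s <= 1 -> 0 <= a1 s.
Proof.
move=> s01; rewrite leNgt; apply/negP => as0.
have da := @alpha_derivable 0%N s s01.
have [d d0 Hd] := derive_withinP da (e := - a1 s) ltac:(lra).
set y := Order.max (s / 2) (s - d / 2).
have ys : y < s by rewrite /y gt_max; apply/andP; split; lra.
have y0 : s / 2 <= y by rewrite /y le_max lexx.
have yd : s - d / 2 <= y by rewrite /y le_max lexx orbT.
have := Hd y; rewrite /= in_itv/= => /(_ ltac:(lra) ltac:(lra)).
have -> : derive_within `]0, 1] alpha s = a1 s by [].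
have : `|y - s| < d by rewrite ltr_norml; lra.
move=> /[swap] /[apply]; rewrite /diff_quot/= ltr_norml => /andP[_].
have : 0 <= (alpha y - alpha s) / (y - s).
  rewrite -mulrNN -invrN mulr_ge0 ?invr_ge0//.
    by have := @alpha_mono y s ltac:(lra) ltac:(lra) ltac:(lra); lra.
  lra.
lra.
Qed.

(** Near 0 the first bound is the hypothesis on the limit and the second follows
    because alpha' >= 1 there; away from 0 both hold by compactness, since alpha'' is
    continuous and negative. *)
Lemma alpha_ratio_bound : exists2 L, 0 < L & forall s : R, 0 < s <= 1 ->
  a1 s ^+ 3 <= L * - a2 s /\ a1 s ^+ 2 <= L * - a2 s.
Proof.
have [l Hl] := alpha_limit.
have [d1 d10 H1] : exists2 d, 0 < d & forall s : R, 0 < s < d -> s <= 1 ->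
    a1 s ^+ 3 <= (`|l| + 1) * - a2 s /\ 1 <= a1 s.
  have : \forall s \near 0^'+, `|l - a1 s ^+ 3 / a2 s| < 1 /\ 1 <= a1 s.
    near=> s; split; near: s.
      by move/cvgrPdist_lt : Hl => /(_ 1 ltr01).
    by move/cvgryPge : alpha_deriv_0; exact.
  move=> /nbhs_ballP[d /= d0 H]; exists d => // s /andP[s0 sd] s1.
  have [] := H s _ s0; first by rewrite /ball/= sub0r normrN gtr0_norm.
  move=> Hs ->; split=> //.
  have a20 : a2 s < 0 by apply: alpha_concave; rewrite s0.
  have : - (`|l| + 1) <= a1 s ^+ 3 / a2 s.
    have := ler_norm l; have := ler_norm (- l); rewrite normrN.
    by move: Hs; rewrite ltr_norml; lra.
  by rewrite ler_ndivlMr//; lra.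
(* The limit governs ]0, c[; on [c, 1] the extreme value theorem does. *)
set c := Order.min 1 (d1 / 2).
have c0 : 0 < c by rewrite lt_min ltr01 divr_gt0.
have c1 : c <= 1 by rewrite ge_min lexx.
have cd : c < d1 by rewrite gt_min; apply/orP; right; lra.
have [m1 m1in Hm1] := @EVT_max R a2 c 1 c1
  (@alpha_derive_within_cont 2%N c 1 c0 (lexx _)).
move: m1in; rewrite in_itv/= => m1in.
have k0 : 0 < - a2 m1 by have := @alpha_concave m1 ltac:(lra); rewrite -/a2; lra.
set M := a1 c ^+ 3 + a1 c ^+ 2.
have ac0 : 0 <= a1 c by apply: alpha1_ge0; rewrite c0.
have M0 : 0 <= M by rewrite /M addr_ge0 ?exprn_ge0.
exists (`|l| + 1 + M / - a2 m1).
  have q0 : 0 <= M / - a2 m1 by rewrite divr_ge0// ltW.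
  by have := normr_ge0 l; lra.
move=> s /andP[s0 s1].
have a20 : 0 < - a2 s by have := @alpha_concave s ltac:(lra); rewrite -/a2; lra.
have a10 : 0 <= a1 s by apply: alpha1_ge0; rewrite s0.
have q0 : 0 <= M / - a2 m1 by rewrite divr_ge0// ltW.
have [sc|cs] := ltP s c.
  have [h1 h2] := H1 s ltac:(lra) s1.
  have h3 : a1 s ^+ 2 <= a1 s ^+ 3.
    by rewrite [leRHS]exprS ler_peMl ?exprn_ge0.
  have h4 : 0 <= M / - a2 m1 * - a2 s by rewrite mulr_ge0 ?(ltW a20).
  rewrite mulrDl; lra.
have h1 : a1 s <= a1 c.
  have [->//|sc] := eqVneq s c; apply/ltW/alpha1_decr => //.
  by rewrite lt_neqAle eq_sym sc.
have h2 : M <= M / - a2 m1 * - a2 s.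
  rewrite -mulrA ler_peMr//.
  rewrite mulrC ler_pdivlMr// mul1r lerN2; apply: Hm1.
  by rewrite in_itv/= cs.
have h3 : a1 s ^+ 3 <= a1 c ^+ 3 by rewrite lerXn2r ?nnegrE.
have h4 : a1 s ^+ 2 <= a1 c ^+ 2 by rewrite lerXn2r ?nnegrE.
have : 0 <= a1 c ^+ 3 by rewrite exprn_ge0.
have : 0 <= a1 c ^+ 2 by rewrite exprn_ge0.
have : 0 <= (`|l| + 1) * - a2 s.
  by rewrite mulr_ge0 ?(ltW a20)//; have := normr_ge0 l; lra.
by move: h2; rewrite {1}/M [X in _ <= X /\ _]mulrDl [X in _ /\ _ <= X]mulrDl; lra.
Unshelve. all: by end_near. Qed.

(** A mean value inequality: the hypothesis compares alpha' with the derivative of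
    L * phi(alpha').  It is used with phi(x) = 1/x and phi(x) = - ln x. *)
Lemma alpha_incr_le_comp (L : R) (phi dphi : R -> R) :
  (forall x : R, 0 < x -> is_derive x 1 phi (dphi x)) ->
  (forall s : R, 0 < s < 1 -> 0 < a1 s -> a1 s <= L * (dphi (a1 s) * a2 s)) ->
  forall s s' : R, 0 < s -> s < s' -> s' <= 1 -> 0 < a1 s' ->
    alpha s' - alpha s <= L * (phi (a1 s') - phi (a1 s)).
Proof.
move=> dP HL s s' s0 ss' s'1 as'.
pose h x := L * phi (a1 x) - alpha x.
have apos x : s <= x <= s' -> 0 < a1 x.
  move=> xs; have [->//|xs'] := eqVneq x s'.
  by apply: lt_trans as' _; apply: alpha1_decr; lra.
have dh x : s < x < s' -> is_derive x 1 h (L * (dphi (a1 x) * a2 x) - a1 x).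
  move=> xs.
  have d1 := @alpha1_is_derive x ltac:(lra).
  have d0 := @alpha_is_derive x ltac:(lra).
  have dV := is_derive1_comp (dP _ (@apos x ltac:(lra))) d1.
  rewrite /h; apply: is_deriveB.
suff : h s <= h s' by rewrite /h; lra.
have := @ger0_derive1_ndecr R h s s'; apply => //; last exact: ltW.
- by move=> x; rewrite in_itv/= => /dh[].
- move=> x; rewrite in_itv/= => xs; have dx := dh _ xs.
  rewrite derive1E derive_val.
  have ax := @apos x ltac:(lra).
  by have := HL x ltac:(lra) ax; lra.
- have /subspace_continuousP c1 := @alpha_derive_within_cont 1%N s s' s0 s'1.
  have /subspace_continuousP c0 := @alpha_derive_within_cont 0%N s s' s0 s'1.
  apply/subspace_continuousP => x xs; apply: cvgB; last exact: c0.
  apply: cvgM; first exact: cvg_cst.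
  apply: (cvg_comp _ _ (c1 _ xs)).
  have ax : 0 < a1 x by apply: apos; move: xs; rewrite /= in_itv.
  have [dx _] := dP _ ax.
  have cx : {for a1 x, continuous phi}.
    exact/differentiable_continuous/derivable1_diffP.
  exact: cx.
Qed.

Lemma alpha_incr_le_inv (L : R) :
  (forall s : R, 0 < s <= 1 -> a1 s ^+ 3 <= L * - a2 s) ->
  forall s s' : R, 0 < s -> s < s' -> s' <= 1 -> 0 < a1 s' ->
    alpha s' - alpha s <= L * ((a1 s')^-1 - (a1 s)^-1).
Proof.
move=> HL; apply: (@alpha_incr_le_comp L (fun x => x^-1) (fun x => - x ^- 2)).
  move=> x x0.
  have := @is_deriveV R id x 1 1 (lt0r_neq0 x0) (is_derive_id _ _).
  by rewrite /GRing.scale/= mulr1.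
move=> s s01 as0; have := HL s ltac:(lra) => Hs.
by rewrite mulNr -mulrN mulrCA mulrC ler_pdivlMr ?exprn_gt0// -exprS.
Qed.

Lemma alpha_incr_le_ln (L : R) :
  (forall s : R, 0 < s <= 1 -> a1 s ^+ 2 <= L * - a2 s) ->
  forall s s' : R, 0 < s -> s < s' -> s' <= 1 -> 0 < a1 s' ->
    alpha s' - alpha s <= L * (ln (a1 s) - ln (a1 s')).
Proof.
move=> HL s s' s0 ss' s'1 as'.
have -> : ln (a1 s) - ln (a1 s') = - ln (a1 s') - - ln (a1 s).
  by rewrite opprK addrC.
apply: (@alpha_incr_le_comp L (fun x => - ln x) (fun x => - x^-1)) => //.
  by move=> x x0; have := is_deriveN (is_derive1_ln x0).
move=> x x01 ax; have := HL x ltac:(lra) => Hs.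
by rewrite mulNr -mulrN mulrCA mulrC ler_pdivlMr// -expr2.
Qed.

(** The maximized expression divided by z, as a function of b = [gain] / z. *)
Definition payoff (b s : R) : R := (1 - s) + alpha s * b.

Lemma argmax_secant b S y : is_argmax (payoff b) S -> 0 <= y <= 1 -> y != S ->
  if y < S then 1 <= diff_quot alpha S y * b
  else diff_quot alpha S y * b <= 1.
Proof.
move=> [S01 HS] y01 yS; have := HS y y01; rewrite /payoff => H.
rewrite /diff_quot; case: ifP => [ys|/negbT]; last rewrite -leNgt => sy.
  rewrite -[X in X / _]opprB -[X in _ / X]opprB invrN mulrNN mulrAC.
  by rewrite ler_pdivlMr; lra.
have yS' : S < y by rewrite lt_neqAle eq_sym yS.
by rewrite mulrAC ler_pdivrMr; lra.
Qed.

(** The first-order condition from the left; at an interior maximizer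
    [argmax_lt1] gives the reverse inequality, whence alpha'(S) = 1 / b. *)
Lemma argmax_pos b S : is_argmax (payoff b) S -> 0 < S ->
  0 < b /\ 1 <= a1 S * b.
Proof.
move=> HS S0; have [S01 H] := HS.
have b0 : 0 < b.
  rewrite ltNge; apply/negP => b0.
  have := H 0 ltac:(lra); rewrite /payoff alpha_0 mul0r.
  have : alpha S * b <= 0 by rewrite mulr_ge0_le0// alpha_ge0.
  lra.
split => //; rewrite leNgt; apply/negP => ab.
have e0 : 0 < (1 - a1 S * b) / b by rewrite divr_gt0// subr_gt0.
have [d d0 Hd] := derive_withinP (@alpha_derivable 0%N S ltac:(lra)) e0.
set y := Order.max (S / 2) (S - d / 2).
have ys : y < S by rewrite /y gt_max; apply/andP; split; lra.
have y0 : S / 2 <= y by rewrite /y le_max lexx.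
have yd : S - d / 2 <= y by rewrite /y le_max lexx orbT.
have := @argmax_secant b S y HS ltac:(lra) ltac:(lra); rewrite ys.
have : `|y - S| < d by rewrite ltr_norml; lra.
have := Hd y; rewrite /= in_itv/= => /(_ ltac:(lra) ltac:(lra)) /[apply].
rewrite -/(a1 S) ltr_norml ltr_pdivlMr// => /andP[_].
have -> : derive_within `]0, 1] alpha S = a1 S by [].
by lra.
Qed.

Lemma argmax_lt1 b S : is_argmax (payoff b) S -> 0 < S -> S < 1 ->
  a1 S * b <= 1.
Proof.
move=> HS S0 S1; have [S01 H] := HS.
have [b0 _] := argmax_pos HS S0.
rewrite leNgt; apply/negP => ab.
have e0 : 0 < (a1 S * b - 1) / b by rewrite divr_gt0// subr_gt0.
have [d d0 Hd] := derive_withinP (@alpha_derivable 0%N S ltac:(lra)) e0.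
set y := Order.min ((S + 1) / 2) (S + d / 2).
have ys : S < y by rewrite /y lt_min; apply/andP; split; lra.
have y1 : y <= (S + 1) / 2 by rewrite /y ge_min lexx.
have yd : y <= S + d / 2 by rewrite /y ge_min lexx orbT.
have := @argmax_secant b S y HS ltac:(lra) ltac:(lra).
rewrite ltNge (ltW ys)/=.
have : `|y - S| < d by rewrite ltr_norml; lra.
have := Hd y; rewrite /= in_itv/= => /(_ ltac:(lra) ltac:(lra)) /[apply].
have -> : derive_within `]0, 1] alpha S = a1 S by [].
rewrite distrC ltr_norml ltr_pdivlMr// => /andP[_].
by lra.
Qed.

(** For b > 0 the infinite slope of alpha at 0 makes a little learning
    profitable. *)
Lemma argmax_0 b : is_argmax (payoff b) 0 -> b <= 0.
Proof.
move=> [_ H]; rewrite leNgt; apply/negP => b0.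
have : \forall s \near 0^'+, 2 / b <= a1 s.
  by move/cvgryPge : alpha_deriv_0; exact.
move=> /nbhs_ballP[d /= d0 Hd].
set s := Order.min 1 (d / 2).
have s0 : 0 < s by rewrite lt_min ltr01 divr_gt0.
have s1 : s <= 1 by rewrite ge_min lexx.
have sd : s < d by rewrite gt_min; apply/orP; right; lra.
have [x|x|c] := @MVT R alpha a1 0 s s0.
- by rewrite in_itv/= => xs; apply: alpha_is_derive; lra.
- apply: (continuous_subspaceW _ alpha_cont) => y;
    by rewrite /= !in_itv/=; lra.
- rewrite in_itv/= => c0s; rewrite alpha_0 !subr0 => E.
  have := H s ltac:(lra); rewrite /payoff alpha_0 mul0r E.
  have : 2 / b <= a1 c.
    by apply: Hd; [rewrite /ball/= sub0r normrN gtr0_norm; lra|lra].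
  rewrite ler_pdivrMr// => h1.
  have : 2 * s <= (a1 c * b) * s by rewrite ler_pM2r.
  lra.
Qed.

Lemma alpha_small e : 0 < e -> exists2 d, 0 < d &
  forall s : R, 0 < s -> s < d -> s <= 1 -> alpha s < e.
Proof.
move=> e0; have /subspace_continuousP := alpha_cont.
move=> /(_ 0); rewrite /= in_itv/= lexx ler01 => /(_ isT).
move=> /cvgrPdist_lt/(_ _ e0)/within_nbhs_eps[d d0 Hd]; exists d => // s s0 sd s1.
have := Hd s; rewrite /from_subspace alpha_0 /= in_itv/= sub0r subr0 normrN.
move=> /(_ ltac:(lra)).
by rewrite gtr0_norm// => /(_ sd); rewrite ltr_norml => /andP[].
Qed.

Lemma argmax_alpha_lt b1 b2 S1 S2 :
  is_argmax (payoff b1) S1 -> is_argmax (payoff b2) S2 -> S1 < S2 ->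
  alpha S1 < alpha S2.
Proof.
move=> [S1r H1] [S2r H2] S12; rewrite lt_neqAle.
rewrite alpha_mono ?andbT//; try lra.
apply/eqP => E; have := H2 S1 S1r; rewrite /payoff E; lra.
Qed.

(** Since 1 / alpha'(S) equals b at an interior maximizer, [alpha_incr_le_inv]
    turns into a Lipschitz bound in b. *)
Lemma argmax_alpha_diff (L : R) : 0 < L ->
  (forall s : R, 0 < s <= 1 -> a1 s ^+ 3 <= L * - a2 s) ->
  forall b1 b2 S1 S2,
  is_argmax (payoff b1) S1 -> is_argmax (payoff b2) S2 -> S1 < S2 ->
  alpha S2 - alpha S1 <= L * (b2 - b1).
Proof.
move=> L0 HL b1 b2 S1 S2 A1 A2 S12.
have [[S1r H1] [S2r H2]] := (A1, A2).
have [b20 ab2] := argmax_pos A2 (@le_lt_trans _ _ S1 0 S2 ltac:(lra) S12).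
have aS2 : 0 < a1 S2.
  by rewrite -(pmulr_lgt0 _ b20) (lt_le_trans ltr01).
have iS2 : (a1 S2)^-1 <= b2 by rewrite -div1r ler_pdivrMr// mulrC.
have [S10|S10] := ltP 0 S1.
  have [b10 ab1] := argmax_pos A1 S10.
  have ab1' := argmax_lt1 A1 S10 ltac:(lra).
  have aS1 : 0 < a1 S1 by rewrite -(pmulr_lgt0 _ b10) (lt_le_trans ltr01).
  have iS1 : b1 <= (a1 S1)^-1 by rewrite -[leRHS]div1r ler_pdivlMr// mulrC.
  apply: le_trans (alpha_incr_le_inv HL S10 S12 (elimT andP S2r).2 aS2) _.
  by rewrite ler_pM2l//; lra.
have S1E : S1 = 0 by lra.
move: A1; rewrite S1E => /argmax_0 b10; rewrite alpha_0 subr0.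
(* At S1 = 0 there is no alpha'(S1); compare with a small s > 0 and let it
   tend to 0. *)
apply/ler_addgt0Pr => e e0.
have [d d0 Hd] := alpha_small e0.
set s := Order.min (S2 / 2) (d / 2).
have s0 : 0 < s by rewrite lt_min; apply/andP; split; lra.
have s1 : s <= S2 / 2 by rewrite ge_min lexx.
have sd : s <= d / 2 by rewrite ge_min lexx orbT.
have ae := Hd s s0 ltac:(lra) ltac:(lra).
have := alpha_incr_le_inv HL s0 (s' := S2) ltac:(lra) ltac:(lra) aS2.
have : 0 <= L * (a1 s)^-1.
  by rewrite mulr_ge0 ?invr_ge0 ?(ltW L0)// alpha1_ge0//; lra.
have : L * (a1 S2)^-1 <= L * (b2 - b1) by rewrite ler_pM2l//; lra.
by rewrite mulrBr; lra.
Qed.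

(** The same with ln(1 / alpha'(S)) = ln b and ln(b2 / b1) <= (b2 - b1) / b1. *)
Lemma argmax_alpha_diff_ln (L : R) : 0 < L ->
  (forall s : R, 0 < s <= 1 -> a1 s ^+ 2 <= L * - a2 s) ->
  forall b1 b2 S1 S2, 0 < b1 ->
  is_argmax (payoff b1) S1 -> is_argmax (payoff b2) S2 -> S1 < S2 ->
  alpha S2 - alpha S1 <= L * ((b2 - b1) / b1).
Proof.
move=> L0 HL b1 b2 S1 S2 b10 A1 A2 S12.
have [[S1r H1] [S2r H2]] := (A1, A2).
have [b20 ab2] := argmax_pos A2 (@le_lt_trans _ _ S1 0 S2 ltac:(lra) S12).
have aS2 : 0 < a1 S2.
  by rewrite -(pmulr_lgt0 _ b20) (lt_le_trans ltr01).
have iS2 : b2^-1 <= a1 S2 by rewrite -div1r ler_pdivrMr// mulrC.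
have [S10|S10] := ltP 0 S1; last first.
  have S1E : S1 = 0 by lra.
  by move: A1; rewrite S1E => /argmax_0; lra.
have [_ ab1] := argmax_pos A1 S10.
have ab1' := argmax_lt1 A1 S10 ltac:(lra).
have aS1 : 0 < a1 S1 by rewrite -(pmulr_lgt0 _ b10) (lt_le_trans ltr01).
have iS1 : a1 S1 <= b1^-1 by rewrite -[leRHS]div1r ler_pdivlMr// mulrC.
apply: le_trans (alpha_incr_le_ln HL S10 S12 (elimT andP S2r).2 aS2) _.
rewrite ler_pM2l//.
have l1 : ln (a1 S1) <= - ln b1 by rewrite -lnV ?ler_ln ?posrE ?invr_gt0.
have l2 : - ln b2 <= ln (a1 S2) by rewrite -lnV ?ler_ln ?posrE ?invr_gt0.
have l3 : ln (b2 / b1) <= (b2 - b1) / b1.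
  have -> : b2 / b1 = 1 + (b2 - b1) / b1 by field; rewrite gt_eqF.
  by apply: le_ln1Dx; rewrite ltr_pdivlMr// mulN1r -subr_gt0 opprK subrK.
apply: le_trans l3; rewrite ln_div ?posrE// [leLHS]addrC.
by apply: lerD => //; rewrite lerNl.
Qed.

Lemma argmax_payoff_exists b : exists S, is_argmax (payoff b) S.
Proof.
have cp : {within `[0, 1], continuous (payoff b)}.
  have /subspace_continuousP ca := alpha_cont.
  apply/subspace_continuousP => x x01; apply: cvgD.
    by apply: cvgB; [exact: cvg_cst|apply: cvg_within_filter; exact: cvg_id].
  by apply: cvgM; [exact: ca|exact: cvg_cst].
have [c] := EVT_max ler01 cp.
rewrite in_itv/= => c01 H; by exists c; split.
Qed.

(** Uniqueness of the maximizer comes from [argmax_alpha_diff] too: two maximizers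
    at the same b would have the same value of alpha.  The last bound, in substance
    a Lipschitz bound in ln b, is the one that is uniform for small z. *)
Theorem optimal_policy : exists (sigma : R -> R) (L : R), [/\ 0 < L,
  forall b, is_argmax (payoff b) (sigma b) /\
    forall s, is_argmax (payoff b) s -> s = sigma b,
  {homo sigma : b1 b2 / b1 <= b2},
  forall b1 b2, `|alpha (sigma b1) - alpha (sigma b2)| <= L * `|b1 - b2| &
  forall b1 b2 beta, 0 < beta -> beta <= b1 -> beta <= b2 ->
    `|alpha (sigma b1) - alpha (sigma b2)| <= L * (`|b1 - b2| / beta)].
Proof.
have [sigma Hs] := choice argmax_payoff_exists.
have [L L0 HL] := alpha_ratio_bound.
have HL3 s s01 := (HL s s01).1.
have HL2 s s01 := (HL s s01).2.
have mono b1 b2 S1 S2 : is_argmax (payoff b1) S1 ->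
    is_argmax (payoff b2) S2 -> S1 < S2 -> b1 < b2.
  move=> A1 A2 S12; have := argmax_alpha_diff L0 HL3 A1 A2 S12.
  have := argmax_alpha_lt A1 A2 S12 => h1 h2.
  by rewrite -subr_gt0 -(pmulr_rgt0 _ L0); lra.
exists sigma, L; split => //.
- move=> b; split=> // s As; have [h|h|//] := ltgtP s (sigma b).
    by have := mono _ _ _ _ As (Hs b) h; rewrite ltxx.
  by have := mono _ _ _ _ (Hs b) As h; rewrite ltxx.
- move=> b1 b2 b12; rewrite leNgt; apply/negP => /(mono _ _ _ _ (Hs b2) (Hs b1)).
  by rewrite ltNge b12.
- move=> b1 b2; wlog S12 : b1 b2 / sigma b1 <= sigma b2.
    move=> W; have [|/ltW] := leP (sigma b1) (sigma b2); first exact: W.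
    by move/W; rewrite distrC [X in _ * X]distrC.
  move: S12; rewrite le_eqVlt => /predU1P[->|S12].
    by rewrite subrr normr0 mulr_ge0// ltW.
  have h := argmax_alpha_lt (Hs b1) (Hs b2) S12.
  rewrite distrC gtr0_norm ?subr_gt0//.
  apply: le_trans (argmax_alpha_diff L0 HL3 (Hs b1) (Hs b2) S12) _.
  by rewrite ler_pM2l// distrC ler_norm.
- move=> b1 b2 beta beta0; wlog S12 : b1 b2 / sigma b1 <= sigma b2.
    move=> W h1 h2; have [|/ltW] := leP (sigma b1) (sigma b2).
      by move=> /W; apply.
    by move/W; rewrite distrC [X in _ * (X / _)]distrC; apply.
  move=> h1 h2.
  move: S12; rewrite le_eqVlt => /predU1P[->|S12].
    by rewrite subrr normr0 mulr_ge0 ?divr_ge0// ltW.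
  have h := argmax_alpha_lt (Hs b1) (Hs b2) S12.
  have b12 := mono _ _ _ _ (Hs b1) (Hs b2) S12.
  rewrite distrC gtr0_norm ?subr_gt0//.
  apply: le_trans (argmax_alpha_diff_ln L0 HL2 _ (Hs b1) (Hs b2) S12) _.
    exact: lt_le_trans h1.
  rewrite ler_pM2l// distrC gtr0_norm ?subr_gt0// ler_pM2l ?subr_gt0//.
  by rewrite lef_pV2// posrE// (lt_le_trans _ h1).
Qed.

End learning_function.

(** * Weighted norms and integral operators *)

Section weighted_norms.
Context {R : realType}.
Local Notation mu := (@lebesgue_measure R).
Implicit Types (u v f g h V a : R -> R) (z c : R) (A : set R).

Lemma halflineE z : halfline z = (0 <= z) :> Prop.
Proof. by rewrite /halfline/= in_itv/= andbT. Qed.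

Lemma measurable_halfline : measurable (@halfline R).
Proof. exact: measurable_itv. Qed.
Hint Resolve measurable_halfline : core.

Lemma tail_sub_halfline z : 0 <= z -> `[z, +oo[ `<=` halfline.
Proof.
by move=> z0 y /=; rewrite halflineE in_itv/= andbT; exact: le_trans.
Qed.

Lemma init_sub_halfline z : `[0, z] `<=` halfline.
Proof. by move=> y /=; rewrite halflineE in_itv/= => /andP[]. Qed.

Lemma ae_halfline_pos (P : R -> Prop) :
  (forall z, 0 < z -> P z) -> ae_halfline P.
Proof.
move=> H; exists [set 0]; split => //; first exact: lebesgue_measure_set1.
move=> z /= /not_implyP[]; rewrite halflineE => z0 Pz.
apply/eqP/negPn/negP => zn0; apply: Pz; apply: H.
by rewrite lt_neqAle eq_sym zn0.
Qed.

Lemma ae_halflineW (P : R -> Prop) : (forall z, 0 <= z -> P z) -> ae_halfline P.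
Proof. by move=> H; apply: ae_halfline_pos => z /ltW; exact: H. Qed.

Let ae_filter : Filter (almost_everywhere mu).
Proof. exact: ae_filter_ringOfSetsType. Qed.

Lemma ae_halflineS (P Q : R -> Prop) : (forall z, 0 < z -> P z -> Q z) ->
  ae_halfline P -> ae_halfline Q.
Proof.
move=> H aP.
have aH : ae_halfline (fun z => P z -> Q z) by exact: ae_halfline_pos.
apply: (@filterS2 _ _ ae_filter) aH aP => z PQ Pz hz.
by apply: PQ => //; exact: Pz.
Qed.

Lemma ae_halflineI (P Q : R -> Prop) :
  ae_halfline P -> ae_halfline Q -> ae_halfline (fun z => P z /\ Q z).
Proof. by apply: (@filterS2 _ _ ae_filter) => z HP HQ hz; split; [exact: HP|exact: HQ]. Qed.

Lemma inv_measurable : measurable_fun setT (fun x : R => x^-1).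
Proof.
have -> : (fun x : R => x^-1) = (fun x => (Order.max x 0) `^ (-1)) \-
    (fun x => (Order.max (- x) 0) `^ (-1)).
  apply/funext => x /=; have /orP[x0|x0] := le_total 0 x.
    by rewrite max_l// max_r ?oppr_le0// !powR_inv1// invr0 subr0.
  rewrite max_r// max_l ?oppr_ge0// !powR_inv1 ?oppr_ge0//.
  by rewrite invr0 sub0r invrN opprK.
apply: measurable_funB.
  apply: (measurableT_comp (@measurable_powR R (-1))).
  exact: measurable_maxr.
apply: (measurableT_comp (@measurable_powR R (-1))).
by apply: measurable_maxr => //; exact: oppr_measurable.
Qed.

(** The hypotheses under which an integral is well defined and bounded by that of
    [h], on every subset of the half-line. *)
Definition dominated g h := [/\ measurable_fun halfline g,
  mu.-integrable halfline (EFin \o h), forall z, 0 <= z -> 0 <= h z &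
  ae_halfline (fun z => `|g z| <= h z)].

Lemma dominated_integrable g h : dominated g h ->
  mu.-integrable halfline (EFin \o g).
Proof.
move=> [mg ih h0 gh]; apply/integrableP; split; first exact/measurable_EFinP.
have /integrableP[mh hoo] := ih.
apply: le_lt_trans hoo; apply: ae_ge0_le_integral => //.
- by apply: measurableT_comp => //; exact/measurable_EFinP.
- by apply: measurableT_comp.
- apply: (@filterS _ _ ae_filter) gh => z H hz /=; rewrite lee_fin (le_trans (H hz))//.
  exact: ler_norm.
Qed.

Lemma dominated_Rintegral g h A : dominated g h -> measurable A ->
  A `<=` halfline -> `|\int[mu]_(z in A) g z| <= \int[mu]_(z in halfline) h z.
Proof.
move=> gh mA AH; have ig := dominated_integrable gh.
have [mg ih h0 ghle] := gh.
have igA : mu.-integrable A (EFin \o g) by exact: integrableS ig.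
apply: le_trans (@le_normr_Rintegral _ _ _ mu _ _ mA igA) _.
rewrite /Rintegral; apply: fine_le.
- by apply: integrable_fin_num => //; exact: (integrable_abse igA).
- exact: integrable_fin_num.
have mag : measurable_fun halfline (fun z => `|g z|%:E).
  by apply/measurable_EFinP; apply: measurableT_comp.
apply: (@le_trans _ _ (\int[mu]_(z in halfline) `|g z|%:E)%E).
  exact: ge0_subset_integral.
apply: ae_ge0_le_integral => //.
- by move=> z; rewrite halflineE => /h0.
- by case/integrableP : ih.
Qed.

(** The norm of W^1 as a real number. *)
Definition N1 u : R := \int[mu]_(z in halfline) (`|u z| * (1 + z)).

Lemma in_W1_measurable u : in_W1 u -> measurable_fun halfline u.
Proof.
move=> /integrableP[/measurable_EFinP mu_ _].
have mi : measurable_fun (@halfline R) (fun z => (1 + z)^-1).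
  apply: measurable_funTS; apply: (measurableT_comp inv_measurable).
  exact: measurable_funD.
have := measurable_funM mu_ mi; apply: eq_measurable_fun => z.
rewrite inE halflineE => z0 /=; rewrite mulfK//.
by rewrite gt_eqF// ltr_pwDl.
Qed.

Lemma in_W1_abs u : in_W1 u ->
  mu.-integrable halfline (EFin \o (fun z => `|u z| * (1 + z))).
Proof.
move=> /integrable_abse; apply: eq_integrable => // z; rewrite inE halflineE.
by move=> z0 /=; rewrite normrM (@ger0_norm _ (1 + z))// addr_ge0.
Qed.

Lemma in_W1P u : measurable_fun halfline u ->
  mu.-integrable halfline (EFin \o (fun z => `|u z| * (1 + z))) -> in_W1 u.
Proof.
move=> mu_ iu; apply: (@dominated_integrable _ (fun z => `|u z| * (1 + z))).
split => //.
- by apply: measurable_funM => //; apply: measurable_funTS; exact: measurable_funD.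
- by move=> z z0; rewrite mulr_ge0// addr_ge0.
- apply: ae_halflineW => z z0.
  by rewrite normrM (@ger0_norm _ (1 + z))// addr_ge0.
Qed.

Lemma W1_normE u : in_W1 u -> W1_norm u = (N1 u)%:E.
Proof.
move=> /in_W1_abs iu; rewrite /W1_norm /N1 /Rintegral fineK//.
exact: integrable_fin_num.
Qed.

Lemma N1_ge0 u : 0 <= N1 u.
Proof.
by apply: Rintegral_ge0 => z; rewrite halflineE => z0; rewrite mulr_ge0// addr_ge0.
Qed.

Lemma W1_dominated c u g : in_W1 u -> 0 <= c -> measurable_fun halfline g ->
  ae_halfline (fun z => `|g z| <= c * (`|u z| * (1 + z))) ->
  dominated g (fun z => c * (`|u z| * (1 + z))).
Proof.
move=> iu c0 mg gle; split => //.
  exact: (@integrableZl _ _ _ mu _ measurable_halfline c _ (in_W1_abs iu)).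
by move=> z z0; rewrite !mulr_ge0// addr_ge0.
Qed.

Lemma W1_Rintegral c u : in_W1 u ->
  \int[mu]_(z in halfline) (c * (`|u z| * (1 + z))) = c * N1 u.
Proof. by move=> iu; rewrite RintegralZl//; exact: in_W1_abs. Qed.

Lemma in_W1_le c u v : in_W1 u -> 0 <= c -> measurable_fun halfline v ->
  ae_halfline (fun z => `|v z| <= c * `|u z|) -> in_W1 v /\ N1 v <= c * N1 u.
Proof.
move=> iu c0 mv vu.
have d : dominated (fun z => `|v z| * (1 + z)) (fun z => c * (`|u z| * (1 + z))).
  apply: W1_dominated => //.
    apply: measurable_funM; first exact: measurableT_comp.
    by apply: measurable_funTS; exact: measurable_funD.
  apply: ae_halflineS vu => z /ltW z0 vz.
  rewrite normrM normr_id (@ger0_norm _ (1 + z)) ?addr_ge0// mulrA.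
  by rewrite ler_wpM2r// addr_ge0.
split; first by apply: in_W1P => //; exact: (dominated_integrable d).
rewrite -W1_Rintegral// (le_trans _ (dominated_Rintegral d _ (@subset_refl _ _)))//.
exact: ler_norm.
Qed.

Lemma in_W1D u v : in_W1 u -> in_W1 v -> in_W1 (fun z => u z + v z).
Proof.
move=> iu iv; rewrite /in_W1.
have := @integrableD _ _ _ mu _ measurable_halfline _ _ iu iv.
by apply: eq_integrable => // z _ /=; rewrite -EFinD mulrDl.
Qed.

Lemma in_W1Z c u : in_W1 u -> in_W1 (fun z => c * u z).
Proof.
move=> iu; have := @integrableZl _ _ _ mu _ measurable_halfline c _ iu.
by apply: eq_integrable => // z _ /=; rewrite -EFinM mulrA.
Qed.

Lemma in_W1B u v : in_W1 u -> in_W1 v -> in_W1 (fun z => u z - v z).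
Proof.
move=> iu iv; have := in_W1D iu (in_W1Z (-1) iv).
by apply: eq_integrable => // z _ /=; rewrite mulN1r.
Qed.

Lemma N1D u v : in_W1 u -> in_W1 v -> N1 (fun z => u z + v z) <= N1 u + N1 v.
Proof.
move=> iu iv; rewrite /N1 -RintegralD//; [|exact: in_W1_abs..].
apply: le_Rintegral => //.
- exact/in_W1_abs/in_W1D.
- have := @integrableD _ _ _ mu _ measurable_halfline _ _ (in_W1_abs iu) (in_W1_abs iv).
  exact: eq_integrable.
- move=> z; rewrite halflineE => z0; rewrite -mulrDl ler_wpM2r ?addr_ge0//.
  exact: ler_normD.
Qed.

Lemma N1Z c u : in_W1 u -> N1 (fun z => c * u z) = `|c| * N1 u.
Proof.
move=> iu; rewrite -W1_Rintegral//; apply: eq_Rintegral => z _.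
by rewrite normrM mulrA.
Qed.

Lemma W1_integrable u : in_W1 u -> mu.-integrable halfline (EFin \o u).
Proof.
move=> iu; apply: (@dominated_integrable _ (fun z => 1 * (`|u z| * (1 + z)))).
apply: W1_dominated => //; first exact: in_W1_measurable.
apply: ae_halflineW => z z0; rewrite mul1r ler_peMr//; lra.
Qed.

(** Membership of the ball of radius [c] of W^oo. *)
Definition wbound V c :=
  measurable_fun halfline V /\ ae_halfline (fun z => `|V z| <= c * (1 + z)).

Definition tail f z : R := \int[mu]_(y in `[z, +oo[) f y.

(** The quantity int_z^oo (V(y) - V(z)) f(y) dy, the expected benefit of meeting a
    more knowledgeable agent. *)
Definition gain f V z : R := tail (fun y => V y * f y) z - V z * tail f z.

Lemma hamiltonianE alpha (f V : R -> R -> R) z (t s : R) :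
  hamiltonian alpha f V z t s = (1 - s) * z + alpha s * gain (f ^~ t) (V ^~ t) z.
Proof. by rewrite /hamiltonian /gain /tail; ring. Qed.

Lemma tail_integrable f z : 0 <= z -> mu.-integrable halfline (EFin \o f) ->
  mu.-integrable `[z, +oo[ (EFin \o f).
Proof. by move=> z0; apply: integrableS => //; exact: tail_sub_halfline. Qed.

Lemma tailB f g z : 0 <= z -> mu.-integrable halfline (EFin \o f) ->
  mu.-integrable halfline (EFin \o g) ->
  tail (fun y => f y - g y) z = tail f z - tail g z.
Proof.
by move=> z0 jf jg; rewrite /tail RintegralB//; exact: tail_integrable.
Qed.

Lemma tail_le f z : in_W1 f -> 0 <= z -> `|tail f z| <= N1 f.
Proof.
move=> jf z0; rewrite -[leRHS]mul1r -W1_Rintegral//.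
apply: dominated_Rintegral => //; last exact: tail_sub_halfline.
apply: W1_dominated => //; first exact: in_W1_measurable.
apply: ae_halflineW => y y0; rewrite mul1r ler_peMr//; lra.
Qed.

Lemma wbound_mul_dominated f V c : in_W1 f -> 0 <= c -> wbound V c ->
  dominated (fun y => V y * f y) (fun y => c * (`|f y| * (1 + y))).
Proof.
move=> jf c0 [mV bV]; apply: W1_dominated => //.
  by apply: measurable_funM => //; exact: in_W1_measurable.
apply: ae_halflineS bV => y y0 Vy.
by rewrite normrM mulrCA mulrC ler_wpM2l.
Qed.

Lemma tail_mul_le f V c z : in_W1 f -> 0 <= c -> wbound V c -> 0 <= z ->
  `|tail (fun y => V y * f y) z| <= c * N1 f.
Proof.
move=> jf c0 bV z0; rewrite -W1_Rintegral//.
apply: dominated_Rintegral (wbound_mul_dominated jf c0 bV) _ _ => //.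
exact: tail_sub_halfline.
Qed.

(** The bound at the point [z] is a separate hypothesis because [gain] evaluates [V]
    there, while [wbound] holds only almost everywhere. *)
Lemma gain_le f V c z : in_W1 f -> 0 <= c -> wbound V c -> 0 <= z ->
  `|V z| <= c * (1 + z) -> `|gain f V z| <= 2 * c * N1 f * (1 + z).
Proof.
move=> jf c0 bV z0 Vz; apply: le_trans (ler_normB _ _) _.
have h1 := tail_mul_le jf c0 bV z0.
have h2 : `|V z * tail f z| <= c * (1 + z) * N1 f.
  by rewrite normrM ler_pM// tail_le.
have h3 : 0 <= c * N1 f * z by rewrite !mulr_ge0// N1_ge0.
lra.
Qed.

Lemma gainBl f g V c z : in_W1 f -> in_W1 g -> 0 <= c -> wbound V c -> 0 <= z ->
  gain (fun y => f y - g y) V z = gain f V z - gain g V z.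
Proof.
move=> jf jg c0 bV z0; rewrite /gain tailB//; [|exact: W1_integrable..].
have -> : (fun y => V y * (f y - g y)) = (fun y => V y * f y - V y * g y).
  by apply/funext => y; rewrite mulrBr.
rewrite tailB//; [ring|exact: dominated_integrable (wbound_mul_dominated _ c0 bV)..].
Qed.

Lemma gainBr f V W c d z : in_W1 f -> 0 <= c -> wbound V c ->
  0 <= d -> wbound W d -> 0 <= z ->
  gain f (fun y => V y - W y) z = gain f V z - gain f W z.
Proof.
move=> jf c0 bV d0 bW z0; rewrite /gain.
have -> : (fun y => (V y - W y) * f y) = (fun y => V y * f y - W y * f y).
  by apply/funext => y; rewrite mulrBl.
rewrite tailB//; first ring.
- exact: dominated_integrable (wbound_mul_dominated jf c0 bV).
- exact: dominated_integrable (wbound_mul_dominated jf d0 bW).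
Qed.

Lemma wboundB V W c d : wbound V c -> wbound W d ->
  wbound (fun y => V y - W y) (c + d).
Proof.
move=> [mV bV] [mW bW]; split; first exact: measurable_funB.
apply: ae_halflineS (ae_halflineI bV bW) => y y0 [h1 h2].
by rewrite mulrDl (le_trans (ler_normB _ _))// lerD.
Qed.

Lemma wbound_id c : 0 <= c -> wbound (fun y => c * y) c.
Proof.
move=> c0; split; first exact: mulrl_measurable.
apply: ae_halflineW => y y0; rewrite ger0_norm ?mulr_ge0//.
by rewrite ler_wpM2l//; lra.
Qed.

Lemma wbound_idfun : wbound (@id R) 1.
Proof.
by have := @wbound_id (1 : R) ler01; congr wbound; apply/funext => y; rewrite mul1r.
Qed.

Lemma gain_idZ f c z : in_W1 f -> 0 <= z ->
  gain f (fun y => c * y) z = c * gain f id z.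
Proof.
move=> jf z0; rewrite /gain.
have -> : (fun y => c * y * f y) = (fun y => c * (id y * f y)).
  by apply/funext => y; rewrite mulrA.
rewrite {1}/tail RintegralZl//; first by rewrite /tail/=; ring.
apply: tail_integrable => //.
exact: dominated_integrable (wbound_mul_dominated jf ler01 wbound_idfun).
Qed.

(** The logarithmic time derivative of the density when agents learn at rate
    [a]. *)
Definition drift f a z : R :=
  - a z * tail f z + \int[mu]_(y in `[0, z]) (a y * f y).

Lemma boltzmann_rhsE alpha (f S : R -> R -> R) z (t : R) :
  boltzmann_rhs alpha f S z t = f z t * drift (f ^~ t) (fun y => alpha (S y t)) z.
Proof. by rewrite /boltzmann_rhs /drift /tail/=; ring. Qed.

Lemma init_integrable f z : mu.-integrable halfline (EFin \o f) ->
  mu.-integrable `[0, z] (EFin \o f).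
Proof. by apply: integrableS => //; exact: init_sub_halfline. Qed.

(** Membership of the ball of radius [c] of L^oo. *)
Definition ae_bound a c :=
  measurable_fun halfline a /\ ae_halfline (fun z => `|a z| <= c).

Lemma ae_bound_mul_dominated f a c : in_W1 f -> 0 <= c -> ae_bound a c ->
  dominated (fun y => a y * f y) (fun y => c * (`|f y| * (1 + y))).
Proof.
move=> jf c0 [ma ba]; apply: W1_dominated => //.
  by apply: measurable_funM => //; exact: in_W1_measurable.
apply: ae_halflineS ba => y y0 ay.
rewrite normrM ler_pM//; rewrite ler_peMr//; lra.
Qed.

Lemma drift_le_dominated f a h z : in_W1 f ->
  dominated (fun y => a y * f y) h -> 0 <= z ->
  `|drift f a z| <= `|a z| * N1 f + \int[mu]_(y in halfline) h y.
Proof.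
move=> jf afh z0; apply: le_trans (ler_normD _ _) _; apply: lerD.
  by rewrite normrM normrN ler_wpM2l// tail_le.
by apply: dominated_Rintegral afh _ _ => //; exact: init_sub_halfline.
Qed.

Lemma drift_le f a c z : in_W1 f -> 0 <= c -> ae_bound a c -> 0 <= z ->
  `|a z| <= c -> `|drift f a z| <= 2 * c * N1 f.
Proof.
move=> jf c0 ba z0 az.
have := drift_le_dominated jf (ae_bound_mul_dominated jf c0 ba) z0.
rewrite W1_Rintegral// => /le_trans; apply.
have : `|a z| * N1 f <= c * N1 f by rewrite ler_wpM2r// N1_ge0.
lra.
Qed.

Lemma driftBl f g a c z : in_W1 f -> in_W1 g -> 0 <= c -> ae_bound a c ->
  0 <= z -> drift (fun y => f y - g y) a z = drift f a z - drift g a z.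
Proof.
move=> jf jg c0 ba z0; rewrite /drift tailB//; [|exact: W1_integrable..].
have -> : (fun y => a y * (f y - g y)) = (fun y => a y * f y - a y * g y).
  by apply/funext => y; rewrite mulrBr.
rewrite RintegralB//; first ring.
- exact/init_integrable/(dominated_integrable (ae_bound_mul_dominated jf c0 ba)).
- exact/init_integrable/(dominated_integrable (ae_bound_mul_dominated jg c0 ba)).
Qed.

Lemma driftBr f a b c z : in_W1 f -> 0 <= c -> ae_bound a c -> ae_bound b c ->
  0 <= z -> drift f (fun y => a y - b y) z = drift f a z - drift f b z.
Proof.
move=> jf c0 ba bb z0; rewrite /drift.
have -> : (fun y => (a y - b y) * f y) = (fun y => a y * f y - b y * f y).
  by apply/funext => y; rewrite mulrBl.
rewrite RintegralB//; first ring.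
- exact/init_integrable/(dominated_integrable (ae_bound_mul_dominated jf c0 ba)).
- exact/init_integrable/(dominated_integrable (ae_bound_mul_dominated jf c0 bb)).
Qed.

End weighted_norms.

(** * Growth of curves measured by a seminorm *)

Section curve_growth.
Context {R : realType}.
Implicit Types (u v : R -> R) (B : (R -> R) -> R -> Prop).

(** Here [B u c] reads: the seminorm of [u] is at most [c].  The relational form
    covers W^1, whose norm makes sense for integrable [u] only, and W^oo, an essential
    supremum, in the same way. *)
Definition seminorm_bound B := [/\
  forall u v c d, B u c -> B v d -> B (fun z => u z + v z) (c + d),
  forall k u c, B u c -> B (fun z => k * u z) (`|k| * c),
  forall u c d, c <= d -> B u c -> B u d &
  forall u c, (forall e, 0 < e -> B u (c + e)) -> B u c].

Definition bound_continuous B (T : R) (w : R -> R -> R) :=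
  forall t, 0 <= t <= T -> forall e, 0 < e -> exists2 d, 0 < d &
    forall t', 0 <= t' <= T -> `|t' - t| < d -> B (fun z => w t' z - w t z) e.

Definition bound_derivative B (T : R) (w dw : R -> R -> R) :=
  forall t, 0 <= t <= T -> forall e, 0 < e -> exists2 d, 0 < d &
    forall t', 0 <= t' <= T -> t' != t -> `|t' - t| < d ->
      B (fun z => (w t' z - w t z) / (t' - t) - dw t z) e.

(** A mean value inequality in integrated form.  The bound on [dw] is required only
    at times at which the conclusion already holds, which is what a priori estimates
    need; the gap between [C'] and [C] lets the bound propagate past the supremum of
    the times up to which it holds. *)
Lemma curve_growth B T w dw (C C' : R) : seminorm_bound B ->
  0 <= C' -> C' < C -> bound_continuous B T w -> bound_derivative B T w dw ->
  B (w 0) 0 ->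
  (forall t, 0 <= t <= T -> B (w t) (C * t) -> B (dw t) C') ->
  forall t, 0 <= t <= T -> B (w t) (C * t).
Proof.
move=> [BD BZ Bm Bc] C'0 C'C wc wd w0 dwB t0 t0T.
have T0 : 0 <= T by lra.
have C0 : 0 < C by lra.
set E := [set t : R | 0 <= t <= T /\ forall s, 0 <= s <= t -> B (w s) (C * s)].
have E0 : E 0.
  split; first by rewrite lexx T0.
  move=> s s0; have -> : s = 0 by lra.
  by rewrite mulr0.
have hE : has_sup E by split; [exists 0|exists T => t [/andP[]]].
set tau := sup E.
have tau0 : 0 <= tau by exact: sup_upper_bound.
have tauT : tau <= T by apply: ge_sup; [exists 0|move=> t [/andP[]]].
have lt_tau s : 0 <= s < tau -> B (w s) (C * s).
  move=> /andP[s0 st].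
  have [t [tT Ht] ts] := sup_adherent (eps := tau - s) ltac:(lra) hE.
  by apply: Ht; rewrite s0 ltW//; move: ts; rewrite -/tau; lra.
have Btau : B (w tau) (C * tau).
  have [->|tau_neq0] := eqVneq tau 0; first by rewrite mulr0.
  apply: Bc => e e0.
  have [d d0 Hd] := wc tau ltac:(lra) e e0.
  set s := Order.max 0 (tau - d / 2).
  have s0 : 0 <= s by rewrite le_max lexx.
  have sd : tau - d / 2 <= s by rewrite le_max lexx orbT.
  have st : s < tau.
    by rewrite gt_max; apply/andP; split; [rewrite lt_neqAle eq_sym tau_neq0|lra].
  have h1 := lt_tau s ltac:(lra).
  have h2 := Hd s ltac:(lra).
  have : `|s - tau| < d by rewrite ltr_norml; lra.
  move/h2/(BZ (-1)); rewrite normrN1 mul1r => h3.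
  have := BD _ _ _ _ h1 h3.
  have -> : (fun z => w s z + -1 * (w s z - w tau z)) = w tau.
    by apply/funext => z; ring.
  by apply: Bm; rewrite lerD2r ler_pM2l// ltW.
have le_tau s : 0 <= s <= tau -> B (w s) (C * s).
  move=> /andP[s0]; rewrite le_eqVlt => /predU1P[->//|st].
  by apply: lt_tau; rewrite s0.
have [tauT'|] := ltP tau T; last first.
  by move=> Ttau; apply: le_tau; lra.
exfalso.
have [d d0 Hd] := wd tau ltac:(lra) (C - C') ltac:(lra).
have dB := dwB tau ltac:(lra) Btau.
set t1 := Order.min T (tau + d / 2).
have t1T : t1 <= T by rewrite ge_min lexx.
have t1d : t1 <= tau + d / 2 by rewrite ge_min lexx orbT.
have t1tau : tau < t1 by rewrite lt_min tauT'; lra.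
have : E t1.
  split; first lra.
  move=> s s1; have [st|ts] := leP s tau; first by apply: le_tau; lra.
  have sd : `|s - tau| < d by rewrite ltr_norml; lra.
  have h1 := BZ (s - tau) _ _ (Hd s ltac:(lra) ltac:(lra) sd).
  have h2 := BZ (s - tau) _ _ dB.
  have := BD _ _ _ _ Btau (BD _ _ _ _ h1 h2).
  have -> : (fun z => w tau z + ((s - tau) * ((w s z - w tau z) / (s - tau) -
      dw tau z) + (s - tau) * dw tau z)) = w s.
    by apply/funext => z; field; lra.
  apply: Bm; rewrite gtr0_norm; [lra|lra].
by move/(sup_upper_bound hE); rewrite -/tau; lra.
Qed.

End curve_growth.

Section norm_bounds.
Context {R : realType}.
Local Notation mu := (@lebesgue_measure R).
Implicit Types (u v : R -> R).

Definition W1_bound u (c : R) := in_W1 u /\ N1 u <= c.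

Lemma W1_seminorm_bound : seminorm_bound W1_bound.
Proof.
split.
- move=> u v c d [iu uc] [iv vd]; split; first exact: in_W1D.
  by rewrite (le_trans (N1D iu iv))// lerD.
- move=> k u c [iu uc]; split; first exact: in_W1Z.
  by rewrite N1Z// ler_wpM2l.
- by move=> u c d cd [iu uc]; split => //; exact: le_trans cd.
- move=> u c H; split; first by have [] := H 1 ltr01.
  by apply/ler_addgt0Pr => e /H[].
Qed.

Lemma wbound_seminorm_bound : seminorm_bound (@wbound R).
Proof.
split.
- move=> u v c d [mu_ uc] [mv vd]; split; first exact: measurable_funD.
  apply: ae_halflineS (ae_halflineI uc vd) => z z0 [h1 h2].
  by rewrite mulrDl (le_trans (ler_normD _ _))// lerD.
- move=> k u c [mu_ uc]; split.
    by apply: (measurable_funM (measurable_cst k) mu_).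
  apply: ae_halflineS uc => z z0 h.
  by rewrite normrM -mulrA ler_wpM2l.
- move=> u c d cd [mu_ uc]; split => //.
  apply: ae_halflineS uc => z z0 /le_trans; apply.
  by rewrite ler_wpM2r//; lra.
- move=> u c H; split; first by have [] := H 1 ltr01.
  have : {ae mu, forall z, forall n : nat,
      halfline z -> `|u z| <= (c + n.+1%:R^-1) * (1 + z)}.
    by apply: ae_foralln => n; have [_] := H n.+1%:R^-1 ltac:(by rewrite invr_gt0).
  have F : Filter (almost_everywhere mu) by exact: ae_filter_ringOfSetsType.
  apply: (@filterS _ _ F) => z Hz hz.
  have z0 : 0 <= z by rewrite -halflineE.
  apply/ler_addgt0Pr => e e0.
  have [n nP] : exists n : nat, (1 + z) / e < n%:R.
    by exists (Num.truncn ((1 + z) / e)).+1; exact: truncnS_gt.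
  apply: le_trans (Hz n hz) _; rewrite mulrDl lerD2l mulrC ler_pdivrMr//.
  move: nP; rewrite ltr_pdivrMr// mulrC => nP.
  rewrite (le_trans (ltW nP))// ler_pM2l// ler_nat//.
Qed.

(** Through this equivalence, estimates in W^oo become estimates that hold at almost
    every z. *)
Lemma Winfty_normP u c : 0 <= c ->
  (Winfty_norm u <= c%:E)%E <-> ae_halfline (fun z => `|u z| <= c * (1 + z)).
Proof.
move=> c0.
have E z : 0 <= z -> (`|u z / (1 + z)| <= c) = (`|u z| <= c * (1 + z)).
  move=> z0; rewrite normrM normfV (@ger0_norm _ (1 + z)) ?addr_ge0//.
  by rewrite ler_pdivrMr// ltr_pwDl.
have F : Filter (almost_everywhere mu) by exact: ae_filter_ringOfSetsType.
split.
  move=> /ess_supP; apply: (@filterS _ _ F) => z /[swap] hz.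
  by rewrite patchE mem_set// lee_fin E// -halflineE.
move=> H; apply/ess_supP; apply: (@filterS _ _ F) H => z Hz.
rewrite patchE; case: ifPn; last by rewrite lee_fin.
by rewrite inE => hz; rewrite lee_fin E ?Hz// -halflineE.
Qed.

Lemma Winfty_norm_ge0 u : (0 <= Winfty_norm u)%E.
Proof.
apply: ess_sup_gee; last by apply: aeW => z; rewrite patchE; case: ifP.
by rewrite /= -set_itvNyy lebesgue_measure_itv/= lt0y.
Qed.

Lemma measurable_weight : measurable_fun (@halfline R) (fun z => 1 + z).
Proof. by apply: measurable_funTS; exact: measurable_funD. Qed.

Lemma measurable_inv_weight : measurable_fun (@halfline R) (fun z => (1 + z)^-1).
Proof. exact: (measurableT_comp inv_measurable measurable_weight). Qed.

Lemma wbound_in_Winfty u c : wbound u c -> in_Winfty u.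
Proof.
move=> [mu_ uc]; split; first exact: (measurable_funM mu_ measurable_inv_weight).
apply: (@le_lt_trans _ _ (`|c|%:E)%E); last exact: ltry.
have := (@Winfty_normP u `|c| (normr_ge0 _)).2; apply.
apply: ae_halflineS uc => z z0 /le_trans; apply.
by rewrite ler_wpM2r ?ler_norm//; lra.
Qed.

Lemma in_Winfty_measurable u : in_Winfty u -> measurable_fun halfline u.
Proof.
move=> [mu_ _]; have := measurable_funM mu_ measurable_weight.
apply: eq_measurable_fun => z; rewrite inE halflineE => z0 /=.
by rewrite divfK// gt_eqF// ltr_pwDl.
Qed.

Lemma in_Winfty_wbound u c : in_Winfty u -> 0 <= c ->
  (Winfty_norm u <= c%:E)%E -> wbound u c.
Proof.
by move=> iu c0 /(Winfty_normP _ c0) uc; split => //; exact: in_Winfty_measurable.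
Qed.

Lemma in_Winfty_bounded u : in_Winfty u -> exists2 c, 0 <= c & wbound u c.
Proof.
move=> iu; have [_] := iu; rewrite -/(Winfty_norm u).
case E : (Winfty_norm u) => [x| |] // _.
  exists `|x| => //; apply: in_Winfty_wbound => //.
  by rewrite E lee_fin ler_norm.
by exists 0 => //; apply: in_Winfty_wbound => //; rewrite E leNye.
Qed.

Lemma ecvg0_lt (T : Type) (F : set_system T) {FF : Filter F} (g : T -> \bar R)
  (e : R) : 0 < e -> g x @[x --> F] --> 0%E -> \forall x \near F, (g x < e%:E)%E.
Proof.
move=> e0 /fine_cvgP[fg] /cvgrPdist_lt/(_ e e0); apply: filterS2 fg => x fx.
rewrite /= sub0r normrN => /(le_lt_trans (ler_norm _)).
by rewrite -lte_fin fineK.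
Qed.

Lemma ecvg0_le (T : Type) (F : set_system T) {FF : Filter F} (g : T -> \bar R) :
  (forall x, (0 <= g x)%E) ->
  (forall e, 0 < e -> \forall x \near F, (g x <= e%:E)%E) -> g x @[x --> F] --> 0%E.
Proof.
move=> g0 H; apply/fine_cvgP; split.
  apply: filterS (H 1 ltr01) => x gx.
  by rewrite ge0_fin_numE// (le_lt_trans gx)// ltry.
apply/cvgrPdist_le => e e0; apply: filterS (H e e0) => x gx /=.
rewrite sub0r normrN ger0_norm ?fine_ge0//.
by rewrite -lee_fin fineK// ge0_fin_numE// (le_lt_trans gx)// ltry.
Qed.

Lemma ecvg0_within_nbhs (A : set R) (t e : R) (g : R -> \bar R) : 0 < e ->
  g x @[x --> within A (nbhs t)] --> 0%E ->
  exists2 d, 0 < d & forall y, A y -> `|y - t| < d -> (g y < e%:E)%E.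
Proof.
move=> e0 H; have W : \forall x \near within A (nbhs t), (g x < e%:E)%E.
  exact: ecvg0_lt e0 H.
by move: W => /within_nbhs_eps.
Qed.

Lemma ecvg0_within_dnbhs (A : set R) (t e : R) (g : R -> \bar R) : 0 < e ->
  g x @[x --> within A t^'] --> 0%E ->
  exists2 d, 0 < d & forall y, A y -> y != t -> `|y - t| < d -> (g y < e%:E)%E.
Proof.
move=> e0 H; have W : \forall x \near within A t^', (g x < e%:E)%E.
  exact: ecvg0_lt e0 H.
by move: W => /within_dnbhs_eps.
Qed.

End norm_bounds.

(** * Joint measurability, time integrals and Picard iteration *)

Section joint_measurability.
Context {R : realType}.
Local Notation mu := (@lebesgue_measure R).

Lemma itv_tailE (z : R) : (`[z, +oo[%classic : set R) = [set y : R | z <= y].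
Proof. by apply/seteqP; split => y /=; rewrite in_itv/= andbT. Qed.

Lemma itv_initE (z : R) :
  (`[0, z]%classic : set R) = [set y : R | (0 <= y) && (y <= z)].
Proof. by apply/seteqP; split => y /=; rewrite in_itv. Qed.

(** The measurability part of the theorem of Tonelli, applied to the positive and
    negative parts. *)
Lemma measurable_Rintegral_param (k : (R * R) * R -> R) :
  measurable_fun setT k -> measurable_fun setT (fun p => \int[mu]_y k (p, y)).
Proof.
move=> mk.
have mE : measurable_fun setT (EFin \o k) by exact/measurable_EFinP.
have mk_ : measurable_fun setT (fun p => \int[mu]_y (k (p, y))%:E)%E.
  have -> : (fun p => \int[mu]_y (k (p, y))%:E)%E =
     ((fun p => \int[mu]_y ((EFin \o k)^\+ (p, y)))
      \- (fun p => \int[mu]_y ((EFin \o k)^\- (p, y))))%E.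
    apply/funext => p; rewrite [LHS]integralE.
    by congr (_ - _)%E; apply: eq_integral => y _; rewrite ?funeposE ?funenegE.
  apply: emeasurable_funB.
    apply: (@measurable_fun_fubini_tonelli_F _ _ _ _ R mu ((EFin \o k)^\+)%E).
      exact: measurable_funepos.
    by move=> x; rewrite funepos_ge0.
  apply: (@measurable_fun_fubini_tonelli_F _ _ _ _ R mu ((EFin \o k)^\-)%E).
    exact: measurable_funeneg.
  by move=> x; rewrite funeneg_ge0.
have : measurable_fun setT (fine \o (fun p => \int[mu]_y (k (p, y))%:E)%E).
  by apply: measurableT_comp => //; exact: fine_measurable.
by [].
Qed.

Lemma measurable_Rintegral_param_in (k : (R * R) * R -> R)
    (b : (R * R) * R -> bool) :
  measurable_fun setT k -> measurable_fun setT b ->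
  measurable_fun setT (fun p => \int[mu]_(y in [set y | b (p, y)]) k (p, y)).
Proof.
move=> mk mb.
have -> : (fun p => \int[mu]_(y in [set y | b (p, y)]) k (p, y)) =
    (fun p => \int[mu]_y (if b (p, y) then k (p, y) else 0)).
  apply/funext => p; rewrite Rintegral_mkcond; apply: eq_Rintegral => y _.
  rewrite patchE; case: (boolP (b (p, y))) => H; first by rewrite mem_set.
  by rewrite memNset//=; exact/negP.
apply: (@measurable_Rintegral_param (fun q => if b q then k q else 0)).
exact: measurable_fun_ifT.
Qed.

Lemma measurable_section1 (k : R * R -> R) t : measurable_fun setT k ->
  measurable_fun setT (fun z => k (z, t)).
Proof.
by move=> mk; apply: (measurableT_comp mk); exact: pair2_measurable.
Qed.

Lemma measurable_section2 (k : R * R -> R) z : measurable_fun setT k ->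
  measurable_fun setT (fun t => k (z, t)).
Proof.
by move=> mk; apply: (measurableT_comp mk); exact: pair1_measurable.
Qed.

Lemma measurable_fst_snd2 (rho : R * R -> R) : measurable_fun setT rho ->
  measurable_fun setT (fun q : (R * R) * R => rho (q.2, q.1.2)).
Proof.
move=> mrho; apply: (measurableT_comp mrho).
apply: measurable_fun_pair => //.
by apply: (measurableT_comp measurable_snd); exact: measurable_fst.
Qed.

Lemma measurable_tail_joint (rho : R * R -> R) : measurable_fun setT rho ->
  measurable_fun setT (fun p : R * R => tail (fun y => rho (y, p.2)) p.1).
Proof.
move=> mrho.
have -> : (fun p : R * R => tail (fun y => rho (y, p.2)) p.1) =
    (fun p : R * R => \int[mu]_(y in [set y | p.1 <= y]) rho (y, p.2)).
  by apply/funext => p; rewrite /tail itv_tailE.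
apply: (@measurable_Rintegral_param_in (fun q => rho (q.2, q.1.2))
  (fun q => q.1.1 <= q.2)).
  exact: measurable_fst_snd2.
apply: measurable_fun_ler => //.
by apply: (measurableT_comp measurable_fst); exact: measurable_fst.
Qed.

Lemma measurable_init_joint (rho : R * R -> R) : measurable_fun setT rho ->
  measurable_fun setT (fun p : R * R => \int[mu]_(y in `[0, p.1]) rho (y, p.2)).
Proof.
move=> mrho.
have -> : (fun p : R * R => \int[mu]_(y in `[0, p.1]) rho (y, p.2)) =
    (fun p : R * R => \int[mu]_(y in [set y | (0 <= y) && (y <= p.1)]) rho (y, p.2)).
  by apply/funext => p; rewrite itv_initE.
apply: (@measurable_Rintegral_param_in (fun q => rho (q.2, q.1.2))
  (fun q => (0 <= q.2) && (q.2 <= q.1.1))).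
  exact: measurable_fst_snd2.
apply: measurable_and; first exact: measurable_fun_ler.
apply: measurable_fun_ler => //.
by apply: (measurableT_comp measurable_fst); exact: measurable_fst.
Qed.

End joint_measurability.

Section time_integral.
Context {R : realType}.
Local Notation mu := (@lebesgue_measure R).
Implicit Types (g h : R -> R) (T t c e K : R).

Definition time_integral g t : R := \int[mu]_(s in `[0, t]) g s.

Lemma bounded_itv_integrable g a b K : measurable_fun setT g ->
  (forall s, a <= s <= b -> `|g s| <= K) -> mu.-integrable `[a, b] (EFin \o g).
Proof.
move=> mg gK; apply: measurable_bounded_integrable.
- exact: measurable_itv.
- by rewrite /= lebesgue_measure_itv/=; case: ifP => _; rewrite ?ltry// -EFinB ltry.
- exact: measurable_funTS.
- exists `|K|; split; first exact: num_real.
  move=> x Kx s; rewrite /= in_itv/= => /gK h; apply: ltW.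
  by rewrite (le_lt_trans h)// (le_lt_trans (ler_norm _)).
Qed.

(** The other estimates of time integrals are derived from this one: over a short
    interval the integral of [g] is its length times the value [c] that [g] nearly
    takes there. *)
Lemma time_integral_diff g T K c e t t' : measurable_fun setT g ->
  (forall s, 0 <= s <= T -> `|g s| <= K) -> 0 <= t -> t <= t' -> t' <= T ->
  (forall s, t <= s <= t' -> `|g s - c| <= e) ->
  `|time_integral g t' - time_integral g t - (t' - t) * c| <= (t' - t) * e.
Proof.
move=> mg gK t0 tt' t'T ge.
have e0 : 0 <= e by apply: le_trans (ge t _); rewrite ?lexx.
have i1 : mu.-integrable `[0, t'] (EFin \o g).
  by apply: (@bounded_itv_integrable _ _ _ K) => // s s0; apply: gK; lra.
have i2 : mu.-integrable `[t, t'] (EFin \o g).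
  by apply: (@bounded_itv_integrable _ _ _ K) => // s s0; apply: gK; lra.
have -> : time_integral g t' - time_integral g t = \int[mu]_(s in `[t, t']) g s.
  rewrite /time_integral Rintegral_itvB ?bnd_simp//.
  rewrite Rintegral_itv_obnd_cbnd//.
  by apply: integrableS i2 => //; move=> s /=; rewrite !in_itv/=; lra.
have cstE k : \int[mu]_(s in `[t, t']) k = (t' - t) * k.
  rewrite Rintegral_cst//= lebesgue_measure_itv/= lte_fin mulrC.
  case: ltP => [_|t't]; first by rewrite -EFinB.
  have -> : t' = t by lra.
  by rewrite subrr.
rewrite -cstE.
have ic k : mu.-integrable `[t, t'] (EFin \o cst k).
  by apply: (@bounded_itv_integrable _ _ _ `|k|) => //.
rewrite -RintegralB//; last exact: ic.
have im : mu.-integrable `[t, t'] (EFin \o (fun s => g s - c)).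
  apply: (@bounded_itv_integrable _ _ _ e) => //.
  exact: measurable_funB.
apply: le_trans (le_normr_Rintegral _ im) _; first exact: measurable_itv.
rewrite -cstE.
apply: le_Rintegral => //.
- exact: (integrable_abse im).
- exact: ic.
Qed.

Lemma time_integralB g h T K t : measurable_fun setT g ->
  measurable_fun setT h ->
  (forall s, 0 <= s <= T -> `|g s| <= K) ->
  (forall s, 0 <= s <= T -> `|h s| <= K) -> 0 <= t <= T ->
  time_integral (fun s => g s - h s) t = time_integral g t - time_integral h t.
Proof.
move=> mg mh gK hK t0T; rewrite /time_integral RintegralB//.
- by apply: (@bounded_itv_integrable _ _ _ K) => // s s0; apply: gK; lra.
- by apply: (@bounded_itv_integrable _ _ _ K) => // s s0; apply: hK; lra.
Qed.

Lemma time_integral_dist g h T K e t t' : measurable_fun setT g ->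
  measurable_fun setT h ->
  (forall s, 0 <= s <= T -> `|g s| <= K) ->
  (forall s, 0 <= s <= T -> `|h s| <= K) -> 0 <= t -> t <= t' -> t' <= T ->
  (forall s, t <= s <= t' -> `|g s - h s| <= e) ->
  `|(time_integral g t' - time_integral g t) -
    (time_integral h t' - time_integral h t)| <= (t' - t) * e.
Proof.
move=> mg mh gK hK t0 tt' t'T ge.
have := @time_integral_diff (fun s => g s - h s) T (K + K) 0 e t t'.
rewrite !(@time_integralB _ _ T K)//; try lra.
have -> : time_integral g t' - time_integral h t' -
    (time_integral g t - time_integral h t) - (t' - t) * 0 =
    (time_integral g t' - time_integral g t) -
    (time_integral h t' - time_integral h t) by ring.
apply => //.
- exact: measurable_funB.
- move=> s s0; apply: le_trans (ler_normB _ _) _.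
  by apply: lerD; [exact: gK|exact: hK].
- by move=> s s0; rewrite subr0; exact: ge.
Qed.

Lemma measurable_time_integral (k : R * R -> R) : measurable_fun setT k ->
  measurable_fun setT (fun p => time_integral (fun s => k (p.1, s)) p.2).
Proof.
move=> mk; rewrite /time_integral.
have E : (fun p => \int[mu]_(s in `[0, p.2]) k (p.1, s)) =
    (fun p => \int[mu]_(s in [set s | (0 <= s) && (s <= p.2)]) k (p.1, s)).
  by apply/funext => p; rewrite itv_initE.
rewrite E.
apply: (@measurable_Rintegral_param_in _ (fun q => k (q.1.1, q.2))
  (fun q => (0 <= q.2) && (q.2 <= q.1.2))).
  apply: (measurableT_comp mk); apply: measurable_fun_pair => //.
  by apply: (measurableT_comp measurable_fst); exact: measurable_fst.
apply: measurable_and; first exact: measurable_fun_ler.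
apply: measurable_fun_ler => //.
by apply: (measurableT_comp measurable_snd); exact: measurable_fst.
Qed.

Lemma time_integral0 g : time_integral g 0 = 0.
Proof. by rewrite /time_integral set_itv1 Rintegral_set1. Qed.

Lemma time_integral_dist0 g h T K e t : measurable_fun setT g ->
  measurable_fun setT h ->
  (forall s, 0 <= s <= T -> `|g s| <= K) ->
  (forall s, 0 <= s <= T -> `|h s| <= K) -> 0 <= t <= T ->
  (forall s, 0 <= s <= t -> `|g s - h s| <= e) ->
  `|time_integral g t - time_integral h t| <= t * e.
Proof.
move=> mg mh gK hK /andP[t0 tT] ghe.
have := time_integral_dist mg mh gK hK (lexx 0) t0 tT ghe.
by rewrite (time_integral0 g) (time_integral0 h) (subr0 t) (subr0 (time_integral g t))
  (subr0 (time_integral h t)).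
Qed.

(** The derivative of the integral at [t], when [c] is the value of [g] at [t]; the
    error [e] is kept explicit because it has to be uniform in the space
    variable. *)
Lemma time_integral_quot g T K c e t t' : measurable_fun setT g ->
  (forall s, 0 <= s <= T -> `|g s| <= K) -> 0 <= t <= T -> 0 <= t' <= T ->
  t' != t ->
  (forall s, 0 <= s <= T -> `|s - t| <= `|t' - t| -> `|g s - c| <= e) ->
  `|(time_integral g t' - time_integral g t) / (t' - t) - c| <= e.
Proof.
move=> mg gK tT t'T t't ge.
have d0 : t' - t != 0 by rewrite subr_eq0.
have -> : (time_integral g t' - time_integral g t) / (t' - t) - c =
   (time_integral g t' - time_integral g t - (t' - t) * c) / (t' - t).
  by field.
rewrite normrM normfV ler_pdivrMr ?normr_gt0// [leRHS]mulrC.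
have [tt'|t't'] := leP t t'.
  rewrite (@ger0_norm _ (t' - t)) ?subr_ge0//.
  have := @time_integral_diff g T K c e t t' mg gK; apply; try lra.
  move=> s st; apply: ge; first lra.
  by rewrite !ger0_norm; lra.
rewrite -normrN (@ltr0_norm _ (t' - t)) ?subr_lt0//.
have := @time_integral_diff g T K c e t' t mg gK.
have -> : - (time_integral g t' - time_integral g t - (t' - t) * c) =
  time_integral g t - time_integral g t' - (t - t') * c by ring.
rewrite opprB; apply; try lra.
move=> s st; apply: ge; first lra.
by rewrite !ler0_norm; lra.
Qed.

Lemma time_integral_lip g T K t t' : measurable_fun setT g ->
  (forall s, 0 <= s <= T -> `|g s| <= K) -> 0 <= t <= T -> 0 <= t' <= T ->
  `|time_integral g t' - time_integral g t| <= K * `|t' - t|.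
Proof.
move=> mg gK tT t'T; have [->|t't] := eqVneq t' t.
  by rewrite !subrr normr0 mulr0.
have := @time_integral_quot g T K 0 K t t' mg gK tT t'T t't.
rewrite subr0 normrM normfV ler_pdivrMr ?normr_gt0 ?subr_eq0//; apply.
by move=> s sT _; rewrite subr0 gK.
Qed.

End time_integral.

Section picard.
Context {R : realType} {I : Type}.
Implicit Types (u v : I -> R).

Lemma geometric_small (c e : R) : 0 < e -> exists n, c / 2 ^+ n < e.
Proof.
move=> e0; exists (Num.truncn (c / e)).+1.
have nP : c / e < (Num.truncn (c / e)).+1%:R by exact: truncnS_gt.
rewrite ltr_pdivrMr ?exprn_gt0//.
move: nP; rewrite ltr_pdivrMr// mulrC => /lt_le_trans; apply.
by rewrite ler_pM2l// -natrX ler_nat ltnW// ltn_expl.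
Qed.

Lemma le0_geometric (x c : R) : (forall n, x <= c / 2 ^+ n) -> x <= 0.
Proof.
move=> H; rewrite leNgt; apply/negP => x0.
by have [n] := geometric_small c x0; rewrite ltNge H.
Qed.

Variables (A : (I -> R) -> Prop) (Gamma : (I -> R) -> I -> R) (w : I -> R).
Hypothesis w_ge0 : forall i, 0 <= w i.
Hypothesis Gamma_stable : forall u, A u -> A (Gamma u).
Hypothesis A_closed : forall (s : nat -> I -> R) u, (forall n, A (s n)) ->
  (forall i, s n i @[n --> \oo] --> u i) -> A u.
Hypothesis Gamma_contract : forall u v (d : R), A u -> A v -> 0 <= d ->
  (forall i, `|u i - v i| <= d * w i) ->
  forall i, `|Gamma u i - Gamma v i| <= d / 2 * w i.

(** The contraction principle in a weighted supremum norm.  Convergence is only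
    needed at each point, and the set [A] only has to be closed under pointwise limits,
    so that measurability may be part of [A]. *)
Lemma picard_fixpoint u0 (K : R) : A u0 -> 0 <= K ->
  (forall i, `|Gamma u0 i - u0 i| <= K * w i) ->
  exists2 u, A u & forall i, Gamma u i = u i.
Proof.
move=> Au0 K0 HK.
pose s n := iter n Gamma u0.
have As n : A (s n) by elim: n => //= n; exact: Gamma_stable.
have K2 n : 0 <= K / 2 ^+ n by rewrite divr_ge0// exprn_ge0.
have step n i : `|s n.+1 i - s n i| <= K / 2 ^+ n * w i.
  elim: n i => [|n IH] i; first by rewrite expr0 divr1; exact: HK.
  have := Gamma_contract (As n.+1) (As n) (K2 n) IH i.
  by rewrite exprSr invfM mulrA.
have dist n k i : `|s (n + k)%N i - s n i| <= 2 * K / 2 ^+ n * w i - 2 * K / 2 ^+ (n + k) * w i.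
  elim: k => [|k IH]; first by rewrite addn0 !subrr normr0.
  rewrite addnS; have := step (n + k)%N i.
  have := ler_normD (s (n + k).+1 i - s (n + k)%N i) (s (n + k)%N i - s n i).
  rewrite addrA subrK.
  have -> : 2 * K / 2 ^+ (n + k).+1 * w i = K / 2 ^+ (n + k) * w i.
    by rewrite exprSr; field; rewrite expf_neq0.
  lra.
have dist' n k i : `|s (n + k)%N i - s n i| <= 2 * K / 2 ^+ n * w i.
  apply: le_trans (dist n k i) _; rewrite lerBlDr lerDl.
  by rewrite mulr_ge0// divr_ge0 ?exprn_ge0// mulr_ge0.
have small i e : 0 < e -> exists n, 2 * K / 2 ^+ n * w i < e.
  by move=> /(geometric_small (2 * K * w i))[n ne]; exists n; rewrite mulrAC.
have cvgs i : cvgn (fun n => s n i).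
  apply/cauchy_cvgP/cauchy_exP => e e0.
  have [n ne] := small i e e0.
  exists (s n i); exists n => // k /= nk.
  rewrite /ball/= distrC -(subnKC nk); exact: le_lt_trans (dist' _ _ _) ne.
pose u i := limn (fun n => s n i).
have su i : s n i @[n --> \oo] --> u i by exact: cvgs.
have Au : A u by exact: A_closed As su.
have us n i : `|u i - s n i| <= 2 * K / 2 ^+ n * w i.
  have cn : (fun k => `|s k i - s n i|) @ \oo --> `|u i - s n i|.
    by apply: cvg_norm; apply: cvgB; [exact: su|exact: cvg_cst].
  apply: (cvgr_to_le cn).
  by exists n => // k /= nk; rewrite -(subnKC nk); exact: dist'.
exists u => // i.
apply/eqP; rewrite -subr_eq0 -normr_le0.
apply: (@le0_geometric _ (2 * K * w i)) => n.
have d0 : 0 <= 2 * K / 2 ^+ n by rewrite divr_ge0 ?exprn_ge0// mulr_ge0.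
have h1 := Gamma_contract Au (As n) d0 (us n) i.
have h2 := us n.+1 i.
have -> : 2 * K * w i / 2 ^+ n = 2 * K / 2 ^+ n / 2 * w i + 2 * K / 2 ^+ n.+1 * w i.
  by rewrite exprSr; field; rewrite expf_neq0.
have := ler_distD (s n.+1 i) (Gamma u i) (u i).
have e1 : Gamma (s n) i = s n.+1 i by [].
rewrite (distrC (s n.+1 i) (u i)); rewrite e1 in h1; lra.
Qed.

End picard.

(** * Estimates at a fixed time *)

Section static_estimates.
Context {R : realType}.
Local Notation mu := (@lebesgue_measure R).
Variables (alpha sigma : R -> R) (L abar : R).
Hypothesis L_gt0 : 0 < L.
Hypothesis alpha_range : forall s : R, 0 <= s <= 1 -> 0 <= alpha s <= abar.
Hypothesis sigma_argmax : forall b, is_argmax (payoff alpha b) (sigma b).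
Hypothesis policy_lip :
  forall b1 b2, `|alpha (sigma b1) - alpha (sigma b2)| <= L * `|b1 - b2|.
Hypothesis policy_lip_pos : forall b1 b2 beta : R,
  0 < beta -> beta <= b1 -> beta <= b2 ->
  `|alpha (sigma b1) - alpha (sigma b2)| <= L * (`|b1 - b2| / beta).

Lemma policy_range b : 0 <= alpha (sigma b) <= abar.
Proof. by apply: alpha_range; have [] := sigma_argmax b. Qed.

Lemma abar_ge0 : 0 <= abar.
Proof. by have := policy_range 0; lra. Qed.

(** The maximum over s of the expression in the problem, as a function of
    B = [gain]. *)
Definition max_hamiltonian (z B : R) : R :=
  (1 - sigma (B / z)) * z + alpha (sigma (B / z)) * B.

Lemma payoff_scale (z B s : R) : 0 < z ->
  (1 - s) * z + alpha s * B = z * payoff alpha (B / z) s.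
Proof. by move=> z0; rewrite /payoff; field; rewrite gt_eqF. Qed.

Lemma le_max_hamiltonian (z B s : R) : 0 < z -> 0 <= s <= 1 ->
  (1 - s) * z + alpha s * B <= max_hamiltonian z B.
Proof.
move=> z0 s01; rewrite /max_hamiltonian !payoff_scale// ler_pM2l//.
by have [_] := sigma_argmax (B / z); exact.
Qed.

Lemma is_argmax_scale (z B s : R) : 0 < z ->
  is_argmax (fun s => (1 - s) * z + alpha s * B) s <->
  is_argmax (payoff alpha (B / z)) s.
Proof.
move=> z0; split=> -[s01 H]; split => // s' s'01; have := H s' s'01.
  by rewrite !payoff_scale// ler_pM2l.
by move=> h; rewrite !payoff_scale// ler_pM2l.
Qed.

(** Envelope principle: a maximum of functions that are affine in [B] with slopes
    in [0, abar]. *)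
Lemma max_hamiltonian_lip (z B1 B2 : R) : 0 < z ->
  `|max_hamiltonian z B1 - max_hamiltonian z B2| <= abar * `|B1 - B2|.
Proof.
move=> z0.
have H B B' : max_hamiltonian z B - max_hamiltonian z B' <= abar * `|B - B'|.
  have := @le_max_hamiltonian z B' (sigma (B / z)) z0.
  have [s01 _] := sigma_argmax (B / z) => /(_ s01).
  have /andP[a0 a1] := policy_range (B / z).
  have h : alpha (sigma (B / z)) * (B - B') <= abar * `|B - B'|.
    by apply: le_trans (ler_wpM2l a0 (ler_norm _)) _; rewrite ler_wpM2r.
  rewrite {2}/max_hamiltonian; lra.
rewrite ler_norml; apply/andP; split; last exact: H.
by rewrite lerNl opprB distrC; exact: H.
Qed.

Lemma max_hamiltonian0 (z : R) : 0 < z -> max_hamiltonian z 0 = z.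
Proof.
move=> z0; have h := @le_max_hamiltonian z 0 0 z0.
have [s01 _] := sigma_argmax (0 / z).
apply/eqP; rewrite eq_le; apply/andP; split; last by move: h; rewrite lexx ler01; lra.
rewrite /max_hamiltonian mulr0 addr0 ler_piMl ?(ltW z0)//; lra.
Qed.

Variables (f0 : R -> R) (m M eta0 eps : R).
Hypothesis f0_W1 : in_W1 f0.
Hypothesis f0_M : N1 f0 <= M.
Hypothesis M_ge1 : 1 <= M.
Hypothesis m_gt0 : 0 < m.
Hypothesis f0_gain : forall z, 0 <= z -> m - z <= gain f0 id z.
Hypothesis eta0_range : 0 <= eta0 <= 1.
Hypothesis eta0_m : 16 * eta0 <= m.
Hypothesis eps_range : 0 <= eps <= 1.
Hypothesis eps_m : 32 * M * eps <= m.

Local Ltac data_lra := have ? := L_gt0; have ? := abar_ge0; have ? := f0_M;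
  have ? := M_ge1; have ? := m_gt0; have ? := eta0_range; have ? := eta0_m;
  have ? := eps_range; have ? := eps_m; lra.

(** The states that occur at a time [tau] before the final one.  At that time the
    value is roughly [tau * z]: an agent who never learns earns z per unit of time,
    while discounting and learning contribute at second order in [tau]. *)
Definition near_data (tau : R) (f V : R -> R) :=
  W1_bound (fun z => f z - f0 z) eta0 /\
  wbound (fun z => V z - tau * z) (eps * tau).

Lemma near_W1 (tau : R) f V : near_data tau f V -> in_W1 f.
Proof.
move=> fV.
have [[df _] _] := fV; have := in_W1D df f0_W1.
by congr in_W1; apply/funext => z; rewrite subrK.
Qed.

Lemma near_N1 (tau : R) f V : near_data tau f V -> N1 f <= 2 * M.
Proof.
move=> fV.
have [[df Nf] _] := fV; have := N1D df f0_W1.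
have -> : (fun z => f z - f0 z + f0 z) = f by apply/funext => z; rewrite subrK.
by move=> /le_trans; apply; apply: le_trans (lerD Nf f0_M) _; data_lra.
Qed.

Lemma near_value_pt (tau : R) (V : R -> R) z : 0 <= tau -> 0 <= z ->
  `|V z - tau * z| <= eps * tau * (1 + z) ->
  `|V z| <= 2 * tau * (1 + z).
Proof.
move=> tau_ge0 z0 h.
have h1 : eps * tau * (1 + z) <= tau * (1 + z).
  by rewrite -mulrA ler_piMl ?mulr_ge0//; data_lra.
have h2 : `|V z| <= `|V z - tau * z| + `|tau * z|.
  by rewrite (le_trans _ (ler_normD _ _))// subrK.
rewrite (@ger0_norm _ (tau * z)) ?mulr_ge0// in h2.
have : tau * z <= tau * (1 + z) by rewrite ler_wpM2l//; data_lra.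
data_lra.
Qed.

Lemma near_value (tau : R) f V : 0 <= tau -> near_data tau f V ->
  wbound V (2 * tau).
Proof.
move=> tau_ge0 fV.
have [_ [mV bV]] := fV; split.
  have := measurable_funD mV (wbound_id tau_ge0).1.
  by apply: eq_measurable_fun => z _ /=; rewrite subrK.
by apply: ae_halflineS bV => z /ltW z0; exact: near_value_pt.
Qed.

Lemma near_gain_le (tau : R) f V z : 0 <= tau -> near_data tau f V ->
  0 <= z -> `|V z - tau * z| <= eps * tau * (1 + z) ->
  `|gain f V z| <= 8 * M * tau * (1 + z).
Proof.
move=> tau_ge0 fV z0 /(near_value_pt tau_ge0 z0) Vz.
have := gain_le (near_W1 fV) (mulr_ge0 (ler0n _ 2) tau_ge0) (near_value tau_ge0 fV) z0 Vz.
move=> /le_trans; apply; rewrite ler_wpM2r//; first data_lra.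
have : 2 * tau * N1 f <= 2 * tau * (2 * M).
  by rewrite ler_wpM2l ?mulr_ge0// (near_N1 fV).
data_lra.
Qed.

(** For V = tau z and f = f_0 the gain is tau times int_z^oo (y - z) f_0(y) dy, which
    is at least tau (m - z).  Half of tau m is lost through z <= m / 4 and the
    perturbation of f, and tau m / 4 through that of V. *)
Lemma near_gain_ge (tau : R) f V z : 0 <= tau -> near_data tau f V ->
  0 <= z -> z <= 1 -> 4 * z <= m ->
  `|V z - tau * z| <= eps * tau * (1 + z) -> tau * (m / 4) <= gain f V z.
Proof.
move=> tau_ge0 fV z0 z1 zm Vz.
have [[df Nf] bV] := fV.
have e0 : 0 <= eps * tau by rewrite mulr_ge0//; data_lra.
have h1 := gain_le (near_W1 fV) e0 bV z0 Vz.
have t0 : 0 <= 2 * tau by rewrite mulr_ge0.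
have := gainBr (near_W1 fV) t0 (near_value tau_ge0 fV) tau_ge0 (wbound_id tau_ge0) z0.
rewrite gain_idZ//; last exact: near_W1 fV.
move=> E; rewrite E in h1.
have bid := @wbound_idfun R.
have h2 := gain_le df ler01 bid z0.
have {}h2 := h2 ltac:(by rewrite ger0_norm// mul1r; data_lra).
rewrite (gainBl (near_W1 fV) f0_W1 ler01 bid z0) in h2.
have h3 := f0_gain z0.
have h4 : 2 * 1 * N1 (fun y => f y - f0 y) * (1 + z) <= m / 4.
  have : N1 (fun y => f y - f0 y) * (1 + z) <= eta0 * 2.
    by rewrite ler_pM ?N1_ge0//; data_lra.
  data_lra.
have h5 : m / 2 <= gain f id z by move: h2; rewrite ler_norml; data_lra.
have h6 : 2 * (eps * tau) * N1 f * (1 + z) <= tau * (m / 4).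
  have -> : 2 * (eps * tau) * N1 f * (1 + z) = tau * (2 * eps * (N1 f * (1 + z))).
    by ring.
  rewrite ler_wpM2l//.
  have : eps * (N1 f * (1 + z)) <= eps * (2 * M * 2).
    rewrite ler_wpM2l//; first data_lra.
    by rewrite ler_pM ?N1_ge0 ?(near_N1 fV)//; data_lra.
  data_lra.
have h7 : tau * (m / 2) <= tau * gain f id z by rewrite ler_wpM2l.
move: h1; rewrite ler_norml; data_lra.
Qed.

Lemma near_hamiltonian (tau : R) f V z : 0 <= tau -> near_data tau f V ->
  0 < z -> `|V z - tau * z| <= eps * tau * (1 + z) ->
  `|max_hamiltonian z (gain f V z) - z| <= 8 * abar * M * tau * (1 + z).
Proof.
move=> tau_ge0 fV z0 Vz; have := max_hamiltonian_lip (gain f V z) 0 z0.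
rewrite max_hamiltonian0// subr0 => /le_trans; apply.
have := near_gain_le tau_ge0 fV (ltW z0) Vz.
by move=> /(ler_wpM2l abar_ge0); data_lra.
Qed.

(** The distance of the values is measured relative to [tau]; in this scaling the
    differences of gains are O(tau * delta), like the lower bound on the gains in
    [near_gain_ge]. *)
Record close_states (tau delta : R) (f g V W : R -> R) : Prop := CloseStates {
  close_tau : 0 <= tau <= 1;
  close_delta : 0 <= delta;
  close_left : near_data tau f V;
  close_right : near_data tau g W;
  close_density : W1_bound (fun z => f z - g z) delta;
  close_value : wbound (fun z => V z - W z) (delta * tau) }.

Lemma close_gain_diff (tau delta : R) f g V W z :
  close_states tau delta f g V W -> 0 <= z ->
  `|W z - tau * z| <= eps * tau * (1 + z) ->
  `|V z - W z| <= delta * tau * (1 + z) ->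
  `|gain f V z - gain g W z| <= 8 * M * tau * delta * (1 + z).
Proof.
move=> [/andP[tau_ge0 tau_le1] delta_ge0 fV gW fg VW] z0 Wz VWz.
have t20 : 0 <= 2 * tau by rewrite mulr_ge0.
have jf := near_W1 fV; have jg := near_W1 gW.
have bV := near_value tau_ge0 fV; have bW := near_value tau_ge0 gW.
have -> : gain f V z - gain g W z =
    gain f (fun y => V y - W y) z + gain (fun y => f y - g y) W z.
  by rewrite (gainBr jf t20 bV t20 bW z0) (gainBl jf jg t20 bW z0) addrA subrK.
have h1 := gain_le jf (mulr_ge0 delta_ge0 tau_ge0) VW z0 VWz.
have h2 := gain_le fg.1 t20 bW z0 (near_value_pt tau_ge0 z0 Wz).
have dt0 : 0 <= delta * tau by rewrite mulr_ge0.
have h3 : 2 * (delta * tau) * N1 f * (1 + z) <= 2 * (delta * tau) * (2 * M) * (1 + z).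
  by rewrite ler_wpM2r ?addr_ge0// ler_wpM2l ?mulr_ge0// (near_N1 fV).
have h4 : 2 * (2 * tau) * N1 (fun y => f y - g y) * (1 + z) <=
    2 * (2 * tau) * delta * (1 + z).
  by rewrite ler_wpM2r ?addr_ge0// ler_wpM2l ?mulr_ge0//; exact: fg.2.
have h5 : (delta * tau) * (1 + z) <= M * ((delta * tau) * (1 + z)).
  by rewrite ler_peMl ?mulr_ge0// addr_ge0.
by apply: le_trans (ler_normD _ _) _; data_lra.
Qed.

(** The two summands belong to the ranges z >= min(1, m/4) and
    z <= min(1, m/4). *)
Definition policy_const : R :=
  8 * L * M * (1 + (Order.min 1 (m / 4))^-1) + 64 * L * M / m.

Lemma policy_const_ge0 : 0 <= policy_const.
Proof.
have h : 0 <= (Order.min 1 (m / 4))^-1.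
  by rewrite invr_ge0 le_min ler01 divr_ge0// ltW.
rewrite /policy_const addr_ge0// ?divr_ge0 ?mulr_ge0 ?addr_ge0//; data_lra.
Qed.

(** For z bounded below the Lipschitz bound of the policy in b = B / z suffices.
    For small z its logarithmic counterpart is used: there |B1 - B2| / min(B1, B2) is
    at most O(tau delta) / (tau m / 4), free of both z and tau. *)
Lemma close_policy_diff (tau delta : R) f g V W z :
  close_states tau delta f g V W -> 0 < z ->
  `|V z - tau * z| <= eps * tau * (1 + z) ->
  `|W z - tau * z| <= eps * tau * (1 + z) ->
  `|V z - W z| <= delta * tau * (1 + z) ->
  `|alpha (sigma (gain f V z / z)) - alpha (sigma (gain g W z / z))|
    <= policy_const * delta.
Proof.
move=> cl z0 Vz Wz VWz; have z0' := ltW z0.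
have hg := close_gain_diff cl z0' Wz VWz.
have [/andP[tau_ge0 tau_le1] delta_ge0 fV gW fg VW] := cl.
set z1 : R := Order.min 1 (m / 4).
have z10 : 0 < z1 by rewrite lt_min ltr01 divr_gt0.
have LM : 0 <= L * M * delta by rewrite !mulr_ge0//; data_lra.
have c1 : 0 <= 8 * L * M * (1 + z1^-1) * delta.
  by rewrite !mulr_ge0 ?addr_ge0 ?invr_ge0//; data_lra.
have c2 : 0 <= 64 * L * M / m * delta by rewrite !mulr_ge0 ?invr_ge0//; data_lra.
rewrite /policy_const -/z1 [leRHS]mulrDl.
have Edist : gain f V z / z - gain g W z / z = (gain f V z - gain g W z) / z.
  by ring.
have [zz1|z1z] := leP z1 z.
  apply: le_trans (policy_lip _ _) _; rewrite Edist normrM (gtr0_norm (x := z^-1)) ?invr_gt0//.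
  have : `|gain f V z - gain g W z| / z <= 8 * M * delta * (1 + z1^-1).
    rewrite ler_pdivrMr//; apply: le_trans hg _.
    have h1 : 1 + z <= (1 + z1^-1) * z.
      have : 1 <= z1^-1 * z by rewrite mulrC ler_pdivlMr// mul1r.
      lra.
    have h2 : 8 * M * tau * delta <= 8 * M * delta.
      rewrite -!mulrA ler_wpM2l// ler_wpM2l//; first data_lra.
      by rewrite ler_piMl.
    rewrite -[leRHS]mulrA ler_pM// ?mulr_ge0//; data_lra.
  by move=> /(ler_wpM2l (ltW L_gt0)); data_lra.
have [z_1 z_m] : z <= 1 /\ 4 * z <= m.
  by move: z1z; rewrite /z1 lt_min => /andP[]; data_lra.
(* At the final time both gains vanish. *)
have [tau0|] := ltP 0 tau; last first.
  move=> tau0; have tE : tau = 0 by data_lra.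
  move: hg; rewrite tE mulr0 !mul0r normr_le0 => /eqP hg.
  by rewrite (_ : gain f V z = gain g W z) ?subrr ?normr0 ?addr_ge0//; data_lra.
have b0 : 0 < tau * (m / 4) / z by rewrite !mulr_gt0// invr_gt0.
have h1 := near_gain_ge tau_ge0 fV z0' z_1 z_m Vz.
have h2 := near_gain_ge tau_ge0 gW z0' z_1 z_m Wz.
apply: le_trans (policy_lip_pos b0 _ _) _.
- by rewrite ler_pM2r// invr_gt0.
- by rewrite ler_pM2r// invr_gt0.
have -> : `|gain f V z / z - gain g W z / z| / (tau * (m / 4) / z) =
    `|gain f V z - gain g W z| / (tau * (m / 4)).
  rewrite Edist normrM (gtr0_norm (x := z^-1)) ?invr_gt0//.
  by field; rewrite !gt_eqF.
have : `|gain f V z - gain g W z| / (tau * (m / 4)) <= 64 * M / m * delta.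
  rewrite ler_pdivrMr; last by rewrite mulr_gt0// divr_gt0.
  have -> : 64 * M / m * delta * (tau * (m / 4)) = 8 * M * tau * delta * 2.
    by field; rewrite gt_eqF.
  apply: le_trans hg _; rewrite ler_wpM2l ?mulr_ge0//; data_lra.
by move=> /(ler_wpM2l (ltW L_gt0)); data_lra.
Qed.

Definition drift_const : R := 4 * M * policy_const + 2 * abar.

Lemma drift_const_ge0 : 0 <= drift_const.
Proof.
by rewrite addr_ge0 ?mulr_ge0 ?policy_const_ge0 ?abar_ge0//; data_lra.
Qed.

Lemma close_drift_diff (tau delta : R) f g V W a b z :
  close_states tau delta f g V W -> ae_bound a abar -> ae_bound b abar ->
  ae_halfline (fun z => `|a z - b z| <= policy_const * delta) -> 0 <= z -> `|b z| <= abar ->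
  `|a z - b z| <= policy_const * delta ->
  `|drift f a z - drift g b z| <= drift_const * delta.
Proof.
move=> [/andP[tau_ge0 tau_le1] delta_ge0 fV gW fg VW] a_bound b_bound ab z0 bz abz.
have a0 := abar_ge0.
have jf := near_W1 fV; have jg := near_W1 gW.
have c0 : 0 <= policy_const * delta by rewrite mulr_ge0// policy_const_ge0.
have bab : ae_bound (fun y => a y - b y) (policy_const * delta).
  by split => //; apply: measurable_funB; [exact: a_bound.1|exact: b_bound.1].
have -> : drift f a z - drift g b z =
    drift f (fun y => a y - b y) z + drift (fun y => f y - g y) b z.
  by rewrite (driftBr jf a0 a_bound b_bound z0) (driftBl jf jg a0 b_bound z0) addrA subrK.
have h1 := drift_le jf c0 bab z0 abz.
have h2 := drift_le fg.1 a0 b_bound z0 bz.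
have h3 : 2 * (policy_const * delta) * N1 f <= 2 * (policy_const * delta) * (2 * M).
  by apply: ler_wpM2l; [rewrite mulr_ge0|exact: near_N1 fV].
have h4 : 2 * abar * N1 (fun y => f y - g y) <= 2 * abar * delta.
  by rewrite ler_wpM2l ?mulr_ge0//; exact: fg.2.
by apply: le_trans (ler_normD _ _) _; rewrite /drift_const; data_lra.
Qed.

(** * Existence *)

Variables (r T Kinf : R).
Hypothesis r_ge0 : 0 <= r.
Hypothesis T_range : 0 < T <= 1.
Hypothesis policy_measurable : measurable_fun setT sigma.
Hypothesis rate_measurable : measurable_fun setT (fun b => alpha (sigma b)).
Hypothesis T_density : 16 * abar * M ^+ 2 * T <= eta0.
Hypothesis T_value : 4 * (2 * r + 8 * abar * M ^+ 2) * T <= eps.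
Hypothesis T_contract : 4 * (4 * abar * M + 2 * M * drift_const) * T <= 1.

Lemma M_gt0 : 0 < M. Proof. exact: lt_le_trans M_ge1. Qed.

(** Bounds the growth of V - (T - t) z, relative to T - t and to 1 + z. *)
Definition value_const : R := 2 * r + 8 * abar * M ^+ 2.

Lemma M_le_sqr : 8 * abar * M <= 8 * abar * M ^+ 2.
Proof.
rewrite expr2 ler_wpM2l ?mulr_ge0 ?abar_ge0// ler_peMl//; data_lra.
Qed.

Lemma value_const_ge0 : 0 <= value_const.
Proof. by rewrite addr_ge0 ?mulr_ge0 ?abar_ge0 ?exprn_ge0//; data_lra. Qed.

Lemma value_const_T : value_const * T <= eps / 4.
Proof. by have := T_value; rewrite /value_const; lra. Qed.

Lemma near_cost (tau : R) f V z : 0 <= tau -> near_data tau f V -> 0 < z ->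
  `|V z - tau * z| <= eps * tau * (1 + z) ->
  `|max_hamiltonian z (gain f V z) - r * V z - z| <= value_const * tau * (1 + z).
Proof.
move=> tau0 nd z0 Vn.
have h1 := near_hamiltonian tau0 nd z0 Vn.
have h2 := near_value_pt tau0 (ltW z0) Vn.
have h3 : `|r * V z| <= r * (2 * tau * (1 + z)).
  by rewrite normrM ger0_norm//; apply: ler_wpM2l.
have h4 : 8 * abar * M * (tau * (1 + z)) <= 8 * abar * M ^+ 2 * (tau * (1 + z)).
  by rewrite ler_wpM2r ?M_le_sqr// mulr_ge0//; lra.
rewrite addrAC; apply: le_trans (ler_normB _ _) _.
by rewrite /value_const; lra.
Qed.

Lemma T_itv : 0 <= T <= T.
Proof. by have := T_range; lra. Qed.

Section existence.
Hypothesis f0_measurable : measurable_fun setT f0.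
Hypothesis f0_ge0 : forall z, 0 <= f0 z.
Hypothesis f0_le : forall z, f0 z <= Kinf.

Implicit Types (rho V : R * R -> R) (p : R * R) (z t : R).

(** The point z = 0 is left out, since the policy is evaluated at B / z. *)
Definition dom p : bool := (0 < p.1) && (0 <= p.2 <= T).

(** The equation for rho = f / f_0 has initial value 1 and bounded coefficients, so
    that it can be solved pointwise in z. *)
Definition density rho t z : R := f0 z * rho (z, t).

Definition value V t z : R := V (z, t).

Definition rate rho V p : R :=
  alpha (sigma (gain (density rho p.2) (value V p.2) p.1 / p.1)).

Definition growth rho V p : R :=
  rho p * drift (density rho p.2) (fun y => rate rho V (y, p.2)) p.1.

(** The equation for V reads - dV/dt = [cost]. *)
Definition cost rho V p : R :=
  max_hamiltonian p.1 (gain (density rho p.2) (value V p.2) p.1) - r * V p.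

Lemma measurable_density rho : measurable_fun setT rho ->
  measurable_fun setT (fun p => f0 p.1 * rho p).
Proof.
by move=> mrho; apply: measurable_funM => //; exact: (measurableT_comp f0_measurable).
Qed.

Section joint.
Variables rho V : R * R -> R.
Hypothesis mrho : measurable_fun setT rho.
Hypothesis mV : measurable_fun setT V.

Lemma measurable_gain_joint :
  measurable_fun setT (fun p => gain (density rho p.2) (value V p.2) p.1).
Proof.
apply: measurable_funB.
  apply: (measurable_tail_joint (rho := fun p => V p * (f0 p.1 * rho p))).
  by apply: measurable_funM => //; exact: measurable_density mrho.
apply: measurable_funM => /=.
  by apply: eq_measurable_fun mV => -[].
exact: (measurable_tail_joint (measurable_density mrho)).
Qed.

Lemma measurable_ratio_joint :
  measurable_fun setT (fun p => gain (density rho p.2) (value V p.2) p.1 / p.1).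
Proof.
apply: measurable_funM; first exact: measurable_gain_joint.
by apply: (measurableT_comp inv_measurable).
Qed.

Lemma measurable_rate_joint : measurable_fun setT (rate rho V).
Proof. exact: (measurableT_comp rate_measurable measurable_ratio_joint). Qed.

Lemma measurable_growth_joint : measurable_fun setT (growth rho V).
Proof.
apply: measurable_funM => //; apply: measurable_funD.
  apply: measurable_funM.
    apply: measurable_funN.
    by apply: eq_measurable_fun measurable_rate_joint => -[].
  exact: (measurable_tail_joint (measurable_density mrho)).
apply: (measurable_init_joint (rho := fun p => rate rho V p * (f0 p.1 * rho p))).
by apply: measurable_funM; [exact: measurable_rate_joint|exact: measurable_density mrho].
Qed.

Lemma measurable_cost_joint : measurable_fun setT (cost rho V).
Proof.
have ms := measurableT_comp policy_measurable measurable_ratio_joint.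
apply: measurable_funB; last exact: (measurable_funM (measurable_cst r) mV).
apply: measurable_funD.
  apply: measurable_funM => //.
  by apply: measurable_funB.
by apply: measurable_funM; [exact: measurable_rate_joint|exact: measurable_gain_joint].
Qed.

End joint.

(** The pointwise form of [near_data], uniform in time. *)
Record admissible rho V : Prop := Admissible {
  adm_rho : measurable_fun setT rho;
  adm_V : measurable_fun setT V;
  adm_rho_near : forall p, dom p -> `|rho p - 1| <= eta0 / M;
  adm_V_near : forall p, dom p ->
    `|V p - (T - p.2) * p.1| <= eps * (T - p.2) * (1 + p.1) }.

Lemma domP z t : 0 < z -> 0 <= t <= T -> dom (z, t).
Proof. by move=> z0 tT; rewrite /dom/= z0. Qed.

Lemma density_W1 rho (c t : R) : measurable_fun setT rho -> 0 <= c ->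
  (forall z, 0 < z -> `|rho (z, t)| <= c) ->
  W1_bound (density rho t) (c * M).
Proof.
move=> mrho c0 rc.
have [] := @in_W1_le _ c f0 (density rho t) f0_W1 c0.
- by apply: measurable_funTS; exact: measurable_section1 (measurable_density mrho).
- apply: ae_halfline_pos => z z0; rewrite normrM mulrC ler_wpM2r//.
  exact: rc.
by move=> h1 h2; split => //; apply: le_trans h2 _; rewrite ler_wpM2l.
Qed.

Lemma rate_le rho V p : `|rate rho V p| <= abar.
Proof.
by have /andP[h0 h1] := policy_range (gain (density rho p.2) (value V p.2) p.1 / p.1);
  rewrite ger0_norm.
Qed.

Section one_admissible.
Variables rho V : R * R -> R.
Hypothesis adm : admissible rho V.

Lemma adm_near t : 0 <= t <= T ->
  near_data (T - t) (density rho t) (value V t).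
Proof.
move=> tT; have [mrho mV rho1 Vn] := adm.
split.
  have k0 : 0 <= eta0 / M by rewrite divr_ge0 ?(ltW M_gt0)//; data_lra.
  have := @density_W1 (fun p => rho p - 1) (eta0 / M) t _ k0.
  rewrite divfK ?gt_eqF ?M_gt0// => H.
  rewrite (_ : (fun z => _) = density (fun p => rho p - 1) t).
    apply: H => [|z z0]; first exact: measurable_funB.
    by apply: rho1; exact: domP.
  by apply/funext => z; rewrite /density; ring.
split.
  apply: measurable_funB; last exact: mulrl_measurable.
  by apply: measurable_funTS; exact: measurable_section1.
by apply: ae_halfline_pos => z z0; exact: (Vn (z, t) (domP z0 tT)).
Qed.

Lemma adm_value_pt p : dom p ->
  `|value V p.2 p.1 - (T - p.2) * p.1| <= eps * (T - p.2) * (1 + p.1).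
Proof. by move=> dp; have := adm_V_near adm dp; case: p {dp}. Qed.

Lemma adm_rho_le2 p : dom p -> `|rho p| <= 2.
Proof.
move=> /(adm_rho_near adm) h.
have h1 : eta0 / M <= 1 by rewrite ler_pdivrMr ?M_gt0//; data_lra.
by have := ler_normD (rho p - 1) 1; rewrite subrK normr1; lra.
Qed.

Lemma adm_rho_ge0 p : dom p -> 0 <= rho p.
Proof.
move=> /(adm_rho_near adm) h.
have h1 : eta0 / M <= 1 by rewrite ler_pdivrMr ?M_gt0//; data_lra.
by move: h; rewrite ler_norml; lra.
Qed.

Lemma rate_ae_bound t : ae_bound (fun y => rate rho V (y, t)) abar.
Proof.
split; last by apply: ae_halfline_pos => z _; exact: rate_le.
apply: measurable_funTS; apply: measurable_section1.
by have [mrho mV _ _] := adm; exact: measurable_rate_joint.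
Qed.

Lemma adm_drift_le p : dom p ->
  `|drift (density rho p.2) (fun y => rate rho V (y, p.2)) p.1| <= 4 * abar * M.
Proof.
move=> /andP[z0 tT]; have nd := adm_near tT.
have := drift_le (near_W1 nd) abar_ge0 (rate_ae_bound p.2) (ltW z0) (rate_le rho V _).
move=> /le_trans; apply.
have := ler_wpM2l (mulr_ge0 (ler0n _ 2) abar_ge0) (near_N1 nd).
by lra.
Qed.

Lemma adm_growth_le p : dom p -> `|growth rho V p| <= 8 * abar * M.
Proof.
move=> dp; rewrite normrM.
have := ler_pM (normr_ge0 _) (normr_ge0 _) (adm_rho_le2 dp) (adm_drift_le dp).
by move=> /le_trans; apply; lra.
Qed.

Lemma adm_cost_near p : dom p ->
  `|cost rho V p - p.1| <= value_const * (T - p.2) * (1 + p.1).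
Proof.
move=> dp; have /andP[z0 tT] := dp.
have tau0 : 0 <= T - p.2 by lra.
have := near_cost tau0 (adm_near tT) z0 (adm_value_pt dp).
by rewrite /cost /value -surjective_pairing.
Qed.

Lemma adm_cost_le p : dom p -> `|cost rho V p| <= 2 * (1 + p.1).
Proof.
move=> dp; have /andP[z0 tT] := dp.
have h := adm_cost_near dp.
have h1 : value_const * (T - p.2) * (1 + p.1) <= 1 * (1 + p.1).
  rewrite ler_wpM2r//; first lra.
  have : value_const * (T - p.2) <= value_const * T.
    by rewrite ler_wpM2l ?value_const_ge0//; lra.
  have := value_const_T; data_lra.
have := ler_normD (cost rho V p - p.1) p.1; rewrite subrK (gtr0_norm z0).
lra.
Qed.

Lemma adm_growth_meas z : measurable_fun setT (fun s => growth rho V (z, s)).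
Proof.
apply: measurable_section2.
by have [mrho mV _ _] := adm; exact: measurable_growth_joint.
Qed.

Lemma adm_cost_meas z : measurable_fun setT (fun s => cost rho V (z, s)).
Proof.
apply: measurable_section2.
by have [mrho mV _ _] := adm; exact: measurable_cost_joint.
Qed.

End one_admissible.

Section two_admissible.
Variables (rho1 V1 rho2 V2 : R * R -> R) (d : R).
Hypothesis adm1 : admissible rho1 V1.
Hypothesis adm2 : admissible rho2 V2.
Hypothesis d_ge0 : 0 <= d.
Hypothesis rho12 : forall p, dom p -> `|rho1 p - rho2 p| <= d.
Hypothesis V12 : forall p, dom p ->
  `|V1 p - V2 p| <= d * ((T - p.2) * (1 + p.1)).

Lemma adm_value_diff_pt p : dom p ->
  `|value V1 p.2 p.1 - value V2 p.2 p.1| <= d * M * (T - p.2) * (1 + p.1).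
Proof.
move=> dp; have /andP[z0 tT] := dp; rewrite /value -!surjective_pairing.
apply: le_trans (V12 dp) _; rewrite -!mulrA ler_wpM2l// ler_peMl//.
by rewrite mulr_ge0//; lra.
Qed.

Lemma adm_close t : 0 <= t <= T ->
  close_states (T - t) (d * M) (density rho1 t) (density rho2 t)
    (value V1 t) (value V2 t).
Proof.
move=> tT; split.
- by have := T_range; lra.
- by rewrite mulr_ge0// ltW// M_gt0.
- exact: adm_near.
- exact: adm_near.
- rewrite (_ : (fun z => _) = density (fun p => rho1 p - rho2 p) t).
    apply: density_W1 => //.
      by apply: measurable_funB; [exact: adm_rho adm1|exact: adm_rho adm2].
    by move=> z z0; apply: rho12; exact: domP.
  by apply/funext => z; rewrite /density; ring.
- split.
    apply: measurable_funTS; apply: measurable_funB; apply: measurable_section1.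
      exact: adm_V adm1.
    exact: adm_V adm2.
  by apply: ae_halfline_pos => z z0; exact: (adm_value_diff_pt (domP z0 tT)).
Qed.

Lemma adm_rate_diff p : dom p ->
  `|rate rho1 V1 p - rate rho2 V2 p| <= policy_const * (d * M).
Proof.
move=> dp; have /andP[z0 tT] := dp.
apply: (close_policy_diff (adm_close tT) z0).
- exact (adm_value_pt adm1 dp).
- exact (adm_value_pt adm2 dp).
- exact (adm_value_diff_pt dp).
Qed.

Lemma adm_growth_diff p : dom p ->
  `|growth rho1 V1 p - growth rho2 V2 p| <=
    (4 * abar * M + 2 * M * drift_const) * d.
Proof.
move=> dp; have /andP[z0 tT] := dp.
have hd := close_drift_diff (adm_close tT) (rate_ae_bound adm1 p.2)
  (rate_ae_bound adm2 p.2) _ (ltW z0) (rate_le rho2 V2 _) _.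
have {}hd := hd ltac:(by apply: ae_halfline_pos => z z0'; apply: (@adm_rate_diff (z, p.2)); exact: domP).
have hr := adm_rate_diff dp.
have {}hd := hd ltac:(by case: p {dp z0 tT hd} hr).
have h1 := adm_drift_le adm1 dp.
have h2 := adm_rho_le2 adm2 dp.
have h3 := rho12 dp.
rewrite /growth.
set D1 := drift _ _ _ in hd h1 *.
set D2 := drift _ _ _ in hd *.
have -> : rho1 p * D1 - rho2 p * D2 = (rho1 p - rho2 p) * D1 + rho2 p * (D1 - D2).
  by ring.
apply: le_trans (ler_normD _ _) _; rewrite !normrM.
have h4 : `|rho1 p - rho2 p| * `|D1| <= d * (4 * abar * M) by exact: ler_pM.
have h5 : `|rho2 p| * `|D1 - D2| <= 2 * (drift_const * (d * M)) by exact: ler_pM.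
by lra.
Qed.

Lemma adm_cost_diff p : dom p ->
  `|cost rho1 V1 p - cost rho2 V2 p| <=
    value_const * d * ((T - p.2) * (1 + p.1)).
Proof.
move=> dp; have /andP[z0 tT] := dp.
have h1 := close_gain_diff (adm_close tT) (ltW z0) (adm_value_pt adm2 dp)
  (adm_value_diff_pt dp).
have h2 := max_hamiltonian_lip (gain (density rho1 p.2) (value V1 p.2) p.1)
  (gain (density rho2 p.2) (value V2 p.2) p.1) z0.
have h3 := V12 dp.
have h4 := le_trans h2 (ler_wpM2l abar_ge0 h1).
have h5 : `|r * (V1 p - V2 p)| <= r * (d * ((T - p.2) * (1 + p.1))).
  by rewrite normrM ger0_norm// ler_wpM2l.
rewrite /cost.
set H1 := max_hamiltonian _ _ in h4 *; set H2 := max_hamiltonian _ _ in h4 *.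
have -> : H1 - r * V1 p - (H2 - r * V2 p) = (H1 - H2) - r * (V1 p - V2 p) by ring.
apply: le_trans (ler_normB _ _) _; rewrite /value_const expr2.
have : 0 <= r * (d * ((T - p.2) * (1 + p.1))) by rewrite !mulr_ge0//; lra.
lra.
Qed.

End two_admissible.

(** One step of the iteration.  The two unknowns are stored as one function, with
    the boolean selecting [rho] or [V]; outside [dom] they are frozen at 1 and 0. *)
Definition step (u : bool * (R * R) -> R) (i : bool * (R * R)) : R :=
  let rho p := u (true, p) in let V p := u (false, p) in
  let: (b, p) := i in
  if dom p then
    if b then 1 + time_integral (fun s => growth rho V (p.1, s)) p.2
    else time_integral (fun s => cost rho V (p.1, s)) T
         - time_integral (fun s => cost rho V (p.1, s)) p.2
  else b%:R.

(** The factor T - t matches [close_states]. *)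
Definition weight (i : bool * (R * R)) : R :=
  let: (b, p) := i in
  if dom p then if b then 1 else (T - p.2) * (1 + p.1) else 0.

Definition adm_state (u : bool * (R * R) -> R) : Prop :=
  admissible (fun p => u (true, p)) (fun p => u (false, p)) /\
  (forall b p, ~~ dom p -> u (b, p) = b%:R).

Lemma measurable_dom : measurable_fun setT dom.
Proof.
apply: measurable_and; first exact: measurable_fun_ltr.
by apply: measurable_and; exact: measurable_fun_ler.
Qed.

Lemma weight_ge0 i : 0 <= weight i.
Proof.
case: i => b p /=; case: ifP => // /andP[z0 tT]; case: b => //.
by rewrite mulr_ge0//; lra.
Qed.

Lemma dom_sub p s : dom p -> 0 <= s <= T -> dom (p.1, s).
Proof. by move=> /andP[z0 _] sT; exact: domP. Qed.

Lemma step_admissible u : adm_state u -> adm_state (step u).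
Proof.
move=> [adm _]; split; last by move=> b p dp; rewrite /step (negbTE dp).
set rho := (fun p => u (true, p)) in adm.
set V := (fun p => u (false, p)) in adm.
have [mrho mV _ _] := adm.
have mg := measurable_growth_joint mrho mV.
have mc := measurable_cost_joint mrho mV.
split.
- rewrite (_ : (fun p => _) = fun p => if dom p then
    1 + time_integral (fun s => growth rho V (p.1, s)) p.2 else 1)//.
  apply: (measurable_fun_ifT measurable_dom); last exact: measurable_cst.
  have h := measurable_funD (measurable_cst (1 : R)) (measurable_time_integral mg).
  exact h.
- rewrite (_ : (fun p => _) = fun p => if dom p then
    time_integral (fun s => cost rho V (p.1, s)) T
    - time_integral (fun s => cost rho V (p.1, s)) p.2 else 0)//.
  apply: (measurable_fun_ifT measurable_dom); last exact: measurable_cst.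
  apply: measurable_funB; last exact: measurable_time_integral.
  apply: (measurableT_comp (measurable_time_integral mc)
    (g := fun p : R * R => (p.1, T))).
  exact: measurable_fun_pair.
- move=> p dp; rewrite /step dp -/rho -/V addrC addKr.
  have /andP[z0 tT] := dp.
  have := @time_integral_diff _ (fun s => growth rho V (p.1, s)) T
    (8 * abar * M) 0 (8 * abar * M) 0 p.2 (adm_growth_meas adm p.1).
  rewrite time_integral0 !subr0 mulr0 subr0 => H.
  apply: le_trans (H _ _ _ _ _) _; rewrite ?lexx//; try lra.
  + by move=> s sT; apply: (adm_growth_le adm); exact: dom_sub.
  + by move=> s sT; rewrite subr0; apply: (adm_growth_le adm); apply: dom_sub => //; lra.
  + rewrite ler_pdivlMr ?M_gt0//.
    have h1 : p.2 * (8 * abar * M) * M <= T * (8 * abar * M) * M.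
      rewrite ler_wpM2r ?(ltW M_gt0)// ler_wpM2r ?mulr_ge0 ?abar_ge0 ?(ltW M_gt0)//; lra.
    have h2 : 0 <= T * (8 * abar * M) * M.
      by rewrite !mulr_ge0 ?abar_ge0 ?(ltW M_gt0)//; lra.
    by have := T_density; rewrite expr2; lra.
- move=> p dp; rewrite /step dp -/rho -/V.
  have /andP[z0 tT] := dp.
  have := @time_integral_diff _ (fun s => cost rho V (p.1, s)) T
    (2 * (1 + p.1)) p.1 (value_const * (T - p.2) * (1 + p.1)) p.2 T
    (adm_cost_meas adm p.1) => H.
  apply: le_trans (H _ _ _ _ _) _; rewrite ?lexx//; try lra.
  + by move=> s sT; apply: (adm_cost_le adm (dom_sub dp sT)).
  + move=> s sT; have sT' : 0 <= s <= T by lra.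
    apply: le_trans (adm_cost_near adm (dom_sub dp sT')) _ => /=.
    rewrite ler_wpM2r//; first lra.
    by rewrite ler_wpM2l ?value_const_ge0//; lra.
  + have -> : (T - p.2) * (value_const * (T - p.2) * (1 + p.1)) =
      value_const * (T - p.2) * ((T - p.2) * (1 + p.1)) by ring.
    rewrite -[leRHS]mulrA ler_wpM2r//; first by rewrite mulr_ge0//; lra.
    have := value_const_T.
    have : value_const * (T - p.2) <= value_const * T.
      by rewrite ler_wpM2l ?value_const_ge0//; lra.
    by data_lra.
Qed.

(** The rate of change of [rho] is Lipschitz in the weighted norm, and integration
    over [0,t] gains the small factor T.  The costs differ by O(T) d (1 + z), and
    integration over [t,T] supplies the factor T - t of the weight. *)
Lemma step_contract u v (d : R) : adm_state u -> adm_state v -> 0 <= d ->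
  (forall i, `|u i - v i| <= d * weight i) ->
  forall i, `|step u i - step v i| <= d / 2 * weight i.
Proof.
move=> [admu _] [admv _] d0 uv [b p]; rewrite /weight /step.
case: ifP => dp; last by rewrite subrr normr0 mulr0.
set rho1 := (fun p => u (true, p)) in admu *.
set V1 := (fun p => u (false, p)) in admu *.
set rho2 := (fun p => v (true, p)) in admv *.
set V2 := (fun p => v (false, p)) in admv *.
have rho12 q : dom q -> `|rho1 q - rho2 q| <= d.
  by move=> dq; have := uv (true, q); rewrite /weight dq mulr1.
have V12 q : dom q -> `|V1 q - V2 q| <= d * ((T - q.2) * (1 + q.1)).
  by move=> dq; have := uv (false, q); rewrite /weight dq.
have /andP[z0 tT] := dp.
case: b.
  rewrite opprD addrACA subrr add0r mulr1.
  have H := @time_integral_dist0 _ (fun s => growth rho1 V1 (p.1, s))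
    (fun s => growth rho2 V2 (p.1, s)) T (8 * abar * M)
    ((4 * abar * M + 2 * M * drift_const) * d) p.2
    (adm_growth_meas admu p.1) (adm_growth_meas admv p.1).
  apply: le_trans (H _ _ tT _) _.
  - by move=> s sT; apply: (adm_growth_le admu); exact: dom_sub.
  - by move=> s sT; apply: (adm_growth_le admv); exact: dom_sub.
  - move=> s sT; apply: (adm_growth_diff admu admv d0 rho12 V12).
    by apply: dom_sub => //; lra.
  - set c := 4 * abar * M + 2 * M * drift_const.
    have c0 : 0 <= c.
      by rewrite /c addr_ge0 ?mulr_ge0 ?abar_ge0 ?drift_const_ge0 ?(ltW M_gt0).
    have h1 : p.2 * (c * d) <= T * (c * d) by rewrite ler_wpM2r ?mulr_ge0//; lra.
    have h2 : 4 * (c * T) * d <= 1 * d.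
      by rewrite ler_wpM2r//; have := T_contract; rewrite -/c; lra.
    by lra.
have := @time_integral_dist _ (fun s => cost rho1 V1 (p.1, s))
    (fun s => cost rho2 V2 (p.1, s)) T (2 * (1 + p.1))
    (value_const * d * (T * (1 + p.1))) p.2 T
    (adm_cost_meas admu p.1) (adm_cost_meas admv p.1) => H.
apply: le_trans (H _ _ _ _ _ _) _; rewrite ?lexx//; try lra.
- by move=> s sT; apply: (adm_cost_le admu (dom_sub dp sT)).
- by move=> s sT; apply: (adm_cost_le admv (dom_sub dp sT)).
- move=> s sT; have sT' : 0 <= s <= T by lra.
  apply: le_trans (adm_cost_diff admu admv d0 rho12 V12 (dom_sub dp sT')) _ => /=.
  rewrite ler_wpM2l ?mulr_ge0 ?value_const_ge0// ler_wpM2r//; lra.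
- have -> : (T - p.2) * (value_const * d * (T * (1 + p.1))) =
    (value_const * T) * (d * ((T - p.2) * (1 + p.1))) by ring.
  have -> : d / 2 * ((T - p.2) * (1 + p.1)) =
    2^-1 * (d * ((T - p.2) * (1 + p.1))) by ring.
  rewrite ler_wpM2r//; first by rewrite !mulr_ge0//; lra.
  by have := value_const_T; data_lra.
Qed.

Lemma adm_state_closed (s : nat -> bool * (R * R) -> R) u :
  (forall n, adm_state (s n)) -> (forall i, s n i @[n --> \oo] --> u i) ->
  adm_state u.
Proof.
move=> As su; split; last first.
  move=> b p dp; have := su (b, p).
  have -> : (fun n => s n (b, p)) = (fun _ => b%:R).
    by apply/funext => n; apply: (As n).2.
  by move=> /cvg_unique; apply => //; exact: cvg_cst.
split.
- apply: (measurable_fun_cvg (h := fun n p => s n (true, p))).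
    by move=> n; have [] := (As n).1.
  by move=> p _; exact: su.
- apply: (measurable_fun_cvg (h := fun n p => s n (false, p))).
    by move=> n; have [] := (As n).1.
  by move=> p _; exact: su.
- move=> p dp.
  have c : (fun n => `|s n (true, p) - 1|) @ \oo --> `|u (true, p) - 1|.
    by apply: cvg_norm; apply: cvgB; [exact: su|exact: cvg_cst].
  apply: (cvgr_to_le c); near=> n.
  by have [_ _ H _] := (As n).1; exact: H.
- move=> p dp.
  have c : (fun n => `|s n (false, p) - (T - p.2) * p.1|) @ \oo -->
      `|u (false, p) - (T - p.2) * p.1|.
    by apply: cvg_norm; apply: cvgB; [exact: su|exact: cvg_cst].
  apply: (cvgr_to_le c); near=> n.
  by have [_ _ _ H] := (As n).1; exact: H.
Unshelve. all: by end_near. Qed.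

Definition initial_state (i : bool * (R * R)) : R :=
  let: (b, p) := i in
  if dom p then if b then 1 else (T - p.2) * p.1 else b%:R.

Lemma initial_adm_state : adm_state initial_state.
Proof.
split; last by move=> b p dp; rewrite /initial_state (negbTE dp).
split.
- rewrite (_ : (fun p => _) = fun p => if dom p then 1 else 1)//.
  by apply: (measurable_fun_ifT measurable_dom); exact: measurable_cst.
- rewrite (_ : (fun p => _) = fun p => if dom p then (T - p.2) * p.1 else 0)//.
  apply: (measurable_fun_ifT measurable_dom); last exact: measurable_cst.
  apply: measurable_funM => //.
  by apply: measurable_funB => //; exact: measurable_cst.
- move=> p dp; rewrite /initial_state dp subrr normr0 divr_ge0 ?(ltW M_gt0)//.
  data_lra.
- move=> p dp; rewrite /initial_state dp subrr normr0.
  have /andP[z0 tT] := dp.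
  by rewrite !mulr_ge0//; data_lra.
Qed.

Lemma fixed_point_exists : exists rho V, admissible rho V /\
  forall p, dom p ->
    rho p = 1 + time_integral (fun s => growth rho V (p.1, s)) p.2 /\
    V p = time_integral (fun s => cost rho V (p.1, s)) T -
          time_integral (fun s => cost rho V (p.1, s)) p.2.
Proof.
have [||u [au _] ufix] := @picard_fixpoint R _ adm_state step weight
  weight_ge0 step_admissible adm_state_closed step_contract initial_state 2 initial_adm_state.
- exact: ler0n.
- have [a1 out1] := initial_adm_state.
  have [a2 out2] := step_admissible initial_adm_state.
  move=> [b p]; case: (boolP (dom p)) => dp; last first.
    by rewrite out1// out2// subrr normr0 mulr_ge0// weight_ge0.
  case: b.
    have h1 := adm_rho_near a1 dp; have h2 := adm_rho_near a2 dp.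
    have h3 : eta0 / M <= 1 by rewrite ler_pdivrMr ?M_gt0//; data_lra.
    rewrite /weight dp; move: h1 h2; rewrite distrC.
    have := ler_normD (step initial_state (true, p) - 1) (1 - initial_state (true, p)).
    by rewrite addrA subrK; lra.
  have h1 := adm_V_near a1 dp; have h2 := adm_V_near a2 dp.
  have /andP[z0 tT] := dp.
  have h3 : eps * (T - p.2) * (1 + p.1) <= 1 * ((T - p.2) * (1 + p.1)).
    rewrite -mulrA ler_wpM2r//; first by rewrite mulr_ge0//; lra.
    by data_lra.
  rewrite /weight dp; move: h1 h2; rewrite distrC.
  have := ler_normD (step initial_state (false, p) - (T - p.2) * p.1) ((T - p.2) * p.1 - initial_state (false, p)).
  by rewrite addrA subrK; lra.
exists (fun p => u (true, p)), (fun p => u (false, p)); split => // p dp.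
by split; [have := ufix (true, p)|have := ufix (false, p)]; rewrite /step dp => <-.
Qed.

Section fixed_point.
Variables rho V : R * R -> R.
Hypothesis adm : admissible rho V.
Hypothesis rho_fix : forall p, dom p ->
  rho p = 1 + time_integral (fun s => growth rho V (p.1, s)) p.2.
Hypothesis V_fix : forall p, dom p ->
  V p = time_integral (fun s => cost rho V (p.1, s)) T -
        time_integral (fun s => cost rho V (p.1, s)) p.2.

Let speed : R := 8 * abar * M.

Lemma speed_ge0 : 0 <= speed.
Proof. by rewrite !mulr_ge0 ?abar_ge0 ?(ltW M_gt0). Qed.

Lemma growth_bounded z : 0 < z ->
  forall s, 0 <= s <= T -> `|growth rho V (z, s)| <= speed.
Proof. by move=> z0 s sT; apply: (adm_growth_le adm); exact: domP. Qed.

Lemma cost_bounded z : 0 < z ->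
  forall s, 0 <= s <= T -> `|cost rho V (z, s)| <= 2 * (1 + z).
Proof. by move=> z0 s sT; exact: (adm_cost_le adm (domP z0 sT)). Qed.

Lemma rho_lip z t t' : 0 < z -> 0 <= t <= T -> 0 <= t' <= T ->
  `|rho (z, t') - rho (z, t)| <= speed * `|t' - t|.
Proof.
move=> z0 tT t'T; rewrite !rho_fix; [|exact: domP..].
rewrite opprD addrACA subrr add0r.
exact (time_integral_lip (adm_growth_meas adm z) (growth_bounded z0) tT t'T).
Qed.

Lemma V_lip z t t' : 0 < z -> 0 <= t <= T -> 0 <= t' <= T ->
  `|V (z, t') - V (z, t)| <= 2 * `|t' - t| * (1 + z).
Proof.
move=> z0 tT t'T; rewrite !V_fix; [|exact: domP..].
rewrite /= opprB addrC addrA subrK -normrN opprB mulrAC.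
exact (time_integral_lip (adm_cost_meas adm z) (cost_bounded z0) tT t'T).
Qed.

Lemma density_lip t t' : 0 <= t <= T -> 0 <= t' <= T ->
  W1_bound (fun z => density rho t' z - density rho t z)
    (speed * `|t' - t| * M).
Proof.
move=> tT t'T.
have mr : measurable_fun setT (fun p : R * R => rho (p.1, t') - rho (p.1, t)).
  apply: measurable_funB.
    exact: (measurableT_comp (measurable_section1 t' (adm_rho adm)) measurable_fst).
  exact: (measurableT_comp (measurable_section1 t (adm_rho adm)) measurable_fst).
have := @density_W1 (fun p => rho (p.1, t') - rho (p.1, t)) (speed * `|t' - t|) t mr.
have -> : density (fun p => rho (p.1, t') - rho (p.1, t)) t =
    (fun z => density rho t' z - density rho t z).
  by apply/funext => z; rewrite /density /= mulrBr.
apply; first by rewrite mulr_ge0// speed_ge0.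
by move=> z z0; exact: rho_lip.
Qed.

Lemma value_lip t t' : 0 <= t <= T -> 0 <= t' <= T ->
  wbound (fun z => value V t' z - value V t z) (2 * `|t' - t|).
Proof.
move=> tT t'T; split; last by apply: ae_halfline_pos => z z0; exact: V_lip.
apply: measurable_funTS; apply: measurable_funB.
  exact: (measurable_section1 _ (adm_V adm)).
exact: (measurable_section1 _ (adm_V adm)).
Qed.

Let gain_speed : R := 8 * M + 32 * abar * M ^+ 2.

Lemma gain_speed_ge0 : 0 <= gain_speed.
Proof. by rewrite addr_ge0 ?mulr_ge0 ?abar_ge0 ?exprn_ge0 ?(ltW M_gt0). Qed.

(** In contrast with [close_states] there is no factor T - t here: the gain
    vanishes at the final time, its variation in time does not, so the logarithmic bound
    of the policy does not apply and the rate varies in time at a speed of order 1 / z. *)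
Lemma gain_lip z t t' : 0 < z -> 0 <= t <= T -> 0 <= t' <= T ->
  `|gain (density rho t') (value V t') z - gain (density rho t) (value V t) z|
    <= gain_speed * `|t' - t| * (1 + z).
Proof.
move=> z0 tT t'T.
have nt := adm_near adm tT; have nt' := adm_near adm t'T.
have tau0 : 0 <= T - t by lra.
have tau'0 : 0 <= T - t' by lra.
have jt := near_W1 nt; have jt' := near_W1 nt'.
have bt := near_value tau0 nt; have bt' := near_value tau'0 nt'.
have c0 : 0 <= 2 * (T - t) by rewrite mulr_ge0.
have c'0 : 0 <= 2 * (T - t') by rewrite mulr_ge0.
have -> : gain (density rho t') (value V t') z - gain (density rho t) (value V t) z =
    gain (density rho t') (fun y => value V t' y - value V t y) z +
    gain (fun y => density rho t' y - density rho t y) (value V t) z.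
  by rewrite (gainBr jt' c'0 bt' c0 bt (ltW z0)) (gainBl jt' jt c0 bt (ltW z0)) addrA subrK.
have [jd Nd] := density_lip tT t'T.
have d0 : 0 <= 2 * `|t' - t| by rewrite mulr_ge0.
have h1 := gain_le jt' d0 (value_lip tT t'T) (ltW z0) (V_lip z0 tT t'T).
have h2 := gain_le jd c0 bt (ltW z0)
  (near_value_pt tau0 (ltW z0) (adm_value_pt adm (domP z0 tT))).
have h3 : 2 * (2 * `|t' - t|) * N1 (density rho t') * (1 + z) <=
    2 * (2 * `|t' - t|) * (2 * M) * (1 + z).
  by rewrite ler_wpM2r ?addr_ge0 ?(ltW z0)// ler_wpM2l ?mulr_ge0// (near_N1 nt').
have h4 : 2 * (2 * (T - t)) * N1 (fun y => density rho t' y - density rho t y) *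
    (1 + z) <= 2 * (2 * 1) * (speed * `|t' - t| * M) * (1 + z).
  rewrite ler_wpM2r ?addr_ge0 ?(ltW z0)// ler_pM ?mulr_ge0 ?N1_ge0//.
  by have := T_range; lra.
apply: le_trans (ler_normD _ _) _; apply: le_trans (lerD h1 h2) _.
apply: le_trans (lerD h3 h4) _; rewrite /gain_speed /speed; lra.
Qed.

Lemma cost_lip z t t' : 0 < z -> 0 <= t <= T -> 0 <= t' <= T ->
  `|cost rho V (z, t') - cost rho V (z, t)| <=
    (abar * gain_speed + 2 * r) * `|t' - t| * (1 + z).
Proof.
move=> z0 tT t'T; rewrite /cost.
set H1 := max_hamiltonian _ _; set H2 := max_hamiltonian _ _.
have -> : H1 - r * V (z, t') - (H2 - r * V (z, t)) =
    (H1 - H2) - r * (V (z, t') - V (z, t)) by ring.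
have h1 : `|H1 - H2| <= abar * (gain_speed * `|t' - t| * (1 + z)).
  apply: le_trans (max_hamiltonian_lip _ _ z0) _.
  by rewrite ler_wpM2l ?abar_ge0//; exact: gain_lip.
have h2 : `|r * (V (z, t') - V (z, t))| <= r * (2 * `|t' - t| * (1 + z)).
  by rewrite normrM ger0_norm// ler_wpM2l//; exact: V_lip.
by apply: le_trans (ler_normB _ _) _; lra.
Qed.

(** The indicator of small z, where the regularity in time is lost. *)
Let low (z1 z : R) : R := if z <= z1 then 1 else 0.

Lemma low_range z1 z : 0 <= low z1 z <= 1.
Proof. by rewrite /low; case: ifP => _; rewrite ?lexx ?ler01. Qed.

Let rate_speed (z1 : R) : R := L * gain_speed * (1 + z1^-1).

(** Below [z1] only the trivial bound by [abar] is available; above it the Lipschitz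
    constant in time is of order 1 / z1. *)
Lemma rate_lip z1 z t t' : 0 < z1 -> 0 < z -> 0 <= t <= T -> 0 <= t' <= T ->
  `|rate rho V (z, t') - rate rho V (z, t)| <=
    abar * low z1 z + rate_speed z1 * `|t' - t|.
Proof.
move=> z10 z0 tT t'T; rewrite /low.
have rs0 : 0 <= rate_speed z1 * `|t' - t|.
  by rewrite !mulr_ge0 ?gain_speed_ge0 ?addr_ge0 ?invr_ge0 ?(ltW z10) ?(ltW L_gt0).
case: ifP => [_|/negbT].
  have /andP[h1 h2] := policy_range (gain (density rho t) (value V t) z / z).
  have /andP[h3 h4] := policy_range (gain (density rho t') (value V t') z / z).
  have : `|rate rho V (z, t') - rate rho V (z, t)| <= abar.
    by rewrite /rate/= ler_norml; lra.
  lra.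
rewrite -ltNge mulr0 add0r => z1z.
apply: le_trans (policy_lip _ _) _; rewrite /= -mulrBl normrM.
rewrite (@gtr0_norm _ (z^-1)) ?invr_gt0// /rate_speed -!mulrA.
rewrite ler_wpM2l ?(ltW L_gt0)// ler_pdivrMr//.
apply: le_trans (gain_lip z0 tT t'T) _.
rewrite -!mulrA ler_wpM2l ?gain_speed_ge0// mulrCA ler_wpM2l//.
have : 1 <= z1^-1 * z by rewrite mulrC ler_pdivlMr// mul1r ltW.
lra.
Qed.

Let low_mass (z1 : R) : R := N1 (fun z => f0 z * low z1 z).

Lemma low_measurable z1 : measurable_fun setT (low z1).
Proof.
by apply: measurable_fun_ifT => //; exact: measurable_fun_ler.
Qed.

Lemma low_W1 z1 (a b : R) : 0 <= a -> 0 <= b ->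
  W1_bound (fun z => f0 z * (a * low z1 z + b)) (a * low_mass z1 + b * M).
Proof.
move=> a0 b0.
have j1 : in_W1 (fun z => f0 z * low z1 z).
  have [] := @in_W1_le _ 1 f0 (fun z => f0 z * low z1 z) f0_W1 ler01.
  - by apply: measurable_funTS; apply: measurable_funM => //; exact: low_measurable.
  - apply: ae_halflineW => z z0; rewrite mul1r normrM ler_piMr//.
    by have /andP[h0 h1] := low_range z1 z; rewrite ger0_norm.
  by [].
have E : (fun z => f0 z * (a * low z1 z + b)) =
    (fun z => a * (f0 z * low z1 z) + b * f0 z).
  by apply/funext => z; ring.
rewrite E; split; first by apply: in_W1D; exact: in_W1Z.
apply: le_trans (N1D (in_W1Z a j1) (in_W1Z b f0_W1)) _.
rewrite (N1Z a j1) (N1Z b f0_W1) !ger0_norm// lerD2l ler_wpM2l//.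
Qed.

(** This is where the boundedness of f_0 enters. *)
Lemma low_mass_le z1 : 0 <= z1 <= 1 -> low_mass z1 <= 2 * Kinf * z1.
Proof.
move=> /andP[z10 z11].
pose g z := f0 z * (1 + z).
have mg : measurable_fun setT g.
  by apply: measurable_funM => //; exact: measurable_funD.
have gb s : 0 <= s <= z1 -> `|g s| <= Kinf * 2.
  move=> s1; rewrite /g ger0_norm; last by rewrite mulr_ge0//; lra.
  by rewrite ler_pM//; lra.
have := @time_integral_dist0 _ g (cst 0) z1 (Kinf * 2) (Kinf * 2) z1 mg
  (measurable_cst _) gb.
have K0 : 0 <= Kinf by apply: le_trans (f0_le 0).
have -> : time_integral (cst 0) z1 = 0.
  by rewrite /time_integral Rintegral_cst// mul0r.
have -> : low_mass z1 = time_integral g z1.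
  rewrite /low_mass /N1 /time_integral.
  have -> : (`[0, z1]%classic : set R) = halfline `&` [set z | z <= z1].
    apply/seteqP; split => z /=; rewrite halflineE in_itv/=; first by move=> /andP.
    by move=> [-> ->].
  rewrite Rintegral_mkcondr; apply: eq_Rintegral => z; rewrite inE halflineE => z0.
  rewrite patchE /low; case: (leP z z1) => zz1.
    by rewrite mem_set// mulr1 ger0_norm.
  rewrite memNset/= ?mulr0 ?normr0 ?mul0r//.
  by apply/negP; rewrite -ltNge.
rewrite subr0 => H.
have {}H := H ltac:(by move=> s _; rewrite normr0 mulr_ge0) ltac:(by rewrite z10 lexx)
  ltac:(by move=> s s1; rewrite subr0; exact: gb).
apply: le_trans (ler_norm _) _; lra.
Qed.

Lemma drift_lip z1 z t t' : 0 < z1 -> 0 < z -> 0 <= t <= T -> 0 <= t' <= T ->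
  `|drift (density rho t') (fun y => rate rho V (y, t')) z -
    drift (density rho t) (fun y => rate rho V (y, t)) z| <=
  2 * abar * M * low z1 z + 2 * abar * low_mass z1 +
  (4 * M * rate_speed z1 + 2 * abar * speed * M) * `|t' - t|.
Proof.
move=> z10 z0 tT t'T.
have nt := adm_near adm tT; have nt' := adm_near adm t'T.
have jt := near_W1 nt; have jt' := near_W1 nt'.
have z0' := ltW z0.
set a' := fun y => rate rho V (y, t'); set a := fun y => rate rho V (y, t).
have ba : ae_bound a abar := rate_ae_bound adm t.
have ba' : ae_bound a' abar := rate_ae_bound adm t'.
have -> : drift (density rho t') a' z - drift (density rho t) a z =
    drift (density rho t') (fun y => a' y - a y) z +
    drift (fun y => density rho t' y - density rho t y) a z.
  by rewrite (driftBr jt' abar_ge0 ba' ba z0') (driftBl jt' jt abar_ge0 ba z0') addrA subrK.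
have [jd Nd] := density_lip tT t'T.
have h2 := drift_le jd abar_ge0 ba z0' (rate_le rho V (z, t)).
set k := fun y => f0 y * (2 * abar * low z1 y + 2 * (rate_speed z1 * `|t' - t|)).
have rs0 : 0 <= rate_speed z1 * `|t' - t|.
  by rewrite !mulr_ge0 ?gain_speed_ge0 ?addr_ge0 ?invr_ge0 ?(ltW z10) ?(ltW L_gt0).
have [jk Nk] : W1_bound k (2 * abar * low_mass z1 + 2 * (rate_speed z1 * `|t' - t|) * M).
  by apply: low_W1; [rewrite mulr_ge0 ?abar_ge0|rewrite mulr_ge0].
have dk : dominated (fun y => (a' y - a y) * density rho t' y)
    (fun y => 1 * (`|k y| * (1 + y))).
  apply: W1_dominated => //.
    apply: measurable_funM; last exact: in_W1_measurable.
    by apply: measurable_funB; [exact: ba'.1|exact: ba.1].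
  apply: ae_halfline_pos => y y0; rewrite mul1r normrM.
  have r1 := rate_lip z10 y0 tT t'T.
  have r2 : `|density rho t' y| <= f0 y * 2.
    by rewrite normrM ger0_norm// ler_wpM2l//; apply: (adm_rho_le2 adm); exact: domP.
  apply: le_trans (ler_pM (normr_ge0 _) (normr_ge0 _) r1 r2) _.
  have /andP[lo0 _] := low_range z1 y.
  have k0 : 0 <= k y.
    apply: mulr_ge0 => //; apply: addr_ge0; last by rewrite mulr_ge0.
    by rewrite mulr_ge0// mulr_ge0 ?abar_ge0.
  rewrite (ger0_norm k0).
  have : k y <= k y * (1 + y) by rewrite ler_peMr//; lra.
  by rewrite {1}/k; lra.
have h1 := drift_le_dominated jt' dk z0'.
rewrite W1_Rintegral// mul1r in h1.
have h3 : `|a' z - a z| * N1 (density rho t') <=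
    (abar * low z1 z + rate_speed z1 * `|t' - t|) * (2 * M).
  by apply: ler_pM => //; [exact: N1_ge0|exact: rate_lip|exact: near_N1 nt'].
have h4 : 2 * abar * N1 (fun y => density rho t' y - density rho t y) <=
    2 * abar * (speed * `|t' - t| * M).
  by rewrite ler_wpM2l// mulr_ge0// abar_ge0.
apply: le_trans (ler_normD _ _) _; apply: le_trans (lerD h1 h2) _.
lra.
Qed.

Let growth_speed (z1 : R) : R :=
  4 * abar * M * speed + 2 * (4 * M * rate_speed z1 + 2 * abar * speed * M).

(** The terms with [low] and [low_mass] do not vanish as t' tends to t, but their
    contribution to the W^1 norm is O(z1), by [low_mass_le]. *)
Lemma growth_lip z1 z t t' : 0 < z1 -> 0 < z -> 0 <= t <= T -> 0 <= t' <= T ->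
  `|growth rho V (z, t') - growth rho V (z, t)| <=
  4 * abar * M * low z1 z +
    (4 * abar * low_mass z1 + growth_speed z1 * `|t' - t|).
Proof.
move=> z10 z0 tT t'T.
have h1 := drift_lip z10 z0 tT t'T.
have h2 := adm_drift_le adm (domP z0 t'T).
have h3 := adm_rho_le2 adm (domP z0 tT).
have h4 := rho_lip z0 tT t'T.
rewrite /growth/=; move: h1 h2; rewrite /=.
set D' := drift _ _ _; set D := drift (density rho t) _ _ => h1 h2.
have -> : rho (z, t') * D' - rho (z, t) * D =
    (rho (z, t') - rho (z, t)) * D' + rho (z, t) * (D' - D) by ring.
apply: le_trans (ler_normD _ _) _; rewrite !normrM.
apply: le_trans (lerD (ler_pM (normr_ge0 _) (normr_ge0 _) h4 h2)
  (ler_pM (normr_ge0 _) (normr_ge0 _) h3 h1)) _.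
by rewrite /growth_speed; lra.
Qed.

(** First [z1] is chosen to make the contribution of small z at most e / 2, then
    the time step, depending on [z1], for the rest. *)
Lemma W1_derivative_small t e : 0 <= t <= T -> 0 < e ->
  exists2 d, 0 < d & forall t', 0 <= t' <= T -> t' != t -> `|t' - t| < d ->
    W1_bound (fun z => (density rho t' z - density rho t z) / (t' - t) -
      density rho t z * drift (density rho t) (fun y => rate rho V (y, t)) z) e.
Proof.
move=> tT e0.
have K0 : 0 <= Kinf by apply: le_trans (f0_le 0).
set c := 16 * abar * M * Kinf + 1.
have c0 : 0 < c.
  by rewrite /c ltr_wpDl// !mulr_ge0 ?abar_ge0 ?(ltW M_gt0).
set z1 : R := Order.min 1 (e / (2 * c)).
have z10 : 0 < z1 by rewrite lt_min ltr01 divr_gt0// mulr_gt0.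
have z11 : z1 <= 1 by rewrite ge_min lexx.
have z1e : z1 * c <= e / 2.
  have : z1 <= e / (2 * c) by rewrite ge_min lexx orbT.
  rewrite ler_pdivlMr ?mulr_gt0//; lra.
have gs0 : 0 <= growth_speed z1.
  have h1 : 0 <= rate_speed z1.
    by rewrite !mulr_ge0 ?gain_speed_ge0 ?addr_ge0 ?invr_ge0 ?(ltW z10) ?(ltW L_gt0).
  have a0 := abar_ge0; have M0 := ltW M_gt0; have s0 := speed_ge0.
  have h2 : 0 <= 4 * abar * M * speed by rewrite mulr_ge0// !mulr_ge0.
  have h3 : 0 <= 4 * M * rate_speed z1 by rewrite mulr_ge0// mulr_ge0.
  have h4 : 0 <= 2 * abar * speed * M by rewrite mulr_ge0// mulr_ge0// mulr_ge0.
  by rewrite /growth_speed; lra.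
set k := growth_speed z1 * M + 1.
have k0 : 0 < k by rewrite /k ltr_wpDl// mulr_ge0 ?(ltW M_gt0).
exists (e / (2 * k)); first by rewrite divr_gt0// mulr_gt0.
move=> t' t'T t't dt.
set h := `|t' - t| in dt *.
have hk : h * k <= e / 2.
  by move: dt; rewrite ltr_pdivlMr ?mulr_gt0//; lra.
have a0 : 0 <= 4 * abar * M by rewrite !mulr_ge0 ?abar_ge0 ?(ltW M_gt0).
have b0 : 0 <= 4 * abar * low_mass z1 + growth_speed z1 * h.
  by rewrite addr_ge0// !mulr_ge0 ?abar_ge0 ?N1_ge0// normr_ge0.
have [jk Nk] := low_W1 z1 a0 b0.
set u := fun z => _ - _.
have [ju Nu] : in_W1 u /\ N1 u <=
    1 * N1 (fun z => f0 z * (4 * abar * M * low z1 z +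
      (4 * abar * low_mass z1 + growth_speed z1 * h))).
  apply: in_W1_le => //.
    have m1 := measurable_section1 t' (measurable_density (adm_rho adm)).
    have m2 := measurable_section1 t (measurable_density (adm_rho adm)).
    have m3 := measurable_section1 t
      (measurable_growth_joint (adm_rho adm) (adm_V adm)).
    have E : u = fun z => (f0 z * rho (z, t') - f0 z * rho (z, t)) / (t' - t) -
       f0 z * growth rho V (z, t).
      by apply/funext => z; rewrite /u /density /growth /= mulrA.
    rewrite E; apply: measurable_funTS; apply: measurable_funB.
      by apply: measurable_funM; [exact: measurable_funB|exact: measurable_cst].
    exact: measurable_funM.
  apply: ae_halfline_pos => z z0; rewrite mul1r.
  have lo := low_range z1 z.
  have uE : u z = f0 z * ((time_integral (fun s => growth rho V (z, s)) t' -
     time_integral (fun s => growth rho V (z, s)) t) / (t' - t) -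
     growth rho V (z, t)).
    rewrite /u /density (rho_fix (domP z0 tT)) (rho_fix (domP z0 t'T)) /growth /=.
    rewrite (rho_fix (domP z0 tT)) /=; ring.
  rewrite uE !normrM ler_wpM2l//.
  have := @time_integral_quot _ _ T speed (growth rho V (z, t))
    (4 * abar * M * low z1 z + (4 * abar * low_mass z1 + growth_speed z1 * h)) t t'
    (adm_growth_meas adm z) (growth_bounded z0) tT t'T t't.
  move=> H; apply: le_trans (H _) (ler_norm _) => s sT st.
  apply: le_trans (growth_lip z10 z0 tT sT) _.
  by rewrite lerD2l lerD2l ler_wpM2l.
split => //; rewrite mul1r in Nu; apply: le_trans Nu _; apply: le_trans Nk _.
have l1 : low_mass z1 <= 2 * Kinf * z1 by apply: low_mass_le; rewrite (ltW z10).
have h1 : (8 * abar * M) * low_mass z1 <= (8 * abar * M) * (2 * Kinf * z1).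
  by rewrite ler_wpM2l ?speed_ge0.
have h2 : 0 <= h by rewrite normr_ge0.
rewrite /c in z1e; rewrite /k in hk; lra.
Qed.

(** The envelope principle removes the policy from [cost], which is therefore
    Lipschitz in time with weight 1 + z down to z = 0. *)
Lemma Winfty_derivative_small t e : 0 <= t <= T -> 0 < e ->
  exists2 d, 0 < d & forall t', 0 <= t' <= T -> t' != t -> `|t' - t| < d ->
    ae_halfline (fun z => `|(value V t' z - value V t z) / (t' - t) -
      (r * value V t z - max_hamiltonian z (gain (density rho t) (value V t) z))|
      <= e * (1 + z)).
Proof.
move=> tT e0; set k := abar * gain_speed + 2 * r + 1.
have k0 : 0 < k.
  by rewrite /k ltr_wpDl// addr_ge0 ?mulr_ge0 ?abar_ge0 ?gain_speed_ge0.
exists (e / k); first by rewrite divr_gt0.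
move=> t' t'T t't dt; apply: ae_halfline_pos => z z0.
rewrite ltr_pdivlMr// in dt.
have := @time_integral_quot _ _ T (2 * (1 + z)) (cost rho V (z, t))
    (e * (1 + z)) t t' (adm_cost_meas adm z) (cost_bounded z0) tT t'T t't.
move=> H.
have -> : (value V t' z - value V t z) / (t' - t) - (r * value V t z -
    max_hamiltonian z (gain (density rho t) (value V t) z)) =
  - ((time_integral (fun s => cost rho V (z, s)) t' -
      time_integral (fun s => cost rho V (z, s)) t) / (t' - t) - cost rho V (z, t)).
  rewrite /cost -/(value V t z) /= {1 2}/value (V_fix (domP z0 tT)) (V_fix (domP z0 t'T)) /=.
  ring.
rewrite normrN; apply: H => s sT st.
apply: le_trans (cost_lip z0 tT sT) _; rewrite ler_wpM2r//; first lra.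
have : (abar * gain_speed + 2 * r) * `|s - t| <=
    (abar * gain_speed + 2 * r) * `|t' - t|.
  by rewrite ler_wpM2l// addr_ge0 ?mulr_ge0 ?abar_ge0 ?gain_speed_ge0.
have := normr_ge0 (t' - t).
rewrite /k in dt; lra.
Qed.

Definition strategy z t : R :=
  sigma (gain (density rho t) (value V t) z / z).

Theorem fixed_point_solution :
  mfg_solution r alpha f0 T (fun z t => density rho t z)
    (fun z t => value V t z) strategy.
Proof.
split.
- split=> t tT; first exact: (near_W1 (adm_near adm tT)).
  apply: ecvg0_le.
    by move=> t'; apply: integral_ge0 => z; rewrite halflineE => z0;
      rewrite lee_fin mulr_ge0// addr_ge0.
  move=> e e0; apply/within_nbhs_eps.
  have k0 : 0 < speed * M + 1.
    by rewrite ltr_wpDl// mulr_ge0 ?speed_ge0 ?(ltW M_gt0).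
  exists (e / (speed * M + 1)); first by rewrite divr_gt0.
  move=> t'; rewrite /= in_itv/= => t'T; rewrite ltr_pdivlMr// => dt.
  have [jd Nd] := density_lip tT t'T.
  rewrite W1_normE// lee_fin; apply: le_trans Nd _.
  have := normr_ge0 (t' - t); lra.
- split=> t tT.
    apply: wbound_in_Winfty (near_value _ (adm_near adm tT)); lra.
  apply: ecvg0_le; first by move=> t'; exact: Winfty_norm_ge0.
  move=> e e0; apply/within_nbhs_eps; exists (e / 2); first exact: divr_gt0.
  move=> t'; rewrite /= in_itv/= => t'T dt.
  apply/Winfty_normP; first exact: ltW.
  have [_ ] := value_lip tT t'T; apply: ae_halflineS => z z0 h.
  by apply: le_trans h _; rewrite ler_wpM2r//; lra.
- move=> t tT; apply: measurable_funTS.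
  apply: (measurableT_comp policy_measurable).
  exact: (measurable_section1 t (measurable_ratio_joint (adm_rho adm) (adm_V adm))).
- by move=> z t _ _; have [] := sigma_argmax (gain (density rho t) (value V t) z / z).
- move=> t tT; apply: ecvg0_le.
    by move=> t'; apply: integral_ge0 => z; rewrite halflineE => z0;
      rewrite lee_fin mulr_ge0// addr_ge0.
  move=> e e0; apply/within_dnbhs_eps.
  have [d d0 Hd] := W1_derivative_small tT e0; exists d => // t'.
  rewrite /= in_itv/= => t'T t't dt.
  have [jd Nd] := Hd t' t'T t't dt.
  rewrite [X in W1_norm X](_ : _ = fun z =>
      (density rho t' z - density rho t z) / (t' - t) - density rho t z *
      drift (density rho t) (fun y => rate rho V (y, t)) z).
    by rewrite W1_normE// lee_fin.
  by apply/funext => z; rewrite boltzmann_rhsE.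
- move=> t tT; apply: ecvg0_le; first by move=> t'; exact: Winfty_norm_ge0.
  move=> e e0; apply/within_dnbhs_eps.
  have [d d0 Hd] := Winfty_derivative_small tT e0; exists d => // t'.
  rewrite /= in_itv/= => t'T t't dt.
  apply/Winfty_normP; first exact: ltW.
  have := Hd t' t'T t't dt; apply: ae_halflineS => z z0.
  by rewrite hamiltonianE.
- move=> t tT; apply: ae_halfline_pos => z z0.
  have := (is_argmax_scale (gain (density rho t) (value V t) z) (strategy z t) z0).2
    (sigma_argmax _).
  move=> [h1 h2]; split => // s s01; rewrite !hamiltonianE; exact: h2.
- apply: ae_halfline_pos => z z0; rewrite /density rho_fix ?time_integral0 ?addr0 ?mulr1//.
  by apply: domP => //; rewrite lexx; have := T_range; lra.
- apply: ae_halfline_pos => z z0; rewrite /value V_fix ?subrr//.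
  exact/domP/T_itv.
Qed.

Lemma fixed_point_density_ge0 t : 0 <= t <= T ->
  ae_halfline (fun z => 0 <= density rho t z).
Proof.
move=> tT; apply: ae_halfline_pos => z z0; rewrite mulr_ge0//.
by apply: (adm_rho_ge0 adm); exact: domP.
Qed.

End fixed_point.

Theorem solution_exists : exists f V S : R -> R -> R,
  mfg_solution r alpha f0 T f V S /\
  forall t, 0 <= t <= T -> ae_halfline (fun z => 0 <= f z t).
Proof.
have [rho [V [adm fix_]]] := fixed_point_exists.
exists (fun z t => density rho t z), (fun z t => value V t z), (strategy rho V).
split; first by apply: fixed_point_solution => // p /fix_[].
by move=> t tT; exact: (fixed_point_density_ge0 adm).
Qed.

End existence.

(** * Uniqueness *)

Section uniqueness.
Hypothesis sigma_unique : forall b s, is_argmax (payoff alpha b) s -> s = sigma b.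
Hypothesis alpha_mono : forall s s' : R,
  0 <= s -> s <= s' -> s' <= 1 -> alpha s <= alpha s'.
Hypothesis eta0_gt0 : 0 < eta0.
Hypothesis eps_gt0 : 0 < eps.

Lemma tail_measurable (f : R -> R) : measurable_fun halfline f ->
  measurable_fun halfline (tail f).
Proof.
move=> mf.
have mg : measurable_fun setT (fun p : R * R => (f \_ halfline) p.1).
  apply: (measurableT_comp _ measurable_fst).
  exact/(measurable_restrictT _ (@measurable_halfline R)).
have := measurable_section1 0 (measurable_tail_joint mg).
move=> /(measurable_funTS (D := halfline)); apply: eq_measurable_fun => z.
rewrite inE halflineE => z0; apply: eq_Rintegral => y; rewrite inE /= => yz.
by rewrite patchE mem_set//; exact: (tail_sub_halfline z0).
Qed.

Lemma init_measurable (f : R -> R) : measurable_fun halfline f ->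
  measurable_fun halfline (fun z => \int[mu]_(y in `[0, z]) f y).
Proof.
move=> mf.
have mg : measurable_fun setT (fun p : R * R => (f \_ halfline) p.1).
  apply: (measurableT_comp _ measurable_fst).
  exact/(measurable_restrictT _ (@measurable_halfline R)).
have := measurable_section1 0 (measurable_init_joint mg).
move=> /(measurable_funTS (D := halfline)); apply: eq_measurable_fun => z _.
apply: eq_Rintegral => y; rewrite inE /= => yz.
by rewrite patchE mem_set//; exact: (init_sub_halfline yz).
Qed.

Lemma drift_measurable (f a : R -> R) : measurable_fun halfline f ->
  measurable_fun halfline a -> measurable_fun halfline (drift f a).
Proof.
move=> mf ma; apply: measurable_funD.
  by apply: measurable_funM; [exact: measurable_funN|exact: tail_measurable].
by apply: init_measurable; exact: measurable_funM.
Qed.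

Lemma gain_measurable (f V : R -> R) : measurable_fun halfline f ->
  measurable_fun halfline V -> measurable_fun halfline (gain f V).
Proof.
move=> mf mV; apply: measurable_funB.
  by apply: tail_measurable; exact: measurable_funM.
by apply: measurable_funM => //; exact: tail_measurable.
Qed.

Lemma drift_W1 (f a : R -> R) c : in_W1 f -> ae_bound a c -> 0 <= c ->
  W1_bound (fun z => f z * drift f a z) (2 * c * N1 f * N1 f).
Proof.
move=> jf ba c0; have mf := in_W1_measurable jf.
apply: in_W1_le => //; first by rewrite !mulr_ge0 ?N1_ge0.
  by apply: measurable_funM => //; apply: drift_measurable => //; exact: ba.1.
apply: ae_halflineS ba.2 => z z0 az; rewrite normrM mulrC ler_wpM2r//.
exact: (drift_le jf c0 ba (ltW z0) az).
Qed.

Section one_solution.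
Variables f V S : R -> R -> R.
Hypothesis sol : mfg_solution r alpha f0 T f V S.

Lemma sol_W1 t : 0 <= t <= T -> in_W1 (f ^~ t).
Proof. by have [h _] := mfg_f_space sol; exact: h. Qed.

Lemma sol_Winfty t : 0 <= t <= T -> exists2 c, 0 <= c & wbound (V ^~ t) c.
Proof. by move=> tT; apply: in_Winfty_bounded; have [h _] := mfg_V_space sol; exact: h. Qed.

Lemma sol_V_measurable t : 0 <= t <= T -> measurable_fun halfline (V ^~ t).
Proof. by move=> /sol_Winfty[c _ []]. Qed.

(** Uniqueness of the maximizer determines the strategy at almost every z from the
    other two components. *)
Lemma sol_strategy t : 0 <= t <= T ->
  ae_halfline (fun z => S z t = sigma (gain (f ^~ t) (V ^~ t) z / z)).
Proof.
move=> tT; apply: ae_halflineS (mfg_S_eq sol tT) => z z0 [s01 H].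
apply: sigma_unique; apply/is_argmax_scale => //; split => // s' s'01.
by have := H s' s'01; rewrite !hamiltonianE.
Qed.

Lemma sol_rate_le t z : 0 <= t <= T -> 0 <= z -> `|alpha (S z t)| <= abar.
Proof.
move=> tT z0; have /alpha_range/andP[h0 h1] := mfg_S_range sol z0 tT.
by rewrite ger0_norm.
Qed.

Lemma sol_rate_measurable t : 0 <= t <= T ->
  measurable_fun halfline (fun z => alpha (S z t)).
Proof.
move=> tT.
have ma : measurable_fun setT (fun s : R => alpha (Order.max 0 (Order.min 1 s))).
  apply: nondecreasing_measurable => // s s' ss'; apply: alpha_mono.
  - by rewrite le_max lexx.
  - rewrite ge_max le_max lexx/=; case: (leP 1 s) => h1; case: (leP 1 s') => h2;
      rewrite ?le_max; lra.
  - by rewrite ge_max ler01 ge_min lexx.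
have := measurableT_comp ma (mfg_S_measurable sol tT).
apply: eq_measurable_fun => z; rewrite inE halflineE => z0 /=.
have /andP[h0 h1] := mfg_S_range sol z0 tT.
by rewrite min_r// max_r.
Qed.

Lemma sol_ae_bound t : 0 <= t <= T -> ae_bound (fun z => alpha (S z t)) abar.
Proof.
move=> tT; split; first exact: sol_rate_measurable.
by apply: ae_halflineW => z z0; exact: sol_rate_le.
Qed.

Lemma sol_density_continuous :
  bound_continuous (@W1_bound R) T (fun t z => f z t).
Proof.
move=> t tT e e0; have [_ /(_ t tT) H] := mfg_f_space sol.
have [d d0 Hd] := ecvg0_within_nbhs e0 H.
exists d => // t' t'T dt.
have jd := in_W1B (sol_W1 t'T) (sol_W1 tT); split => //.
have := Hd t'; rewrite /= in_itv/= => /(_ t'T dt).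
by rewrite W1_normE// lte_fin => /ltW.
Qed.

Definition density_rate (t z : R) : R :=
  f z t * drift (f ^~ t) (fun y => alpha (S y t)) z.

Lemma density_rate_W1 t : 0 <= t <= T -> in_W1 (density_rate t).
Proof.
by move=> tT; exact: (drift_W1 (sol_W1 tT) (sol_ae_bound tT) abar_ge0).1.
Qed.

Lemma sol_density_derivative :
  bound_derivative (@W1_bound R) T (fun t z => f z t) density_rate.
Proof.
move=> t tT e e0; have := mfg_f_eq sol tT => H.
have [d d0 Hd] := ecvg0_within_dnbhs e0 H.
exists d => // t' t'T t't dt.
have := Hd t'; rewrite /= in_itv/= => /(_ t'T t't dt).
have -> : (fun z => (f z t' - f z t) / (t' - t) - boltzmann_rhs alpha f S z t) =
    (fun z => (f z t' - f z t) / (t' - t) - density_rate t z).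
  by apply/funext => z; rewrite boltzmann_rhsE.
have jd : in_W1 (fun z => (f z t' - f z t) / (t' - t) - density_rate t z).
  apply: in_W1B; last exact: density_rate_W1.
  rewrite (_ : (fun z => _) = fun z => (t' - t)^-1 * (f z t' - f z t)).
    exact: in_W1Z (in_W1B (sol_W1 t'T) (sol_W1 tT)).
  by apply/funext => z; rewrite mulrC.
by rewrite W1_normE// lte_fin => /ltW Nd; split.
Qed.

Lemma sol_value_continuous : bound_continuous (@wbound R) T (fun t z => V z t).
Proof.
move=> t tT e e0; have [_ /(_ t tT) H] := mfg_V_space sol.
have [d d0 Hd] := ecvg0_within_nbhs e0 H.
exists d => // t' t'T dt; split.
  by apply: measurable_funB; exact: sol_V_measurable.
apply/Winfty_normP; first exact: ltW.
by have := Hd t'; rewrite /= in_itv/= => /(_ t'T dt)/ltW.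
Qed.

Definition value_rate (t z : R) : R := r * V z t - hamiltonian alpha f V z t (S z t).

Lemma value_rate_measurable t : 0 <= t <= T ->
  measurable_fun halfline (value_rate t).
Proof.
move=> tT; have mV := sol_V_measurable tT.
have mf := in_W1_measurable (sol_W1 tT).
apply: measurable_funB; first exact: (measurable_funM (measurable_cst r) mV).
apply: (eq_measurable_fun (fun z => (1 - S z t) * z +
    alpha (S z t) * gain (f ^~ t) (V ^~ t) z)).
  by move=> z _; rewrite hamiltonianE.
apply: measurable_funD.
  apply: measurable_funM => //; apply: measurable_funB; first exact: measurable_cst.
  exact (mfg_S_measurable sol tT).
by apply: measurable_funM; [exact: sol_rate_measurable|exact: gain_measurable].
Qed.

Lemma sol_value_derivative :
  bound_derivative (@wbound R) T (fun t z => V z t) value_rate.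
Proof.
move=> t tT e e0; have := mfg_V_eq sol tT => H.
have [d d0 Hd] := ecvg0_within_dnbhs e0 H.
exists d => // t' t'T t't dt; split.
  apply: measurable_funB; last exact: value_rate_measurable.
  apply: measurable_funM; last exact: measurable_cst.
  by apply: measurable_funB; exact: sol_V_measurable.
apply/Winfty_normP; first exact: ltW.
by have := Hd t'; rewrite /= in_itv/= => /(_ t'T t't dt)/ltW.
Qed.

Lemma sol_value_rate t : 0 <= t <= T ->
  ae_halfline (fun z => value_rate t z =
    r * V z t - max_hamiltonian z (gain (f ^~ t) (V ^~ t) z)).
Proof.
move=> tT; apply: ae_halflineS (sol_strategy tT) => z z0 Sz.
by rewrite /value_rate hamiltonianE Sz.
Qed.

(** The conclusion bounds the W^1 norm of f, hence that of its time derivative, which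
    in turn implies the conclusion: [curve_growth] closes this circle. *)
Lemma sol_density_near t : 0 <= t <= T ->
  W1_bound (fun z => f z t - f0 z) eta0.
Proof.
move=> tT; have T0 : 0 < T by have := T_range; lra.
have := @curve_growth R (@W1_bound R) T (fun t z => f z t - f0 z) density_rate
  (eta0 / T) (8 * abar * M ^+ 2) (@W1_seminorm_bound R).
move=> H; have {H} H := H _ _ _ _ _ _ t tT.
have [||||||j N] := H; last first.
- split => //; apply: le_trans N _; rewrite mulrAC ler_pdivrMr// ler_wpM2l ?(ltW eta0_gt0)//; lra.
- move=> s sT [js Ns].
  have Ns' : N1 (fun z => f z s - f0 z) <= eta0.
    apply: le_trans Ns _; rewrite mulrAC ler_pdivrMr// ler_wpM2l ?(ltW eta0_gt0)//; lra.
  have Nf : N1 (f ^~ s) <= 2 * M.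
    have := N1D js f0_W1.
    have -> : (fun z => f z s - f0 z + f0 z) = f ^~ s.
      by apply/funext => z; rewrite subrK.
    move=> /le_trans; apply; apply: le_trans (lerD Ns' f0_M) _; data_lra.
  have [jr Nr] := drift_W1 (sol_W1 sT) (sol_ae_bound sT) abar_ge0.
  split => //; apply: le_trans Nr _; rewrite expr2.
  have h : N1 (f ^~ s) * N1 (f ^~ s) <= 2 * M * (2 * M).
    by apply: ler_pM => //; exact: N1_ge0.
  by have := ler_wpM2l (mulr_ge0 (ler0n _ 2) abar_ge0) h; lra.
- have [] := @in_W1_le _ 0 f0 (fun z => f z 0 - f0 z) f0_W1 (lexx _).
    + apply: measurable_funB; apply: in_W1_measurable => //.
      by apply: sol_W1; rewrite lexx ltW.
    + apply: ae_halflineS (mfg_init sol) => z z0 ->.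
      by rewrite subrr normr0 mul0r.
  by rewrite mul0r.
- move=> s sT e e0; have [d d0 Hd] := sol_density_derivative sT e0.
  exists d => // t' t'T t't dt; have := Hd t' t'T t't dt.
  by congr W1_bound; apply/funext => z; congr (_ / _ - _); ring.
- move=> s sT e e0; have [d d0 Hd] := sol_density_continuous sT e0.
  exists d => // t' t'T dt; have := Hd t' t'T dt.
  by congr W1_bound; apply/funext => z; ring.
- by rewrite ltr_pdivlMr//; have := T_density; have := eta0_gt0; lra.
- by rewrite !mulr_ge0 ?abar_ge0 ?exprn_ge0 ?(ltW M_gt0).
Qed.

Lemma sol_state_near t : 0 <= t <= T ->
  wbound (fun z => V z t - (T - t) * z) (eps * (T - t)) ->
  near_data (T - t) (f ^~ t) (V ^~ t).
Proof. by move=> tT bV; split => //; exact: sol_density_near. Qed.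

(** Run backwards from the final time with s = T - t, for V - s z.  At each time the
    hypothesis of [near_cost] is the bound reached so far. *)
Lemma sol_value_near t : 0 <= t <= T ->
  wbound (fun z => V z t - (T - t) * z) (eps * (T - t)).
Proof.
have rev s : 0 <= s <= T -> 0 <= T - s <= T by lra.
have H := @curve_growth R (@wbound R) T
  (fun s z => V z (T - s) - s * z) (fun s z => - value_rate (T - s) z - z)
  eps (value_const * T) (@wbound_seminorm_bound R).
move=> tT; have := H _ _ _ _ _ _ (T - t) (rev t tT).
have TK : T - (T - t) = t by ring.
rewrite TK; apply.
- by rewrite mulr_ge0 ?value_const_ge0//; have := T_range; lra.
- by have := value_const_T; have := eps_gt0; lra.
- move=> s sT e e0.
  have [d d0 Hd] := sol_value_continuous (rev s sT) (divr_gt0 e0 (ltr0n _ 2)).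
  exists (Order.min d (e / 2)); first by rewrite lt_min d0 divr_gt0.
  move=> s' s'T; rewrite lt_min => /andP[sd se].
  have sd' : `|T - s' - (T - s)| < d.
    by rewrite (_ : T - s' - (T - s) = - (s' - s)) ?normrN//; ring.
  have B1 := Hd (T - s') (rev s' s'T) sd'.
  have B2 : wbound (fun z => (s' - s) * z) `|s' - s|.
    have [_ BZ _ _] := @wbound_seminorm_bound R.
    have := BZ (s' - s) _ _ (@wbound_id _ (1 : R) ler01).
    by rewrite mulr1; congr wbound; apply/funext => z; rewrite mul1r.
  have [_ _ Bm _] := @wbound_seminorm_bound R.
  have := wboundB B1 B2.
  rewrite (_ : (fun z => _) = (fun z => V z (T - s') - s' * z - (V z (T - s) - s * z))).
    by apply: Bm; lra.
  by apply/funext => z; ring.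
- move=> s sT e e0.
  have [d d0 Hd] := sol_value_derivative (rev s sT) e0.
  exists d => // s' s'T s's sd.
  have sd' : `|T - s' - (T - s)| < d.
    by rewrite (_ : T - s' - (T - s) = - (s' - s)) ?normrN//; ring.
  have ne : T - s' != T - s by apply: contra s's => /eqP h; apply/eqP; lra.
  have [_ BZ _ _] := @wbound_seminorm_bound R.
  have := BZ (-1) _ _ (Hd (T - s') (rev s' s'T) ne sd').
  rewrite normrN1 mul1r; congr wbound; apply/funext => z.
  have n1 : s' - s != 0 by rewrite subr_eq0.
  have n2 : T - s' - (T - s) != 0 by rewrite subr_eq0.
  by field; rewrite n1 n2.
- rewrite subr0; split.
    apply: measurable_funB; last exact: mulrl_measurable.
    by apply: sol_V_measurable; exact: T_itv.
  apply: ae_halflineS (mfg_final sol) => z z0 ->.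
  by rewrite mul0r subrr normr0 mul0r.
- move=> s sT Bs; have sT' := rev s sT.
  have sK : T - (T - s) = s by ring.
  have nd : near_data s (f ^~ (T - s)) (V ^~ (T - s)).
    by have := sol_state_near sT'; rewrite sK; apply.
  split.
    apply: measurable_funB; last exact: measurable_id.
    exact: measurable_funN (value_rate_measurable sT').
  have [_ Bs'] := Bs.
  apply: ae_halflineS (ae_halflineI (sol_value_rate sT') Bs') => z z0 [-> h].
  have s0 : 0 <= s by lra.
  have := near_cost s0 nd z0 h; rewrite opprB => /le_trans; apply.
  by rewrite ler_wpM2r ?ler_wpM2l ?value_const_ge0//; lra.
Qed.

Lemma sol_near t : 0 <= t <= T -> near_data (T - t) (f ^~ t) (V ^~ t).
Proof. by move=> tT; apply: sol_state_near => //; exact: sol_value_near. Qed.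

End one_solution.

Section two_solutions.
Variables f1 V1 S1 f2 V2 S2 : R -> R -> R.
Hypothesis sol1 : mfg_solution r alpha f0 T f1 V1 S1.
Hypothesis sol2 : mfg_solution r alpha f0 T f2 V2 S2.

(** The distance of the values relative to T - t, as required by
    [close_states]. *)
Definition solutions_close (d : R) := forall t, 0 <= t <= T ->
  W1_bound (fun z => f1 z t - f2 z t) d /\
  wbound (fun z => V1 z t - V2 z t) (d * (T - t)).

Lemma solutions_close2 : solutions_close 2.
Proof.
move=> t tT; split.
  have [BD BZ Bm _] := @W1_seminorm_bound R.
  have B1 := sol_density_near sol1 tT.
  have B2 := BZ (-1) _ _ (sol_density_near sol2 tT).
  have := BD _ _ _ _ B1 B2.
  rewrite (_ : (fun z => _) = (fun z => f1 z t - f2 z t)).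
    by apply: Bm; rewrite normrN1 mul1r; have := eta0_range; lra.
  by apply/funext => z; ring.
have := wboundB (sol_value_near sol1 tT) (sol_value_near sol2 tT).
have [_ _ Bm _] := @wbound_seminorm_bound R.
rewrite (_ : (fun z => _) = (fun z => V1 z t - V2 z t)).
  by apply: Bm; rewrite -mulrDl ler_wpM2r//; have := eps_range; lra.
by apply/funext => z; ring.
Qed.

Lemma solutions_close_states d t : 0 <= d -> solutions_close d -> 0 <= t <= T ->
  close_states (T - t) d (f1 ^~ t) (f2 ^~ t) (V1 ^~ t) (V2 ^~ t).
Proof.
move=> d0 cl tT; have [h1 h2] := cl t tT; split => //.
- by have := T_range; lra.
- exact: (sol_near sol1 tT).
- exact: (sol_near sol2 tT).
Qed.

Lemma density_rate_diff d t : 0 <= d -> solutions_close d -> 0 <= t <= T ->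
  W1_bound (fun z => density_rate f1 S1 t z - density_rate f2 S2 t z)
    ((4 * abar * M + 2 * M * drift_const) * d).
Proof.
move=> d0 cl tT.
have cs := solutions_close_states d0 cl tT.
have [_ _ n1 n2 [jd Nd] bv] := cs.
have ba1 := sol_ae_bound sol1 tT; have ba2 := sol_ae_bound sol2 tT.
have j1 := near_W1 n1; have j2 := near_W1 n2.
have ab : ae_halfline (fun z =>
    `|alpha (S1 z t) - alpha (S2 z t)| <= policy_const * d).
  have tau0 : 0 <= T - t by lra.
  apply: ae_halflineS (ae_halflineI (ae_halflineI (sol_strategy sol1 tT)
    (sol_strategy sol2 tT)) (ae_halflineI n1.2.2 (ae_halflineI n2.2.2 bv.2))).
  by move=> z z0 [[-> ->] [h1 [h2 h3]]]; exact: (close_policy_diff cs).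
have Bd : W1_bound (fun z => (f1 z t - f2 z t) * drift (f1 ^~ t) (fun y => alpha (S1 y t)) z)
    (4 * abar * M * d).
  have c0 : 0 <= 4 * abar * M by rewrite !mulr_ge0 ?abar_ge0 ?(ltW M_gt0).
  have [] := @in_W1_le _ (4 * abar * M) (fun z => f1 z t - f2 z t)
    (fun z => (f1 z t - f2 z t) * drift (f1 ^~ t) (fun y => alpha (S1 y t)) z) jd c0.
  - apply: measurable_funM; first exact: in_W1_measurable jd.
    by apply: drift_measurable; [exact: in_W1_measurable j1|exact: ba1.1].
  - apply: ae_halflineW => z z0; rewrite normrM mulrC ler_wpM2r//.
    apply: le_trans (drift_le j1 abar_ge0 ba1 z0 (sol_rate_le sol1 tT z0)) _.
    by have := ler_wpM2l (mulr_ge0 (ler0n _ 2) abar_ge0) (near_N1 n1); lra.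
  - by move=> ju Nu; split => //; apply: le_trans Nu _; rewrite ler_wpM2l.
have Bd2 : W1_bound (fun z => f2 z t * (drift (f1 ^~ t) (fun y => alpha (S1 y t)) z -
    drift (f2 ^~ t) (fun y => alpha (S2 y t)) z)) (2 * M * drift_const * d).
  have c0 : 0 <= drift_const * d by rewrite mulr_ge0// drift_const_ge0.
  have [] := @in_W1_le _ (drift_const * d) (f2 ^~ t)
    (fun z => f2 z t * (drift (f1 ^~ t) (fun y => alpha (S1 y t)) z -
    drift (f2 ^~ t) (fun y => alpha (S2 y t)) z)) j2 c0.
  - apply: measurable_funM; first exact: in_W1_measurable j2.
    apply: measurable_funB; apply: drift_measurable.
    + exact: in_W1_measurable j1.
    + exact: ba1.1.
    + exact: in_W1_measurable j2.
    + exact: ba2.1.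
  - apply: (ae_halflineS _ ab) => z z0 abz; rewrite normrM mulrC ler_wpM2r//.
    have z0' := ltW z0.
    exact: (close_drift_diff cs ba1 ba2 ab z0' (sol_rate_le sol2 tT z0') abz).
  - move=> ju Nu; split => //; apply: le_trans Nu _.
    by have := ler_wpM2l c0 (near_N1 n2); lra.
have [BD _ _ _] := @W1_seminorm_bound R.
have := BD _ _ _ _ Bd Bd2.
rewrite -mulrDl; congr W1_bound; apply/funext => z; rewrite /density_rate; ring.
Qed.

Lemma value_rate_diff d t : 0 <= d -> solutions_close d -> 0 <= t <= T ->
  wbound (fun z => value_rate f1 V1 S1 t z - value_rate f2 V2 S2 t z)
    (value_const * T * d).
Proof.
move=> d0 cl tT.
have cs := solutions_close_states d0 cl tT.
have [_ _ n1 n2 _ bv] := cs.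
have tau0 : 0 <= T - t by lra.
split; first by apply: measurable_funB;
  [exact (value_rate_measurable sol1 tT)|exact (value_rate_measurable sol2 tT)].
apply: ae_halflineS (ae_halflineI (ae_halflineI (sol_value_rate sol1 tT)
  (sol_value_rate sol2 tT)) (ae_halflineI n2.2.2 bv.2)).
move=> z z0 [[-> ->] [h2 h3]].
have hg := close_gain_diff cs (ltW z0) h2 h3.
have hm := le_trans (max_hamiltonian_lip (gain (f1 ^~ t) (V1 ^~ t) z)
  (gain (f2 ^~ t) (V2 ^~ t) z) z0) (ler_wpM2l abar_ge0 hg).
have hr : `|r * (V1 z t - V2 z t)| <= r * (d * (T - t) * (1 + z)).
  by rewrite normrM ger0_norm// ler_wpM2l.
set H1 := max_hamiltonian _ _ in hm *; set H2 := max_hamiltonian _ _ in hm *.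
have -> : r * V1 z t - H1 - (r * V2 z t - H2) =
  r * (V1 z t - V2 z t) - (H1 - H2) by ring.
apply: le_trans (ler_normB _ _) _.
apply: (@le_trans _ _ (value_const * ((T - t) * (d * (1 + z))))).
  have := M_le_sqr; have p0 : 0 <= (T - t) * (d * (1 + z)).
    by rewrite !mulr_ge0//; lra.
  move=> /(ler_wpM2r p0) hM; have : 0 <= r * ((T - t) * (d * (1 + z))).
    by rewrite mulr_ge0.
  by rewrite /value_const; lra.
rewrite -!mulrA ler_wpM2l ?value_const_ge0// ler_wpM2r//; last lra.
by rewrite mulr_ge0//; lra.
Qed.

(** Closeness within [d] makes the time derivatives differ by a fixed multiple of [d],
    which integrates to less than d / 2 because T is small.  The densities agree at time
    0 and the values at time T, so the former are compared forwards and the latter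
    backwards. *)
Lemma solutions_close_half d : 0 < d -> solutions_close d -> solutions_close (d / 2).
Proof.
move=> d0 cl t tT; have T0 : 0 < T by have := T_range; lra.
have rev s : 0 <= s <= T -> 0 <= T - s <= T by lra.
split.
  have H := @curve_growth R (@W1_bound R) T (fun t z => f1 z t - f2 z t)
    (fun t z => density_rate f1 S1 t z - density_rate f2 S2 t z)
    (d / 2 / T) ((4 * abar * M + 2 * M * drift_const) * d) (@W1_seminorm_bound R).
  have [BD BZ Bm _] := @W1_seminorm_bound R.
  apply: Bm (H _ _ _ _ _ _ t tT).
  - by rewrite mulrAC ler_pdivrMr// ler_wpM2l//; lra.
  - by rewrite mulr_ge0 ?addr_ge0 ?mulr_ge0 ?drift_const_ge0 ?abar_ge0 ?(ltW M_gt0) ?(ltW d0).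
  - rewrite ltr_pdivlMr//.
    have := ler_wpM2r (ltW d0) T_contract; lra.
  - move=> s sT e e0.
    have e20 : 0 < e / 2 by rewrite divr_gt0.
    have [da da0 Ha] := sol_density_continuous sol1 sT e20.
    have [db db0 Hb] := sol_density_continuous sol2 sT e20.
    exists (Order.min da db); first by rewrite lt_min da0.
    move=> s' s'T; rewrite lt_min => /andP[sa sb].
    have := BD _ _ _ _ (Ha s' s'T sa) (BZ (-1) _ _ (Hb s' s'T sb)).
    rewrite normrN1 mul1r (_ : e / 2 + e / 2 = e); last by lra.
    by congr W1_bound; apply/funext => z; ring.
  - move=> s sT e e0.
    have e20 : 0 < e / 2 by rewrite divr_gt0.
    have [da da0 Ha] := sol_density_derivative sol1 sT e20.
    have [db db0 Hb] := sol_density_derivative sol2 sT e20.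
    exists (Order.min da db); first by rewrite lt_min da0.
    move=> s' s'T s's; rewrite lt_min => /andP[sa sb].
    have := BD _ _ _ _ (Ha s' s'T s's sa) (BZ (-1) _ _ (Hb s' s'T s's sb)).
    rewrite normrN1 mul1r (_ : e / 2 + e / 2 = e); last by lra.
    by congr W1_bound; apply/funext => z; ring.
  - have [h0 _] := cl 0 ltac:(lra).
    have [j0 _] := h0; split => //.
    have [] := @in_W1_le _ 0 f0 (fun z => f1 z 0 - f2 z 0) f0_W1 (lexx _).
    + exact: in_W1_measurable.
    + apply: ae_halflineS (ae_halflineI (mfg_init sol1) (mfg_init sol2)) => z z0 [-> ->].
      by rewrite subrr normr0 mul0r.
    + by rewrite mul0r.
  - by move=> s sT _; apply: density_rate_diff => //; exact: ltW.
have H := @curve_growth R (@wbound R) T (fun s z => V1 z (T - s) - V2 z (T - s))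
  (fun s z => - (value_rate f1 V1 S1 (T - s) z - value_rate f2 V2 S2 (T - s) z))
  (d / 2) (value_const * T * d) (@wbound_seminorm_bound R).
have [BD BZ Bm _] := @wbound_seminorm_bound R.
have TK : T - (T - t) = t by ring.
have := H _ _ _ _ _ _ (T - t) (rev t tT); rewrite TK; apply.
- by rewrite !mulr_ge0 ?value_const_ge0 ?(ltW d0) ?(ltW T0).
- have := value_const_T => /(ler_wpM2r (ltW d0)).
  have : eps * d <= 1 * d by rewrite ler_wpM2r ?(ltW d0)//; have := eps_range; lra.
  lra.
- move=> s sT e e0.
  have e20 : 0 < e / 2 by rewrite divr_gt0.
  have [da da0 Ha] := sol_value_continuous sol1 (rev s sT) e20.
  have [db db0 Hb] := sol_value_continuous sol2 (rev s sT) e20.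
  exists (Order.min da db); first by rewrite lt_min da0.
  move=> s' s'T; rewrite lt_min => /andP[sa sb].
  have E : T - s' - (T - s) = - (s' - s) by ring.
  have := BD _ _ _ _ (Ha (T - s') (rev s' s'T) ltac:(by rewrite E normrN))
    (BZ (-1) _ _ (Hb (T - s') (rev s' s'T) ltac:(by rewrite E normrN))).
  rewrite normrN1 mul1r (_ : e / 2 + e / 2 = e); last by lra.
  by congr wbound; apply/funext => z; ring.
- move=> s sT e e0.
  have e20 : 0 < e / 2 by rewrite divr_gt0.
  have [da da0 Ha] := sol_value_derivative sol1 (rev s sT) e20.
  have [db db0 Hb] := sol_value_derivative sol2 (rev s sT) e20.
  exists (Order.min da db); first by rewrite lt_min da0.
  move=> s' s'T s's; rewrite lt_min => /andP[sa sb].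
  have E : T - s' - (T - s) = - (s' - s) by ring.
  have ne : T - s' != T - s by apply: contra s's => /eqP h; apply/eqP; lra.
  have n1 : s' - s != 0 by rewrite subr_eq0.
  have := BD _ _ _ _
    (BZ (-1) _ _ (Ha (T - s') (rev s' s'T) ne ltac:(by rewrite E normrN)))
    (Hb (T - s') (rev s' s'T) ne ltac:(by rewrite E normrN)).
  rewrite normrN1 mul1r (_ : e / 2 + e / 2 = e); last by lra.
  by congr wbound; apply/funext => z; rewrite E; field; rewrite n1.
- rewrite subr0; split.
    have [_ [h _]] := cl T ltac:(lra); exact: h.
  apply: ae_halflineS (ae_halflineI (mfg_final sol1) (mfg_final sol2)) => z z0 [-> ->].
  by rewrite subrr normr0 mul0r.
- move=> s sT _.
  have := BZ (-1) _ _ (value_rate_diff (ltW d0) cl (rev s sT)).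
  by rewrite normrN1 mul1r; congr wbound; apply/funext => z; rewrite mulN1r.
Qed.

(** Iterating [solutions_close_half] leaves distance 0; equality of the strategies then
    follows from that of the gains. *)
Theorem solutions_unique t : 0 <= t <= T -> ae_halfline (fun z =>
  [/\ f1 z t = f2 z t, V1 z t = V2 z t & S1 z t = S2 z t]).
Proof.
move=> tT.
have cl n : solutions_close (2 / 2 ^+ n).
  elim: n => [|n IH]; first by rewrite expr0 divr1; exact: solutions_close2.
  have p : 0 < 2 / 2 ^+ n :> R by rewrite divr_gt0// exprn_gt0.
  by have := solutions_close_half p IH; rewrite exprSr invfM mulrA.
have cl0 : solutions_close 0.
  move=> s sT; split.
    have [_ _ Bm Bc] := @W1_seminorm_bound R; apply: Bc => e e0.
    have [n ne] := geometric_small 2 e0; have [h _] := cl n s sT.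
    by apply: Bm h; rewrite add0r ltW.
  have [_ _ Bm Bc] := @wbound_seminorm_bound R; rewrite mul0r; apply: Bc => e e0.
  have [n ne] := geometric_small 2 e0; have [_ h] := cl n s sT.
  apply: Bm h; rewrite add0r; apply: le_trans _ (ltW ne).
  rewrite ler_piMr ?divr_ge0 ?exprn_ge0//; have := T_range; lra.
have [[jd Nd] bV] := cl0 t tT.
have cs := solutions_close_states (lexx 0) cl0 tT.
have feq : ae_halfline (fun z => f1 z t = f2 z t).
  have N0 : (\int[mu]_(z in halfline) `|((f1 z t - f2 z t) * (1 + z))%:E| = 0)%E.
    have := W1_normE jd; have -> : N1 (fun z => f1 z t - f2 z t) = 0.
      by apply/eqP; rewrite eq_le Nd N1_ge0.
    rewrite /W1_norm => E; rewrite -[RHS]E; apply: eq_integral => z.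
    rewrite inE halflineE => z0 /=.
    by rewrite normrM (@ger0_norm _ (1 + z))// addr_ge0.
  have mj : measurable_fun halfline (fun z => ((f1 z t - f2 z t) * (1 + z))%:E).
    by have /integrableP[] := jd.
  have := (@ae_eq_integral_abs _ _ _ mu _ measurable_halfline _ mj).1 N0.
  apply: ae_halflineS => z z0 /= /eqP.
  by rewrite eqe mulf_eq0 subr_eq0 orbC gt_eqF ?addr_gt0//= => /eqP.
apply: ae_halflineS (ae_halflineI (ae_halflineI feq bV.2) (ae_halflineI
  (ae_halflineI (sol_strategy sol1 tT) (sol_strategy sol2 tT))
  (close_right cs).2.2)) => z z0 [[fz Vz] [[-> ->] Wz]].
have Vz' : V1 z t = V2 z t.
  by move: Vz; rewrite !mul0r normr_le0 subr_eq0 => /eqP.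
have := close_gain_diff cs (ltW z0) Wz Vz.
rewrite mulr0 mul0r normr_le0 subr_eq0 => /eqP ->.
by split.
Qed.

End two_solutions.

End uniqueness.

End static_estimates.

(** * The initial density *)

Section initial_density.
Context {R : realType}.
Local Notation mu := (@lebesgue_measure R).
Implicit Types f g : R -> R.

(** The construction works with an f_0 that is bounded, nonnegative and measurable
    everywhere; changing f_0 on a null set does not affect the notion of
    solution. *)
Lemma regular_representative f : in_Linfty f ->
  ae_halfline (fun z => 0 <= f z) -> exists (g : R -> R) (K : R),
  [/\ measurable_fun setT g, forall z, 0 <= g z, forall z, g z <= K &
      ae_halfline (fun z => g z = f z)].
Proof.
move=> [mf foo] f0.
have [K K0 fK] : exists2 K : R, 0 <= K & ae_halfline (fun z => `|f z| <= K).
  have F : Filter (almost_everywhere mu) by exact: ae_filter_ringOfSetsType.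
  have H (K : R) : (Linfty_norm f <= K%:E)%E -> ae_halfline (fun z => `|f z| <= K).
    move=> /ess_supP; apply: (@filterS _ _ F) => z /[swap] hz.
    by rewrite patchE mem_set// lee_fin.
  move: foo; case E : (Linfty_norm f) => [x| |] // _.
    by exists `|x| => //; apply: H; rewrite E lee_fin ler_norm.
  by exists 0 => //; apply: H; rewrite E leNye.
exists ((fun z => Order.min (Order.max (f z) 0) K) \_ halfline), K; split.
- apply/(measurable_restrictT _ (@measurable_halfline R)).
  by apply: measurable_minr => //; exact: measurable_maxr.
- by move=> z; rewrite patchE; case: ifP => // _; rewrite le_min le_max lexx orbT.
- by move=> z; rewrite patchE; case: ifP => // _; rewrite ge_min lexx orbT.
- apply: ae_halflineS (ae_halflineI f0 fK) => z z0 [fz fzK].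
  rewrite patchE mem_set ?halflineE ?ltW// max_l// min_l//.
  exact: le_trans (ler_norm _) fzK.
Qed.

Section mean.
Variable g : R -> R.
Hypothesis g_W1 : in_W1 g.
Hypothesis g_ge0 : forall z, 0 <= g z.
Hypothesis g_mass : \int[mu]_(z in halfline) g z = 1.

Definition mean : R := \int[mu]_(y in halfline) (y * g y).

Lemma mean_integrable : mu.-integrable halfline (EFin \o (fun y => y * g y)).
Proof. exact: dominated_integrable (wbound_mul_dominated g_W1 ler01 wbound_idfun). Qed.

(** A vanishing mean would force all mass to sit at z = 0, a null set. *)
Lemma mean_gt0 : 0 < mean.
Proof.
have m0 : 0 <= mean.
  by apply: Rintegral_ge0 => y; rewrite halflineE => y0; rewrite mulr_ge0.
rewrite lt_neqAle m0 andbT eq_sym; apply/negP => /eqP mE.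
have mj : measurable_fun halfline (EFin \o (fun y => y * g y)).
  by have /integrableP[] := mean_integrable.
have N0 : (\int[mu]_(y in halfline) `|(y * g y)%R%:E| = 0)%E.
  have i := mean_integrable.
  have E : (\int[mu]_(y in halfline) (y * g y)%R%:E = 0)%E.
    have /fineK <- := @integrable_fin_num _ _ _ mu _ measurable_halfline _ i.
    by congr EFin.
  rewrite -[RHS]E; apply: eq_integral => y /set_mem; rewrite halflineE => y0 /=.
  by rewrite ger0_norm// mulr_ge0.
have := (@ae_eq_integral_abs _ _ _ mu _ measurable_halfline _ mj).1 N0 => ae0.
have ae1 : ae_halfline (fun z => (g z)%:E = 0%E).
  apply: ae_halflineS ae0 => z z0 /= /eqP.
  by rewrite eqe mulf_eq0 gt_eqF//= => /eqP ->.
have := g_mass; rewrite /Rintegral.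
rewrite (@ae_eq_integral _ _ _ mu _ (cst 0%E) _ measurable_halfline)//.
- by rewrite integral0/= => /esym/eqP; rewrite oner_eq0.
- by apply/measurable_EFinP; exact: in_W1_measurable.
Qed.

(** The positive part of y - z is at least y - z; integrate against g. *)
Lemma gain_id_ge z : 0 <= z -> mean - z <= gain g id z.
Proof.
move=> z0; have ig := W1_integrable g_W1.
have mt : measurable (`[z, +oo[%classic : set R) by exact: measurable_itv.
have ih : mu.-integrable halfline (EFin \o (fun y => y * g y - z * g y)).
  have i2 := @integrableB _ _ _ mu _ measurable_halfline _ _ mean_integrable
    (@integrableZl _ _ _ mu _ measurable_halfline z _ ig).
  exact: (@eq_integrable _ _ _ mu _ measurable_halfline _ _ _ i2).
have iz := @integrableZl _ _ _ mu _ measurable_halfline z _ ig.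
have -> : mean - z = \int[mu]_(y in halfline) (y * g y - z * g y).
  rewrite (@RintegralB _ _ _ mu _ _ _ measurable_halfline mean_integrable iz).
  by rewrite (@RintegralZl _ _ _ mu _ g z measurable_halfline ig) g_mass mulr1.
have -> : gain g id z = \int[mu]_(y in halfline) ((fun y => y * g y - z * g y) \_ `[z, +oo[) y.
  rewrite -Rintegral_mkcondr setIidr; last exact: tail_sub_halfline.
  rewrite (@RintegralB _ _ _ mu _ _ _ mt (tail_integrable z0 mean_integrable)
    (tail_integrable z0 iz)).
  by rewrite (@RintegralZl _ _ _ mu _ g z mt (tail_integrable z0 ig)).
have ir : mu.-integrable halfline
    (EFin \o ((fun y => y * g y - z * g y) \_ `[z, +oo[)).
  rewrite -restrict_EFin.
  apply/(@integrable_restrict _ _ _ mu _ mt _ measurable_halfline).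
  rewrite setIidr; last exact: tail_sub_halfline.
  exact: tail_integrable z0 ih.
apply: (@le_Rintegral _ _ _ mu _ _ _ measurable_halfline ih ir).
move=> y; rewrite halflineE => y0; rewrite patchE; case: ifPn => //.
rewrite notin_setE/= in_itv/= andbT => /negP; rewrite -ltNge => yz.
by rewrite -mulrBl mulr_le0_ge0// subr_le0 ltW.
Qed.

End mean.
End initial_density.

(** * Local well-posedness *)

Lemma small_time (R : realType) (c e T : R) : 0 <= c -> 0 <= T ->
  T <= e / (c + 1) -> c * T <= e.
Proof.
move=> c0 T0; have c1 : 0 < c + 1 by rewrite ltr_wpDl.
by rewrite ler_pdivlMr//; lra.
Qed.

Theorem theorem3p12 (R : realType) (f0 : R -> R) (r : R) (alpha : R -> R)
  (f0_Linfty : in_Linfty f0) (f0_W1 : in_W1 f0)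
  (f0_ge0 : ae_halfline (fun z => 0 <= f0 z))
  (f0_mass : (\int[@lebesgue_measure R]_(z in halfline) (f0 z)%:E = 1)%E)
  (r_gt0 : 0 < r)
  (alpha_ge0 : forall s, 0 <= s <= 1 -> 0 <= alpha s)
  (alpha_cont : {within `[0, 1], continuous alpha})
  (alpha_smooth : smooth_within `]0, 1] alpha)
  (alpha_mono : forall s s', 0 <= s -> s <= s' -> s' <= 1 -> alpha s <= alpha s')
  (alpha_0 : alpha 0 = 0)
  (alpha_deriv_0 : derive_within_n `]0, 1] 1 alpha s @[s --> 0^'+] --> +oo)
  (alpha_concave : forall s, 0 < s <= 1 -> derive_within_n `]0, 1] 2 alpha s < 0)
  (alpha_limit : exists l : R,
     derive_within_n `]0, 1] 1 alpha s ^+ 3 / derive_within_n `]0, 1] 2 alpha s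
       @[s --> 0^'+] --> l) :
  exists2 T0 : R, 0 < T0 & forall T : R, 0 < T <= T0 ->
    exists f V S : R -> R -> R,
      [/\ mfg_solution r alpha f0 T f V S,
          (forall t, 0 <= t <= T -> ae_halfline (fun z => 0 <= f z t)) &
          forall f' V' S' : R -> R -> R, mfg_solution r alpha f0 T f' V' S' ->
            forall t, 0 <= t <= T ->
              ae_halfline (fun z => [/\ f' z t = f z t, V' z t = V z t &
                                        S' z t = S z t])].
Proof.
have [sigma [L [L_gt0 sigma_spec sigma_homo lip lip_pos]]] := optimal_policy
  alpha_ge0 alpha_cont alpha_smooth alpha_mono alpha_0 alpha_deriv_0
  alpha_concave alpha_limit.
have sigma_argmax b := (sigma_spec b).1.
have sigma_unique b := (sigma_spec b).2.
have [g [K [mg g_ge0 g_le gf]]] := regular_representative f0_Linfty f0_ge0.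
have [g_W1 _] : in_W1 g /\ N1 g <= 1 * N1 f0.
  apply: in_W1_le => //; first exact: measurable_funTS.
  by apply: (ae_halflineS _ gf) => z z0 ->; rewrite mul1r.
have g_mass : \int[@lebesgue_measure R]_(z in halfline) g z = 1.
  have E : (\int[@lebesgue_measure R]_(z in halfline) (g z)%:E = 1)%E.
    rewrite -f0_mass; apply: ae_eq_integral.
    - exact: measurable_halfline.
    - by apply/measurable_EFinP; exact: measurable_funTS.
    - by apply/measurable_EFinP; exact: f0_Linfty.1.
    - by apply: (ae_halflineS _ gf) => z z0 ->.
  by rewrite /Rintegral E.
set m := mean g; set M := 1 + N1 g.
have m_gt0 : 0 < m by exact: mean_gt0.
have g_gain z : 0 <= z -> m - z <= gain g id z by exact: gain_id_ge.
have M_ge1 : 1 <= M by rewrite /M lerDl N1_ge0.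
have M_gt0 : 0 < M by exact: lt_le_trans M_ge1.
have M_ge0 := ltW M_gt0.
have g_M : N1 g <= M by rewrite /M lerDr.
pose abar := alpha 1.
have alpha_range s : 0 <= s <= 1 -> 0 <= alpha s <= abar.
  by move=> s01; rewrite alpha_ge0// alpha_mono//; lra.
have abar0 : 0 <= abar by apply: alpha_ge0; rewrite ler01 lexx.
(* The tolerances that keep the gain above (T - t) m / 4 for small z. *)
pose eta0 := Order.min 1 (m / 16).
pose eps := Order.min 1 (m / (32 * M)).
have eta0_gt0 : 0 < eta0 by rewrite lt_min ltr01 divr_gt0.
have eps_gt0 : 0 < eps by rewrite lt_min ltr01 divr_gt0// mulr_gt0.
have eta0_range : 0 <= eta0 <= 1 by rewrite ltW//= ge_min lexx.
have eps_range : 0 <= eps <= 1 by rewrite ltW//= ge_min lexx.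
have eta0_m : 16 * eta0 <= m.
  by rewrite mulrC -ler_pdivlMr// ge_min lexx orbT.
have eps_m : 32 * M * eps <= m.
  by rewrite mulrC -ler_pdivlMr ?mulr_gt0// ge_min lexx orbT.
(* T times c1 and c2 bounds the drift away from (f_0, (T - t) z), and T times c3
   the contraction factor. *)
pose c1 := 16 * abar * M ^+ 2.
pose c2 := 4 * (2 * r + 8 * abar * M ^+ 2).
pose c3 := 4 * (4 * abar * M + 2 * M * drift_const L abar m M).
have M2_ge0 : 0 <= abar * M ^+ 2 by apply: mulr_ge0 => //; exact: exprn_ge0.
have d_ge0 : 0 <= M * drift_const L abar m M.
  apply: mulr_ge0 => //.
  exact (drift_const_ge0 L_gt0 alpha_range sigma_argmax g_M M_ge1 m_gt0
    eta0_range eta0_m eps_range eps_m).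
have aM_ge0 : 0 <= abar * M by rewrite mulr_ge0.
have c1_ge0 : 0 <= c1 by rewrite /c1; lra.
have c2_ge0 : 0 <= c2 by rewrite /c2; lra.
have c3_ge0 : 0 <= c3 by rewrite /c3; lra.
have gt0 e c : 0 < e -> 0 <= c -> 0 < e / (c + 1) :> R.
  by move=> e0 c0; rewrite divr_gt0// ltr_wpDl.
exists (Order.min 1 (Order.min (eta0 / (c1 + 1))
  (Order.min (eps / (c2 + 1)) (1 / (c3 + 1))))).
  by rewrite !lt_min ltr01 !gt0.
move=> T /andP[T_gt0]; rewrite !le_min => /and4P[T_le1 T1 T2 T3].
have T_range : 0 < T <= 1 by rewrite T_gt0.
have T_density : c1 * T <= eta0 by apply: small_time => //; exact: ltW.
have T_value : c2 * T <= eps by apply: small_time => //; exact: ltW.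
have T_contract : c3 * T <= 1 by apply: small_time => //; exact: ltW.
have sigma_meas : measurable_fun setT sigma by exact: nondecreasing_measurable.
have rate_meas : measurable_fun setT (fun b => alpha (sigma b)).
  apply: nondecreasing_measurable => // b b' bb'.
  have [/andP[s0 _] _] := sigma_argmax b; have [/andP[_ s1] _] := sigma_argmax b'.
  by apply: alpha_mono => //; exact: sigma_homo.
have [f [V [S [sol f_ge0]]]] := solution_exists L_gt0 alpha_range sigma_argmax
  lip lip_pos g_W1 g_M M_ge1 m_gt0 g_gain eta0_range eta0_m eps_range eps_m
  (ltW r_gt0) T_range sigma_meas rate_meas T_density T_value T_contract
  mg g_ge0 g_le.
have init f1 V1 S1 : mfg_solution r alpha f0 T f1 V1 S1 ->
    mfg_solution r alpha g T f1 V1 S1.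
  case=> h1 h2 h3 h4 h5 h6 h7 h8 h9; split => //.
  by apply: ae_halflineS (ae_halflineI h8 gf) => z z0 [-> ->].
exists f, V, S; split => //.
  case: sol => h1 h2 h3 h4 h5 h6 h7 h8 h9; split => //.
  by apply: ae_halflineS (ae_halflineI h8 gf) => z z0 [-> ->].
move=> f' V' S' /init sol' t tT.
exact: (solutions_unique L_gt0 alpha_range sigma_argmax lip lip_pos g_W1 g_M
  M_ge1 m_gt0 g_gain eta0_range eta0_m eps_range eps_m (ltW r_gt0) T_range
  T_density T_value T_contract sigma_unique alpha_mono eta0_gt0 eps_gt0
  sol' sol tT).
Qed.
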